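(* Let $w_1,w_2:\mathbb{R}\to\mathbb{R}$ be fixed smooth, compactly supported functions, with the support of $w_1$ contained in $(0,\infty)$. For every $\varepsilon>0$ and every constant $c_0>0$ there is a constant $C=C(\varepsilon,c_0,w_1,w_2)>0$ such that for all real numbers $N\ge 1$ and $X>0$ with $N\ge c_0X^{1/2}$, setting $M=N^{2/3}$, we have $$\Big|T_S(N,X)-\frac{XM}{N}\,\widehat{w_1}(0)\,\widehat{w_2}(0)\Big|\le C\big(N^{1/3+\varepsilon}+X^{1/2}N^{\varepsilon}\big).$$
   Context: For real $N\ge1$, $X>0$, put $M=N^{2/3}$ and $Z=N/X$. The smoothed counting function is $$T_S(N,X)=\sum_{m,n\in\mathbb{Z}}w_1\Big(\frac{m}{M}\Big)\,w_2\big(Z(n-m^{3/2})\big),$$ where terms with $m\le 0$ contribute $0$ because $w_1$ is supported in $(0,\infty)$. Here $\widehat{w_i}(0)=\int_{-\infty}^{\infty}w_i(x)\,dx$. *)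

(* Defs.v *)
From Stdlib Require Import Reals ZArith.
From Coquelicot Require Import Coquelicot.

Local Open Scope R_scope.

Definition smooth (w : R -> R) : Prop :=
  forall (k : nat) (x : R), ex_derive_n w k x.

Definition support (w : R -> R) : R -> Prop :=
  Rtopology.adherence (fun x => w x <> 0).

Definition compactly_supported (w : R -> R) : Prop :=
  Rtopology.compact (support w).

(* The value at 0 of the Fourier transform of w, an improper Riemann integral
   over the whole line. *)
Definition fourier_at_0 (w : R -> R) : R :=
  RInt_gen w (Rbar_locally m_infty) (Rbar_locally p_infty).

(* [Series] is total, with a junk value on divergent series.  Every sum over Z
   formed below has only finitely many nonzero terms once w1 and w2 have
   compact support and N, X > 0. *)
Definition sum_Z (f : Z -> R) : R :=
  Series (fun k : nat => f (Z.of_nat k)) +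
  Series (fun k : nat => f (- Z.of_nat (S k))%Z).

(* For m <= 0, [Rpower (IZR m) (3/2)] is a junk value, but such terms vanish
   because of the factor w1 when the support of w1 lies in (0, +oo). *)
Definition T_S (w1 w2 : R -> R) (N X : R) : R :=
  let M := Rpower N (2 / 3) in
  let Z := N / X in
  sum_Z (fun m => sum_Z (fun n =>
    w1 (IZR m / M) * w2 (Z * (IZR n - Rpower (IZR m) (3 / 2))))).

(* Main.v *)
From Stdlib Require Import Reals Lra ZArith Lia.
From Coquelicot Require Import Coquelicot.
From HB Require Import structures.
From mathcomp Require Import all_boot zify.
Require Import Defs.

(** Put [T = N^(1/3)] and [s = N / X], so that [M = T^2] and the sum counts the
    pairs with [m] about [T^2] and [n] within about [1/s] of [m^(3/2)].  The
    statement is one of equidistribution modulo 1 of the numbers [m^(3/2)], at a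
    scale that may be as fine as [1/T], and it rests on the exponential sums
    [E(k) = sum_m g(m / T^2) e(k m^(3/2))] with [1 <= k <= T].

    The second-derivative test alone is not strong enough for these sums; what
    saves the argument is the exact shape of [m^(3/2)].  With [q = 9 k^2] and
    [Y = q m], [k m^(3/2) = Y^(3/2) / (3 q)].  The condition that [q] divides [Y]
    is detected by additive characters modulo [q], and [Y] is cut into ranges
    where [sqrt Y] is close to [2 l]; there the only frequencies that resonate
    are [h - l] with [h] small.  Expanding around [Y = 4 l^2] splits off the
    phase [(- 4 l^3 / 3 + 4 h l^2) / q] and leaves a local sum [bsum] which is a
    smooth function of [l] ([Esum_stationary]).  The local sums are bounded by
    the Kusmin-Landau inequality and the second-derivative test, together with
    their derivatives in [l] ([bsum_bounds]).  Now write [l = r + 9 k z]: modulo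
    1 the phase is linear in [z], with slope [(8 h r - 4 r^2) / k], so the sum
    over [z] is a geometric sum with a slowly varying weight ([geometric_abel]).
    The outcome, [Esum_bound], is [|E(k)| <= C T^(3/2) k^(-1/2) S(k)], where [S]
    is the sum [arith_sum] over [h] and [r].  On average over [k] it is
    [k^o(1)] ([arith_average]): after exchanging the sums one counts the
    [k] that divide a given integer, and [divisor_bound] applies.

    The passage from [E(k)] to the count uses the Fejer kernel of order [K] about
    [T].  Its positivity gives an upper bound for the number of [m] with
    [m^(3/2)] within [d] of a translate of the integers, of size
    [T^(1+eps) (1 + d T)] ([density]).  When [s > T] this bound is itself of the
    size of the admissible error ([count_narrow]).  When [s <= T], the bump
    summed over [n] is replaced by its convolution with the kernel; the error is
    controlled by [density] ([smoothing_error]), and what remains is a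
    trigonometric polynomial in [m^(3/2)] of degree less than [K]
    ([smoothed_main]).  Its constant term gives the main term, through Riemann
    sums, up to [O(1 + 1/s)].  Its other coefficients are [O((s k)^(-1/2))], so
    that they contribute at most [T^(3/2 + eps) s^(-1/2)], which is
    [X^(1/2) N^(eps/3)] because [T^3 = N = s X] ([count_wide]).  Finally
    [1/s = X/N] is at most [X^(1/2) / c0] by the hypothesis on [N] and [X]. *)

Set Implicit Arguments.
Unset Strict Implicit.
Unset Printing Implicit Defensive.

Delimit Scope R_scope with R.
Local Open Scope R_scope.

Arguments Rle_trans [r1 r2 r3] _ _.
Arguments Rlt_le_trans [r1 r2 r3] _ _.
Arguments Rle_lt_trans [r1 r2 r3] _ _.
Arguments Rplus_le_compat [r1 r2 r3 r4] _ _.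
Arguments Rmult_le_compat_l r [r1 r2] _ _.
Arguments Rmult_le_compat_r r [r1 r2] _ _.
Arguments Rmult_le_compat [r1 r2 r3 r4] _ _ _ _.

(** * Finite sums in R and C, and sums over integer intervals *)

HB.instance Definition _ := Monoid.isComLaw.Build R 0 Rplus
  (fun x y z => esym (Rplus_assoc x y z)) Rplus_comm Rplus_0_l.
HB.instance Definition _ := Monoid.isMulLaw.Build R 0 Rmult Rmult_0_l Rmult_0_r.
HB.instance Definition _ := Monoid.isAddLaw.Build R Rmult Rplus
  Rmult_plus_distr_r Rmult_plus_distr_l.

Fact Cmult_0_l' (x : C) : Cmult (RtoC 0) x = RtoC 0.
Proof. ring. Qed.
Fact Cmult_0_r' (x : C) : Cmult x (RtoC 0) = RtoC 0.
Proof. ring. Qed.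
Fact Cmult_distr_r (x y z : C) :
  Cmult (Cplus x y) z = Cplus (Cmult x z) (Cmult y z).
Proof. ring. Qed.
Fact Cmult_distr_l (x y z : C) :
  Cmult x (Cplus y z) = Cplus (Cmult x y) (Cmult x z).
Proof. ring. Qed.

HB.instance Definition _ := Monoid.isComLaw.Build C (RtoC 0) Cplus
  Cplus_assoc Cplus_comm Cplus_0_l.
HB.instance Definition _ := Monoid.isMulLaw.Build C (RtoC 0) Cmult
  Cmult_0_l' Cmult_0_r'.
HB.instance Definition _ := Monoid.isAddLaw.Build C Cmult Cplus
  Cmult_distr_r Cmult_distr_l.

Section NatSum.
Variables (T : Type) (idx : T) (op : Monoid.com_law idx).

(** A constant rather than the bare iterated operation, so that a sum is an
    atom for linear arithmetic. *)
Definition gsum (n : nat) (f : nat -> T) : T := \big[op/idx]_(i < n) f i.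

Lemma gsum_0 f : gsum 0 f = idx.
Proof. by rewrite /gsum big_ord0. Qed.

Lemma gsum_recr n f : gsum n.+1 f = op (gsum n f) (f n).
Proof. by rewrite /gsum big_ord_recr. Qed.

Lemma gsum_eq n f g :
  (forall i, (i < n)%coq_nat -> f i = g i) -> gsum n f = gsum n g.
Proof. by move=> H; apply: eq_bigr => i _; apply: H; apply/ltP. Qed.

Lemma gsum_idx n f :
  (forall i, (i < n)%coq_nat -> f i = idx) -> gsum n f = idx.
Proof. by move=> H; rewrite /gsum big1 // => i _; apply: H; apply/ltP. Qed.

Lemma gsum_cat n m f :
  gsum (n + m) f = op (gsum n f) (gsum m (fun i => f (n + i)%N)).
Proof. by rewrite /gsum big_split_ord. Qed.

Lemma gsum_split n f g :
  gsum n (fun i => op (f i) (g i)) = op (gsum n f) (gsum n g).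
Proof. by rewrite /gsum big_split. Qed.

Lemma gsum_exchange n m (f : nat -> nat -> T) :
  gsum n (fun i => gsum m (fun j => f i j)) =
  gsum m (fun j => gsum n (fun i => f i j)).
Proof. by rewrite /gsum exchange_big. Qed.

End NatSum.

Notation rsum := (@gsum R 0 Rplus).
Notation csum := (@gsum C (RtoC 0) Cplus).
Notation "\rsum_ ( i < n ) F" := (rsum n (fun i => F%R))
  (at level 41, F at level 41, i, n at level 50,
   format "'[' \rsum_ ( i  <  n ) '/  '  F ']'").
Notation "\csum_ ( i < n ) F" := (csum n (fun i => F%C))
  (at level 41, F at level 41, i, n at level 50,
   format "'[' \csum_ ( i  <  n ) '/  '  F ']'").

Lemma rsum_le n (f g : nat -> R) :
  (forall i, (i < n)%coq_nat -> f i <= g i) ->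
  \rsum_(i < n) f i <= \rsum_(i < n) g i.
Proof.
elim: n => [|n IH] H; first by rewrite !gsum_0; lra.
rewrite !gsum_recr /=; have := H n ltac:(lia).
by have := IH (fun i hi => H i ltac:(lia)); lra.
Qed.

Lemma rsum_ge0 n (f : nat -> R) :
  (forall i, (i < n)%coq_nat -> 0 <= f i) -> 0 <= \rsum_(i < n) f i.
Proof.
elim: n => [|n IH] H; first by rewrite !gsum_0; lra.
rewrite !gsum_recr /=; have := H n ltac:(lia).
by have := IH (fun i hi => H i ltac:(lia)); lra.
Qed.

Lemma rsum_const n c : \rsum_(i < n) c = INR n * c.
Proof.
elim: n => [|n IH]; first by rewrite gsum_0 /=; ring.
by rewrite gsum_recr IH S_INR /=; ring.
Qed.

Lemma rsum_scal n c (f : nat -> R) :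
  \rsum_(i < n) (c * f i) = c * \rsum_(i < n) f i.
Proof. by rewrite /gsum big_distrr. Qed.

Lemma csum_scal n c (f : nat -> C) :
  \csum_(i < n) (c * f i) = (c * \csum_(i < n) f i)%C.
Proof. by rewrite /gsum big_distrr. Qed.

Lemma rsum_le_const n c (f : nat -> R) :
  (forall i, (i < n)%coq_nat -> f i <= c) -> \rsum_(i < n) f i <= INR n * c.
Proof. by move=> H; rewrite -rsum_const; apply: (@rsum_le n f (fun=> c)). Qed.

Lemma rsum_ge_term n (f : nat -> R) j :
  (j < n)%coq_nat -> (forall i, (i < n)%coq_nat -> 0 <= f i) ->
  f j <= \rsum_(i < n) f i.
Proof.
elim: n => [|n IH] jn H; first by lia.
rewrite gsum_recr /=; have h := H n ltac:(lia).
case: (Nat.eq_dec j n) => [->|jn']; last first.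
  by have := IH ltac:(lia) (fun i hi => H i ltac:(lia)); lra.
have := @rsum_ge0 n f (fun i hi => H i ltac:(lia)); lra.
Qed.

Lemma Cmod_csum n (f : nat -> C) :
  Cmod (\csum_(i < n) f i) <= \rsum_(i < n) Cmod (f i).
Proof.
elim: n => [|n IH]; first by rewrite !gsum_0 Cmod_0; lra.
by rewrite !gsum_recr; apply: (Rle_trans (Cmod_triangle _ _)) => /=; lra.
Qed.

Lemma Cmod_csum_le n (f : nat -> C) (g : nat -> R) :
  (forall i, (i < n)%coq_nat -> Cmod (f i) <= g i) ->
  Cmod (\csum_(i < n) f i) <= \rsum_(i < n) g i.
Proof. by move=> H; exact: (Rle_trans (@Cmod_csum n f) (@rsum_le n (fun i => Cmod (f i)) g H)). Qed.

Lemma Rabs_rsum n (f : nat -> R) :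
  Rabs (\rsum_(i < n) f i) <= \rsum_(i < n) Rabs (f i).
Proof.
elim: n => [|n IH]; first by rewrite !gsum_0 Rabs_R0; lra.
by rewrite !gsum_recr; apply: (Rle_trans (Rabs_triang _ _)) => /=; lra.
Qed.

Lemma Cmod_Ci : Cmod Ci = 1.
Proof. by rewrite /Cmod /= Rmult_0_l Rplus_0_l Rmult_1_l Rmult_1_r sqrt_1. Qed.

Lemma Re_csum n (f : nat -> C) : Re (\csum_(i < n) f i) = \rsum_(i < n) Re (f i).
Proof. by rewrite /gsum (big_morph Re (id1 := 0) (op1 := Rplus)). Qed.

Lemma Im_csum n (f : nat -> C) : Im (\csum_(i < n) f i) = \rsum_(i < n) Im (f i).
Proof. by rewrite /gsum (big_morph Im (id1 := 0) (op1 := Rplus)). Qed.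

Lemma RtoC_rsum n (f : nat -> R) :
  RtoC (\rsum_(i < n) f i) = \csum_(i < n) RtoC (f i).
Proof.
elim: n => [|n IH]; first by rewrite !gsum_0.
by rewrite !gsum_recr /= RtoC_plus IH.
Qed.

Section ZSum.
Variables (T : Type) (idx : T) (op : Monoid.com_law idx).

Definition zsum (a : Z) (n : nat) (f : Z -> T) : T :=
  gsum op n (fun i => f (a + Z.of_nat i)%Z).

Lemma zsum_shift a n c f :
  zsum a n (fun z => f (z + c)%Z) = zsum (a + c) n f.
Proof. by apply: gsum_eq => i _; congr f; lia. Qed.

Lemma zsum_cat a n m f :
  zsum a (n + m) f = op (zsum a n f) (zsum (a + Z.of_nat n) m f).
Proof.
rewrite /zsum gsum_cat; congr (op _ _).
by apply: gsum_eq => i _; congr f; lia.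
Qed.

Lemma zsum_eq a n f g :
  (forall z, (a <= z < a + Z.of_nat n)%Z -> f z = g z) ->
  zsum a n f = zsum a n g.
Proof. by move=> H; apply: gsum_eq => i Hi; rewrite H //; lia. Qed.

Lemma zsum_idx a n f :
  (forall z, (a <= z < a + Z.of_nat n)%Z -> f z = idx) -> zsum a n f = idx.
Proof. by move=> H; apply: gsum_idx => i Hi; rewrite H //; lia. Qed.

Lemma zsum_widen a n a' n' f :
  (forall z, (z < a \/ a + Z.of_nat n <= z)%Z -> f z = idx) ->
  (a' <= a)%Z -> (a + Z.of_nat n <= a' + Z.of_nat n')%Z ->
  zsum a' n' f = zsum a n f.
Proof.
move=> H le1 le2.
have -> : n' = (Z.to_nat (a - a') + (n + Z.to_nat (a' + Z.of_nat n' - (a + Z.of_nat n))))%N by lia.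
rewrite !zsum_cat zsum_idx; last by move=> z Hz; rewrite H //; lia.
rewrite Monoid.mul1m (_ : (a' + _)%Z = a); last by lia.
by rewrite [X in op _ X]zsum_idx ?Monoid.mulm1 // => z Hz; rewrite H //; lia.
Qed.

Lemma zsum_window a n a' n' f :
  (forall z, (z < a \/ a + Z.of_nat n <= z)%Z -> f z = idx) ->
  (forall z, (z < a' \/ a' + Z.of_nat n' <= z)%Z -> f z = idx) ->
  zsum a n f = zsum a' n' f.
Proof.
move=> H H'; pose b := Z.min a a'.
pose m := Z.to_nat (Z.max (a + Z.of_nat n) (a' + Z.of_nat n') - b).
rewrite -(@zsum_widen a n b m) //; try by rewrite /m /b; lia.
by apply: zsum_widen => //; rewrite /m /b; lia.
Qed.

Lemma zsum_block a n d f :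
  zsum a (n * d) f =
  gsum op n (fun i => zsum (a + Z.of_nat i * Z.of_nat d) d f).
Proof.
elim: n => [|n IH]; first by rewrite mul0n /zsum !gsum_0.
rewrite mulSn addnC zsum_cat IH gsum_recr.
by rewrite (_ : (a + Z.of_nat (n * d) = a + Z.of_nat n * Z.of_nat d)%Z) //; lia.
Qed.

Lemma zsum_split a n f g :
  zsum a n (fun z => op (f z) (g z)) = op (zsum a n f) (zsum a n g).
Proof. by rewrite /zsum gsum_split. Qed.

Lemma zsum_exchange a n b m (f : Z -> Z -> T) :
  zsum a n (fun x => zsum b m (fun y => f x y)) =
  zsum b m (fun y => zsum a n (fun x => f x y)).
Proof. by rewrite /zsum gsum_exchange. Qed.

Lemma zsum_exchange_nat a n m (f : nat -> Z -> T) :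
  zsum a n (fun x => gsum op m (fun i => f i x)) =
  gsum op m (fun i => zsum a n (f i)).
Proof. by rewrite /zsum gsum_exchange. Qed.

Lemma zsum_nat n f : zsum 0 n f = gsum op n (fun i => f (Z.of_nat i)).
Proof. by apply: gsum_eq => i _; congr f; lia. Qed.

End ZSum.

Notation rzsum := (@zsum R 0 Rplus).
Notation czsum := (@zsum C (RtoC 0) Cplus).

Lemma rzsum_le a n (f g : Z -> R) :
  (forall z, (a <= z < a + Z.of_nat n)%Z -> f z <= g z) ->
  rzsum a n f <= rzsum a n g.
Proof.
by move=> H; apply: (@rsum_le n (fun i => f (a + Z.of_nat i)%Z)
  (fun i => g (a + Z.of_nat i)%Z)) => i Hi; apply: H; lia.
Qed.

Lemma rzsum_ge0 a n (f : Z -> R) :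
  (forall z, (a <= z < a + Z.of_nat n)%Z -> 0 <= f z) -> 0 <= rzsum a n f.
Proof.
by move=> H; apply: (@rsum_ge0 n (fun i => f (a + Z.of_nat i)%Z)) => i Hi;
  apply: H; lia.
Qed.

Lemma rzsum_scal c a n (f : Z -> R) :
  rzsum a n (fun z => c * f z) = c * rzsum a n f.
Proof. by rewrite /zsum /gsum big_distrr. Qed.

Lemma czsum_scal c a n (f : Z -> C) :
  czsum a n (fun z => c * f z)%C = (c * czsum a n f)%C.
Proof. by rewrite /zsum /gsum big_distrr. Qed.

Lemma rzsum_const a n c : rzsum a n (fun _ => c) = INR n * c.
Proof. exact: rsum_const. Qed.

Lemma Cmod_czsum_le a n (f : Z -> C) (g : Z -> R) :
  (forall z, (a <= z < a + Z.of_nat n)%Z -> Cmod (f z) <= g z) ->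
  Cmod (czsum a n f) <= rzsum a n g.
Proof.
by move=> H; apply: (@Cmod_csum_le n (fun i => f (a + Z.of_nat i)%Z)
  (fun i => g (a + Z.of_nat i)%Z)) => i Hi; apply: H; lia.
Qed.

Lemma Rabs_rzsum_le a n (f g : Z -> R) :
  (forall z, (a <= z < a + Z.of_nat n)%Z -> Rabs (f z) <= g z) ->
  Rabs (rzsum a n f) <= rzsum a n g.
Proof.
move=> H; apply: Rle_trans (@Rabs_rsum n (fun i => f (a + Z.of_nat i)%Z)) _.
exact: (@rzsum_le a n (fun z => Rabs (f z))).
Qed.

Lemma rzsum_ge_term a n (f : Z -> R) j :
  (a <= j < a + Z.of_nat n)%Z ->
  (forall z, (a <= z < a + Z.of_nat n)%Z -> 0 <= f z) -> f j <= rzsum a n f.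
Proof.
move=> Hj H.
have := @rsum_ge_term n (fun i => f (a + Z.of_nat i)%Z) (Z.to_nat (j - a)).
rewrite (_ : (a + Z.of_nat (Z.to_nat (j - a)))%Z = j); last by lia.
by apply; [lia | move=> i Hi; apply: H; lia].
Qed.

Lemma RtoC_rzsum a n (f : Z -> R) :
  RtoC (rzsum a n f) = czsum a n (fun z => RtoC (f z)).
Proof. exact: (@RtoC_rsum n (fun i => f (a + Z.of_nat i)%Z)). Qed.

Lemma rzsum_incl a n a' n' (f : Z -> R) :
  (forall z, (a' <= z < a' + Z.of_nat n')%Z -> 0 <= f z) ->
  (a' <= a)%Z -> (a + Z.of_nat n <= a' + Z.of_nat n')%Z ->
  rzsum a n f <= rzsum a' n' f.
Proof.
move=> H le1 le2.
have -> : n' = (Z.to_nat (a - a') + (n + Z.to_nat (a' + Z.of_nat n' - (a + Z.of_nat n))))%N by lia.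
rewrite !zsum_cat (_ : (a' + Z.of_nat (Z.to_nat _))%Z = a); last by lia.
have h1 := @rzsum_ge0 a' (Z.to_nat (a - a')) f.
have h2 := @rzsum_ge0 (a + Z.of_nat n) (Z.to_nat (a' + Z.of_nat n' - (a + Z.of_nat n))) f.
have {}h1 := h1 (fun z hz => H z ltac:(lia)).
have {}h2 := h2 (fun z hz => H z ltac:(lia)).
by rewrite /=; lra.
Qed.

(** * Exponential sums: the Kusmin-Landau and second-derivative tests *)

Definition ec (x : R) : C := (cos (2 * PI * x), sin (2 * PI * x)).

Lemma ec_plus x y : ec (x + y) = (ec x * ec y)%C.
Proof.
rewrite /ec /Cmult /= Rmult_plus_distr_l cos_plus sin_plus.
by congr pair; ring.
Qed.

Lemma ec_0 : ec 0 = RtoC 1.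
Proof. by rewrite /ec Rmult_0_r cos_0 sin_0. Qed.

Lemma Cmod_ec x : Cmod (ec x) = 1.
Proof.
rewrite /Cmod /ec /=.
have := sin2_cos2 (2 * PI * x); rewrite /Rsqr => H.
by rewrite (_ : _ + _ = 1) ?sqrt_1 //; lra.
Qed.

Lemma ec_INR n : ec (INR n) = RtoC 1.
Proof.
rewrite /ec (_ : 2 * PI * INR n = 0 + 2 * INR n * PI); last by ring.
by rewrite cos_period sin_period cos_0 sin_0.
Qed.

Lemma ec_opp x : ec (- x) = Cconj (ec x).
Proof.
by rewrite /ec /Cconj /= (_ : 2 * PI * - x = - (2 * PI * x)) ?cos_neg ?sin_neg //; ring.
Qed.

Lemma ec_IZR z : ec (IZR z) = RtoC 1.
Proof.
case: (Z_le_dec 0 z) => Hz.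
  by rewrite -(Z2Nat.id z Hz) -INR_IZR_INZ ec_INR.
rewrite (_ : IZR z = - IZR (Z.of_nat (Z.to_nat (- z)))).
  by rewrite -INR_IZR_INZ ec_opp ec_INR /Cconj /= Ropp_0.
by rewrite -opp_IZR; congr IZR; lia.
Qed.

Lemma ec_plusZ x z : ec (x + IZR z) = ec x.
Proof. by rewrite ec_plus ec_IZR; ring. Qed.

Lemma ec_int_diff x y z : x = y + IZR z -> ec x = ec y.
Proof. by move=> ->; rewrite ec_plusZ. Qed.

Lemma csum_abel n (A u : nat -> C) :
  \csum_(i < n.+1) (A i * u i) =
  (A n * (\csum_(i < n.+1) u i)
   - \csum_(j < n) ((A j.+1 - A j) * (\csum_(i < j.+1) u i)))%C.
Proof.
elim: n => [|n IH].
  by rewrite !gsum_recr !gsum_0 /=; ring.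
rewrite gsum_recr IH [X in _ = (_ * X - _)%C]gsum_recr [X in _ = (_ - X)%C]gsum_recr /=.
by ring.
Qed.

(** Summation by parts: every increment of the weight [A] multiplies a partial
    sum of [u], and these are all at most [B]. *)
Lemma abel_ineq n (A u : nat -> C) B :
  (forall j, (j <= n)%coq_nat -> Cmod (\csum_(i < j.+1) u i) <= B) ->
  Cmod (\csum_(i < n.+1) (A i * u i)) <=
  B * (Cmod (A n) + \rsum_(i < n) Cmod (A i.+1 - A i)%C).
Proof.
move=> H; rewrite csum_abel.
apply: (Rle_trans (Cmod_triangle _ _)).
rewrite Cmod_opp Cmod_mult Rmult_plus_distr_l.
apply: Rplus_le_compat.
  by rewrite Rmult_comm; apply: Rmult_le_compat_r; [exact: Cmod_ge_0 | apply: H].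
rewrite -rsum_scal.
apply: (@Cmod_csum_le n _ (fun i => B * Cmod (A i.+1 - A i)%C)) => i Hi.
rewrite Cmod_mult Rmult_comm.
by apply: Rmult_le_compat_r; [exact: Cmod_ge_0 | apply: H; lia].
Qed.

Lemma abel_ineq_lip n (A u : nat -> C) B a d :
  (forall j, (j <= n)%coq_nat -> Cmod (\csum_(i < j.+1) u i) <= B) ->
  Cmod (A n) <= a ->
  (forall i, (i < n)%coq_nat -> Cmod (A i.+1 - A i)%C <= d) ->
  Cmod (\csum_(i < n.+1) (A i * u i)) <= B * (a + INR n * d).
Proof.
move=> H Ha Hd; apply: (Rle_trans (abel_ineq A H)).
apply: Rmult_le_compat_l.
  by apply: (Rle_trans (Cmod_ge_0 _) (H 0%N _)); lia.
by apply: Rplus_le_compat => //; apply: (@rsum_le_const n d (fun i => Cmod (A i.+1 - A i)%C)).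
Qed.

Definition cotpi (t : R) := cos (PI * t) / sin (PI * t).

Lemma sin_ge_half x : 0 <= x <= 1 -> x / 2 <= sin x.
Proof.
move=> Hx; have Hpi := PI2_3_2; have HpiU := PI_4.
case: (Req_dec x 0) => [->|x0]; first by rewrite sin_0; lra.
have [c [Hc1 Hc2]] := MVT_cor2 sin cos 0 x ltac:(lra) (fun c _ => derivable_pt_lim_sin c).
rewrite sin_0 !Rminus_0_r in Hc1; rewrite Hc1.
suff : 1 / 2 <= cos c by nra.
by rewrite -cos_PI3; apply: cos_decr_1; lra.
Qed.

Lemma sin_pi_ge d t : 0 < d -> d <= t <= 1 - d -> d / 2 <= sin (PI * t).
Proof.
move=> Hd Ht; have Hpi := PI2_1.
wlog Ht2 : t Ht / t <= 1 / 2.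
  move=> W; case: (Rle_dec t (1/2)) => h; first exact: W.
  rewrite (_ : PI * t = PI - PI * (1 - t)); last by ring.
  by rewrite sin_PI_x; apply: W; lra.
apply: (Rle_trans (@sin_ge_half d _)); first by lra.
by apply: sin_incr_1; nra.
Qed.

Lemma cotpi_decr a b d : 0 < d -> d <= a -> a <= b -> b <= 1 - d ->
  cotpi b <= cotpi a.
Proof.
move=> Hd Ha Hab Hb.
have sa := @sin_pi_ge d a Hd ltac:(lra).
have sb := @sin_pi_ge d b Hd ltac:(lra).
have Hpi := PI2_1.
suff : 0 <= cotpi a - cotpi b by lra.
have -> : cotpi a - cotpi b = sin (PI * b - PI * a) / (sin (PI * a) * sin (PI * b)).
  by rewrite sin_minus /cotpi; field; lra.
apply: Rmult_le_pos.
  by apply: sin_ge_0; nra.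
by apply/Rlt_le/Rinv_0_lt_compat; nra.
Qed.

Lemma cotpi_bound d t : 0 < d -> d <= t <= 1 - d -> Rabs (cotpi t) <= 2 / d.
Proof.
move=> Hd Ht; have s := sin_pi_ge Hd Ht.
rewrite /cotpi Rabs_div; last by lra.
rewrite (Rabs_pos_eq (sin _)); last by lra.
apply: (@Rle_trans _ (1 / sin (PI * t))).
  apply: Rmult_le_compat_r; first by apply/Rlt_le/Rinv_0_lt_compat; lra.
  by apply: Rabs_le; case: (COS_bound (PI * t)).
rewrite (_ : 2 / d = 1 / (d / 2)); last by field; lra.
by apply: Rmult_le_compat_l; [lra | apply: Rinv_le_contravar; lra].
Qed.

(** If the increments of the phase increase and stay at distance [d] from the
    integers, then [1 / (ec theta - 1) = -1/2 - (i/2) cot (pi theta)] turns the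
    sum into a telescoping one with a monotone weight. *)
Lemma kusmin_landau n (phi : nat -> R) d :
  0 < d -> d <= 1 / 2 ->
  (forall i, (i < n)%coq_nat -> d <= phi i.+1 - phi i <= 1 - d) ->
  (forall i, (i.+1 < n)%coq_nat -> phi i.+1 - phi i <= phi i.+2 - phi i.+1) ->
  Cmod (\csum_(i < n.+1) ec (phi i)) <= 7 / d.
Proof.
move=> d0 d1 Hb Hm.
have hd : 2 <= 1 / d.
  by apply: (Rmult_le_reg_r d) => //; rewrite (_ : 1 / d * d = 1); [lra | field; lra].
case: n Hb Hm => [|n] Hb Hm.
  by rewrite gsum_recr gsum_0 /= Cplus_0_l Cmod_ec; lra.
pose th i := phi i.+1 - phi i.
pose ga i : C := (- (1/2), - cotpi (th i) / 2).
pose u i : C := (ec (phi i.+1) - ec (phi i))%C.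
have Hga i : (i < n.+1)%coq_nat -> ec (phi i) = (ga i * u i)%C.
  move=> Hi; have sn := sin_pi_ge d0 (Hb i Hi).
  have -> : u i = (ec (phi i) * (ec (th i) - 1))%C.
    rewrite /u (_ : phi i.+1 = phi i + th i); last by rewrite /th; ring.
    by rewrite ec_plus; ring.
  suff -> : (ga i * (ec (phi i) * (ec (th i) - 1)) = ec (phi i) * (ga i * (ec (th i) - 1)))%C.
    suff -> : (ga i * (ec (th i) - 1) = 1)%C by ring.
    rewrite /ga /ec /Cmult /cotpi /RtoC /=.
    rewrite (_ : 2 * PI * th i = 2 * (PI * th i)); last by ring.
    rewrite cos_2a sin_2a -/(th i) in sn *.
    set s := sin (PI * th i) in sn *; set c := cos (PI * th i).
    have Hsc : s * s + c * c = 1 by have := sin2_cos2 (PI * th i); rewrite /Rsqr.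
    have Hs0 : s <> 0 by lra.
    have E1 : c * c = 1 - s * s by lra.
    have : c / s * s = c by field.
    move: (c / s) => r Er.
    by congr pair; rewrite E1 -?Er; [rewrite Er in E1 *|]; nra.
  by ring.
rewrite gsum_recr /=.
apply: (Rle_trans (Cmod_triangle _ _)); rewrite Cmod_ec.
rewrite (@gsum_eq _ _ _ n.+1 _ (fun i => ga i * u i)%C); last by move=> i Hi; apply: Hga.
have Htel j : \csum_(i < j.+1) u i = (ec (phi j.+1) - ec (phi 0%N))%C.
  elim: j => [|j IH]; first by rewrite gsum_recr gsum_0 /u /=; ring.
  by rewrite gsum_recr IH /u /=; ring.
have := @abel_ineq n ga u 2.
have HU : forall j, (j <= n)%coq_nat -> Cmod (\csum_(i < j.+1) u i) <= 2.
  move=> j _; rewrite Htel; apply: (Rle_trans (Cmod_triangle _ _)).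
  by rewrite Cmod_opp !Cmod_ec; lra.
move=> /(_ HU) H.
have Hlast : Cmod (ga n) <= 1 / 4 * (1 / d) + 1 / d.
  apply: (@Rle_trans _ (Rabs (1/2) + Rabs (cotpi (th n) / 2))).
    have -> : ga n = (RtoC (- (1/2)) + Ci * RtoC (- (cotpi (th n) / 2)))%C.
      by rewrite /ga /RtoC /Ci /Cplus /Cmult /=; congr pair; field.
    apply: (Rle_trans (Cmod_triangle _ _)).
    rewrite Cmod_mult !Cmod_R !Rabs_Ropp.
    rewrite Cmod_Ci.
    by lra.
  have := @cotpi_bound d (th n) d0 (Hb n ltac:(lia)).
  by move: (cotpi (th n)) => x; rewrite /Rdiv; split_Rabs; lra.
have Hvar : \rsum_(i < n) Cmod (ga i.+1 - ga i)%C <= 2 * (1 / d).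
  rewrite (@gsum_eq _ _ _ n _ (fun i => (cotpi (th i) - cotpi (th i.+1)) / 2)).
    have -> : forall m, \rsum_(i < m) ((cotpi (th i) - cotpi (th i.+1)) / 2)
        = (cotpi (th 0%N) - cotpi (th m)) / 2.
      by elim=> [|m IH]; rewrite ?gsum_0 ?gsum_recr ?IH /=; field.
    have := @cotpi_bound d (th 0%N) d0 (Hb 0%N ltac:(lia)).
    have := @cotpi_bound d (th n) d0 (Hb n ltac:(lia)).
    by move: (cotpi (th n)) (cotpi (th 0%N)) => x y; split_Rabs; lra.
  move=> i Hi.
  have -> : (ga i.+1 - ga i)%C = (Ci * RtoC ((cotpi (th i) - cotpi (th i.+1)) / 2))%C.
    rewrite /ga; move: (cotpi (th i)) (cotpi (th i.+1)) => x y.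
    by rewrite /Cminus /RtoC /Ci /Cplus /Cmult /Copp /=; congr pair; field.
  rewrite Cmod_mult Cmod_R.
  rewrite Cmod_Ci.
  rewrite Rmult_1_l Rabs_pos_eq //.
  have := @cotpi_decr (th i) (th i.+1) d d0.
  have h1 := Hb i ltac:(lia); have h2 := Hb i.+1 ltac:(lia); have h3 := Hm i ltac:(lia).
  by rewrite /th in h1 h2 h3 * => /(_ ltac:(lra) ltac:(lra) ltac:(lra)); lra.
by move: H Hlast Hvar; rewrite (_ : 7 / d = 7 * (1 / d)); [move=> *; lra | field; lra].
Qed.

(** The increments may lie near any fixed integer: subtracting a linear function
    with integer values from the phase changes no term. *)
Lemma kusmin_landau_shift n (phi : nat -> R) d z :
  0 < d -> d <= 1 / 2 ->
  (forall i, (i < n)%coq_nat -> d <= phi i.+1 - phi i + IZR z <= 1 - d) ->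
  (forall i, (i.+1 < n)%coq_nat -> phi i.+1 - phi i <= phi i.+2 - phi i.+1) ->
  Cmod (\csum_(i < n.+1) ec (phi i)) <= 7 / d.
Proof.
move=> d0 d1 Hb Hm.
have E i : phi i + IZR (Z.of_nat i * z) = phi i + INR i * IZR z.
  by rewrite mult_IZR -INR_IZR_INZ.
rewrite (@gsum_eq _ _ _ n.+1 _ (fun i => ec (phi i + INR i * IZR z))).
  apply: kusmin_landau => // i Hi; rewrite !S_INR; first by have := Hb i Hi; lra.
  by have := Hm i Hi; lra.
by move=> i _; rewrite -E ec_plusZ.
Qed.

Lemma monotone_split n (th : nat -> R) c :
  (forall i, (i.+1 < n)%coq_nat -> th i <= th i.+1) ->
  exists p, [/\ (p <= n)%coq_nat, forall i, (i < p)%coq_nat -> th i < c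
     & forall i, (p <= i)%coq_nat -> (i < n)%coq_nat -> c <= th i].
Proof.
elim: n => [|n IH] Hm; first by exists 0%N; split=> // i; lia.
have [p [p1 p2 p3]] := IH (fun i hi => Hm i ltac:(lia)).
case: (Nat.eq_dec p n) => [E|pn]; last first.
  exists p; split; [by lia | exact: p2 |].
  move=> i h1 h2; case: (Nat.eq_dec i n) => [->|]; last by move=> ?; apply: p3; lia.
  have h := Hm n.-1; rewrite (_ : n.-1.+1 = n) in h; last by lia.
  by have := p3 n.-1 ltac:(lia) ltac:(lia); have := h ltac:(lia); lra.
case: (Rlt_dec (th n) c) => h.
  exists n.+1; split=> // i h1; last by lia.
  by case: (Nat.eq_dec i n) => [->|] // ?; apply: p2; lia.
exists p; split; [by lia | exact: p2 |].
move=> i h1 h2; have -> : i = n by lia.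
exact: Rnot_lt_le.
Qed.

(** The increments grow by at least [rho] at each step, so at most
    [2 / sqrt rho + 1] of them are within [sqrt rho] of 0.  These indices are
    counted; the Kusmin-Landau bound covers the two outer ranges. *)
Lemma second_derivative_test n (phi : nat -> R) rho :
  0 < rho -> rho <= 1 / 4 ->
  (forall i, (i < n)%coq_nat -> Rabs (phi i.+1 - phi i) <= 1 / 2) ->
  (forall i, (i.+1 < n)%coq_nat ->
     rho <= (phi i.+2 - phi i.+1) - (phi i.+1 - phi i)) ->
  Cmod (\csum_(i < n.+1) ec (phi i)) <= 17 / sqrt rho.
Proof.
move=> r0 r1 Hb Hm.
pose th i := phi i.+1 - phi i.
set d := sqrt rho.
have d0 : 0 < d by apply: sqrt_lt_R0.
have dd : d * d = rho by apply: sqrt_sqrt; lra.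
have d1 : d <= 1 / 2 by nra.
have Hmth i : (i.+1 < n)%coq_nat -> th i <= th i.+1.
  by move=> hi; have := Hm i hi; rewrite /th; lra.
have [p1 [a1 b1 c1]] := @monotone_split n th (- d) Hmth.
have [p2 [a2 b2 c2]] := @monotone_split n th d Hmth.
have p12 : (p1 <= p2)%coq_nat.
  case: (le_dec p1 p2) => // h.
  by have := b1 p2 ltac:(lia); have := c2 p2 ltac:(lia) ltac:(lia); lra.
have Hb' i : (i < n)%coq_nat -> - (1 / 2) <= th i <= 1 / 2.
  by move=> hi; have := Hb i hi; rewrite -/(th i); split_Rabs; lra.
have -> : n.+1 = (p1 + ((p2 - p1) + (n - p2).+1))%N by lia.
rewrite !gsum_cat.
have F1 : Cmod (csum p1 (fun i => ec (phi i))) <= 7 / d.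
  case: p1 a1 b1 {c1 p12} => [|p1] a1 b1.
    by rewrite gsum_0 Cmod_0; apply: Rdiv_le_0_compat; lra.
  apply: (@kusmin_landau_shift p1 _ d 1) => // i hi; rewrite -/(th i) -?/(th i.+1).
    by have := b1 i ltac:(lia); have := Hb' i ltac:(lia); lra.
  by apply: Hmth; lia.
have F3 : Cmod (csum (n - p2).+1 (fun i => ec (phi (p1 + (p2 - p1 + i))%N))) <= 7 / d.
  rewrite (@gsum_eq _ _ _ _ _ (fun i => ec (phi (p2 + i)%N))); last first.
    by move=> i _; rewrite addnA (_ : (p1 + (p2 - p1) = p2)%N) //; lia.
  apply: kusmin_landau => // i hi; rewrite !addnS -/(th (p2 + i)%N) -?/(th (p2 + i).+1).
    by have := c2 (p2 + i)%N ltac:(lia) ltac:(lia); have := Hb' (p2 + i)%N ltac:(lia); lra.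
  by apply: Hmth; lia.
have F2 : Cmod (csum (p2 - p1) (fun i => ec (phi (p1 + i)%N))) <= 3 / d.
  apply: (Rle_trans (@Cmod_csum_le _ _ (fun=> 1) _)); first by move=> *; rewrite Cmod_ec; lra.
  rewrite rsum_const Rmult_1_r.
  case: (Nat.eq_dec p1 p2) => [->|neq].
    by rewrite subnn /=; apply: Rdiv_le_0_compat; lra.
  have grow m : (p1 + m < n)%coq_nat -> INR m * rho <= th (p1 + m)%N - th p1.
    elim: m => [|m IH] hm; first by rewrite addn0 /=; lra.
    rewrite S_INR addnS; have := IH ltac:(lia).
    by have := Hm (p1 + m)%N ltac:(lia); rewrite -/(th _) -/(th _); lra.
  have := grow (p2 - p1).-1 ltac:(lia).
  rewrite (_ : (p1 + (p2 - p1).-1)%N = p2.-1); last by lia.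
  have := b2 p2.-1 ltac:(lia); have := c1 p1 ltac:(lia) ltac:(lia).
  rewrite (_ : INR (p2 - p1) = INR (p2 - p1).-1 + 1); last first.
    by rewrite -S_INR; congr INR; lia.
  move: (INR _) => x *; apply: (Rmult_le_reg_r d) => //.
  rewrite (_ : 3 / d * d = 3); last by field; lra.
  suff : x * d <= 2 by lra.
  by apply: (Rmult_le_reg_r d) => //; nra.
apply: (Rle_trans (Cmod_triangle _ _)).
apply: (Rle_trans (Rplus_le_compat F1 (Cmod_triangle _ _))).
apply: (Rle_trans (Rplus_le_compat (Rle_refl _) (Rplus_le_compat F2 F3))).
by rewrite /Rdiv; lra.
Qed.

(** * A partition of unity and the stationary phase *)

Lemma mvt (f f' : R -> R) a b : a < b ->
  (forall x, a <= x <= b -> is_derive f x (f' x)) ->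
  exists c, a < c < b /\ f b - f a = f' c * (b - a).
Proof.
move=> ab H.
have [c [Hc1 Hc2]] := MVT_cor2 f f' a b ab
  (fun c hc => proj1 (is_derive_Reals f c (f' c)) (H c hc)).
by exists c.
Qed.

Lemma lipschitz_of_derive (f f' : R -> R) a b D :
  (forall x, a <= x <= b -> is_derive f x (f' x)) ->
  (forall x, a <= x <= b -> Rabs (f' x) <= D) ->
  forall x y, a <= x <= b -> a <= y <= b ->
  Rabs (f x - f y) <= D * Rabs (x - y).
Proof.
move=> Hd HD x y.
wlog xy : x y / y <= x.
  move=> W hx hy; case: (Rle_dec y x) => h; first exact: W.
  by rewrite Rabs_minus_sym (Rabs_minus_sym x); apply: W => //; lra.
move=> hx hy; case: (Req_dec x y) => [->|ne].
  by rewrite !Rminus_diag !Rabs_R0; lra.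
have [c [hc ->]] := @mvt f f' y x ltac:(lra) (fun z hz => Hd z ltac:(lra)).
rewrite Rabs_mult; apply: Rmult_le_compat_r; first exact: Rabs_pos.
by apply: HD; lra.
Qed.

Lemma cos_lip x y : Rabs (cos x - cos y) <= Rabs (x - y).
Proof.
rewrite -[X in _ <= X]Rmult_1_l.
apply: (@lipschitz_of_derive cos (fun t => - sin t) (Rmin x y) (Rmax x y)).
- by move=> z _; auto_derive => //; ring.
- by move=> z _; have := SIN_bound z; split_Rabs; lra.
- by split; [apply: Rmin_l | apply: Rmax_l].
- by split; [apply: Rmin_r | apply: Rmax_r].
Qed.

Lemma sin_lip x y : Rabs (sin x - sin y) <= Rabs (x - y).
Proof.
rewrite -[X in _ <= X]Rmult_1_l.
apply: (@lipschitz_of_derive sin cos (Rmin x y) (Rmax x y)).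
- by move=> z _; auto_derive => //; ring.
- by move=> z _; have := COS_bound z; split_Rabs; lra.
- by split; [apply: Rmin_l | apply: Rmax_l].
- by split; [apply: Rmin_r | apply: Rmax_r].
Qed.

Definition clamp (s : R) := Rmax (-1) (Rmin 1 s).

(** The bump [cos^2 (pi s / 2)] on [-1, 1], extended by 0, and its derivative.
    Its integer translates sum to 1, and one Lipschitz derivative is the only
    smoothness that the partial summations ask for. *)
Definition om (s : R) := (1 + cos (PI * clamp s)) / 2.
Definition om' (s : R) := - (PI / 2) * sin (PI * clamp s).

Lemma clamp_id s : -1 <= s <= 1 -> clamp s = s.
Proof. by move=> h; rewrite /clamp Rmin_right ?Rmax_right; lra. Qed.

Lemma clamp_hi s : 1 <= s -> clamp s = 1.
Proof. by move=> h; rewrite /clamp Rmin_left ?Rmax_right; lra. Qed.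

Lemma clamp_lo s : s <= -1 -> clamp s = -1.
Proof. by move=> h; rewrite /clamp Rmin_right ?Rmax_left; lra. Qed.

Lemma clamp_lip x y : Rabs (clamp x - clamp y) <= Rabs (x - y).
Proof.
have T z : [\/ z <= -1 /\ clamp z = -1, 1 <= z /\ clamp z = 1
              | -1 <= z <= 1 /\ clamp z = z].
  case: (Rle_dec z (-1)) => h1; first by constructor 1; rewrite clamp_lo.
  case: (Rle_dec 1 z) => h2; first by constructor 2; rewrite clamp_hi.
  by constructor 3; rewrite clamp_id; lra.
by case: (T x) => -[hx ->]; case: (T y) => -[hy ->]; split_Rabs; lra.
Qed.

Lemma clamp_opp s : clamp (- s) = - clamp s.
Proof.
case: (Rle_dec s (-1)) => h1.
  by rewrite clamp_hi ?clamp_lo; lra.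
case: (Rle_dec 1 s) => h2; first by rewrite clamp_lo ?clamp_hi; lra.
by rewrite !clamp_id; lra.
Qed.

Lemma PI_bounds : 3 < PI <= 4.
Proof. by have := PI2_3_2; have := PI_4; lra. Qed.

Lemma om_zero s : 1 <= Rabs s -> om s = 0.
Proof.
move=> h; rewrite /om; case: (Rle_dec 0 s) => hs.
  by rewrite clamp_hi ?Rmult_1_r ?cos_PI; [field | split_Rabs; lra].
rewrite clamp_lo; last by split_Rabs; lra.
by rewrite (_ : PI * -1 = - PI) ?cos_neg ?cos_PI; [field | ring].
Qed.

Lemma om'_zero s : 1 <= Rabs s -> om' s = 0.
Proof.
move=> h; rewrite /om'; case: (Rle_dec 0 s) => hs.
  by rewrite clamp_hi ?Rmult_1_r ?sin_PI; [ring | split_Rabs; lra].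
rewrite clamp_lo; last by split_Rabs; lra.
by rewrite (_ : PI * -1 = - PI) ?sin_neg ?sin_PI; ring.
Qed.

Lemma om_range s : 0 <= om s <= 1.
Proof. by rewrite /om; have := COS_bound (PI * clamp s); lra. Qed.

Lemma om'_bound s : Rabs (om' s) <= 2.
Proof.
have [h1 h2] := PI_bounds.
rewrite /om' Rabs_mult Rabs_Ropp (Rabs_pos_eq (PI / 2)); last by lra.
have : Rabs (sin (PI * clamp s)) <= 1.
  by have := SIN_bound (PI * clamp s); split_Rabs; lra.
by have := Rabs_pos (sin (PI * clamp s)); nra.
Qed.

Lemma om_lip x y : Rabs (om x - om y) <= 2 * Rabs (x - y).
Proof.
have [h1 h2] := PI_bounds.
have -> : om x - om y = (cos (PI * clamp x) - cos (PI * clamp y)) / 2.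
  by rewrite /om; field.
rewrite Rabs_div ?(Rabs_pos_eq 2); try lra.
have := cos_lip (PI * clamp x) (PI * clamp y).
rewrite -Rmult_minus_distr_l Rabs_mult (Rabs_pos_eq PI); last by lra.
have := clamp_lip x y; have := Rabs_pos (clamp x - clamp y).
by nra.
Qed.

Lemma om'_lip x y : Rabs (om' x - om' y) <= 8 * Rabs (x - y).
Proof.
have [h1 h2] := PI_bounds.
have -> : om' x - om' y = - (PI / 2) * (sin (PI * clamp x) - sin (PI * clamp y)).
  by rewrite /om'; field.
rewrite Rabs_mult Rabs_Ropp (Rabs_pos_eq (PI / 2)); last by lra.
have := sin_lip (PI * clamp x) (PI * clamp y).
rewrite -Rmult_minus_distr_l Rabs_mult (Rabs_pos_eq PI); last by lra.
have := clamp_lip x y; have := Rabs_pos (clamp x - clamp y).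
move: (Rabs (clamp x - clamp y)) (Rabs (x - y)) (Rabs (sin _ - _)) => a b c *.
have : PI * a <= 4 * b by nra.
by nra.
Qed.

Lemma om_even s : om (- s) = om s.
Proof.
rewrite /om clamp_opp.
by rewrite (_ : PI * - clamp s = - (PI * clamp s)) ?cos_neg //; ring.
Qed.

Lemma locally_of_interval (a b x : R) (P : R -> Prop) :
  a < x < b -> (forall y, a < y < b -> P y) -> locally x P.
Proof.
move=> h H; have p : 0 < Rmin (x - a) (b - x) by apply: Rmin_glb_lt; lra.
exists (mkposreal _ p) => y /= hy; apply: H.
have := Rmin_l (x - a) (b - x); have := Rmin_r (x - a) (b - x).
have : Rabs (y - x) < Rmin (x - a) (b - x) by exact: hy.
by split_Rabs; lra.
Qed.

(** A quadratic zero at [x]: this is the differentiability of [om] at the ends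
    of its support. *)
Lemma is_derive_quadratic (f : R -> R) x K :
  (forall y, Rabs (f y - f x) <= K * (y - x) ^ 2) -> is_derive f x 0.
Proof.
move=> H; apply/is_derive_Reals => eps he.
pose K1 := Rabs K + 1.
have K1p : 0 < K1 by rewrite /K1; have := Rabs_pos K; lra.
have dp : 0 < eps / K1 by apply: Rdiv_lt_0_compat.
exists (mkposreal _ dp) => h h0 /= hh.
rewrite Rminus_0_r Rabs_div //.
have hp : 0 < Rabs h by apply: Rabs_pos_lt.
apply: (Rmult_lt_reg_r (Rabs h)) => //.
rewrite (_ : _ / _ * _ = Rabs (f (x + h) - f x)); last by field; lra.
apply: (Rle_lt_trans (H (x + h))).
have -> : (x + h - x) ^ 2 = Rabs h * Rabs h by rewrite -Rabs_mult Rabs_pos_eq; [ring | nra].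
have : Rabs h * K1 < eps.
  have := Rmult_lt_compat_r K1 _ _ K1p hh.
  by rewrite (_ : eps / K1 * K1 = eps) //; field; lra.
have : K <= K1 by rewrite /K1; split_Rabs; lra.
by nra.
Qed.

Lemma is_derive_om s : is_derive om s (om' s).
Proof.
have pos x : 0 <= x -> is_derive om x (om' x).
  move=> hx; case: (Rlt_dec x 1) => h1; last case: (Rlt_dec 1 x) => h2.
  - apply: (@is_derive_ext_loc _ _ (fun s => (1 + cos (PI * s)) / 2)).
      by apply: (@locally_of_interval (-1) 1); [lra | move=> y hy; rewrite /om clamp_id //; lra].
    by rewrite /om' clamp_id; [auto_derive => //; field | lra].
  - rewrite om'_zero; last by split_Rabs; lra.
    apply: (@is_derive_ext_loc _ _ (fun=> 0)).
      apply: (@locally_of_interval 1 (x + 1)); first by lra.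
      by move=> y hy; rewrite om_zero //; split_Rabs; lra.
    by auto_derive.
  - have -> : x = 1 by lra.
    rewrite om'_zero; last by split_Rabs; lra.
    apply: (@is_derive_quadratic _ _ 16) => y.
    rewrite (@om_zero 1); last by split_Rabs; lra.
    rewrite Rminus_0_r Rabs_pos_eq; last by case: (om_range y).
    have -> : om y = sin (PI / 2 * (clamp y - 1)) ^ 2.
      rewrite /om (_ : PI * clamp y = 2 * (PI / 2 * clamp y)); last by field.
      rewrite cos_2a_cos (_ : PI / 2 * (clamp y - 1) = - (PI / 2 - PI / 2 * clamp y)); last by field.
      by rewrite sin_neg sin_shift; field.
    have hs : Rabs (sin (PI / 2 * (clamp y - 1))) <= 2 * Rabs (y - 1).
      have := sin_lip (PI / 2 * (clamp y - 1)) 0; rewrite sin_0 !Rminus_0_r Rabs_mult.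
      have [p1 p2] := PI_bounds; rewrite (Rabs_pos_eq (PI / 2)); last by lra.
      have := clamp_lip y 1; rewrite (@clamp_hi 1); last by lra.
      by have := Rabs_pos (clamp y - 1); nra.
    rewrite -(pow2_abs (sin _)) -(pow2_abs (y - 1)).
    by have := Rabs_pos (sin (PI / 2 * (clamp y - 1))); nra.
case: (Rle_dec 0 s) => hs; first exact: pos.
have := pos (- s) ltac:(lra) => H.
have E : om' s = scal (-1) (om' (- s)).
  rewrite /scal /= /mult /= /om' clamp_opp.
  by rewrite (_ : PI * - clamp s = - (PI * clamp s)) ?sin_neg; ring.
rewrite E; apply: (@is_derive_ext _ _ (fun s => om (- s))); first by move=> t; rewrite om_even.
by apply: is_derive_comp => //; auto_derive => //; ring.
Qed.

Lemma Zfloor_ex x : exists z, IZR z <= x < IZR z + 1.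
Proof.
exists (up x - 1)%Z; rewrite minus_IZR; have [] := archimed x; lra.
Qed.

(** At most two translates are nonzero at [x], and they add up to
    [cos^2 + sin^2 = 1]. *)
Lemma om_partition x a n :
  IZR a <= x - 1 -> x + 1 <= IZR (a + Z.of_nat n) ->
  rzsum a n (fun l => om (x - IZR l)) = 1.
Proof.
move=> h1 h2; have [z hz] := Zfloor_ex x.
have az : (a <= z)%Z by apply/Z.lt_succ_r/lt_IZR; rewrite succ_IZR; lra.
have zn2 : (z + 1 <= a + Z.of_nat n)%Z.
  by apply: le_IZR; rewrite (plus_IZR z); lra.
case: (Req_dec x (IZR z)) => [E|xz].
  have zz : (z + 1 <= a + Z.of_nat n)%Z by [].
  rewrite (@zsum_widen _ _ _ z 1); [|move=> l hl|lia|lia].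
    rewrite /zsum gsum_recr gsum_0 /= Z.add_0_r E Rminus_diag.
    by rewrite /om clamp_id ?Rmult_0_r ?cos_0; lra.
  apply: om_zero; rewrite E -minus_IZR -abs_IZR; apply: IZR_le; lia.
have zn3 : (z + 2 <= a + Z.of_nat n)%Z.
  have : (z + 1 < a + Z.of_nat n)%Z by apply: lt_IZR; rewrite (plus_IZR z); lra.
  by lia.
rewrite (@zsum_widen _ _ _ z 2); [|move=> l hl|lia|lia].
  rewrite /zsum !gsum_recr gsum_0 /= Z.add_0_r plus_IZR.
  rewrite /om !clamp_id; try lra.
  have -> : PI * (x - (IZR z + 1)) = PI * (x - IZR z) - PI by ring.
  by rewrite cos_minus cos_PI sin_PI; field.
apply: om_zero; case: hl => hl.
  have : IZR l + 1 <= IZR z by rewrite -plus_IZR; apply: IZR_le; lia.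
  by split_Rabs; lra.
have : IZR z + 2 <= IZR l by rewrite -plus_IZR; apply: IZR_le; lia.
by split_Rabs; lra.
Qed.

Lemma is_derive_compR (f g : R -> R) x df dg :
  is_derive f (g x) df -> is_derive g x dg ->
  is_derive (fun t => f (g t)) x (df * dg).
Proof.
move=> hf hg; rewrite Rmult_comm.
exact: (@is_derive_comp R_AbsRing R_NormedModule f g x df dg).
Qed.

(** Coordinates around the stationary point [Y = 4 lam^2]: [Y = 4 lam^2 + v],
    [y = sqrt Y] and [s = y / 2 - lam].  The phase [Psi] is
    [y^3 / 3 - lam y^2] with its value at [v = 0] subtracted; it is normalised so
    that its derivative in [v] is [s] and its derivative in [lam] is
    [- 4 s^2], both bounded where [|s| <= 1]. *)
Definition yv (lam v : R) := sqrt (4 * lam ^ 2 + v).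
Definition sv (lam v : R) := yv lam v / 2 - lam.
Definition Psi (lam v : R) :=
  yv lam v ^ 3 / 3 - lam * yv lam v ^ 2 + 4 * lam ^ 3 / 3.

Lemma yv_pos lam v : 0 < 4 * lam ^ 2 + v -> 0 < yv lam v.
Proof. exact: sqrt_lt_R0. Qed.

Lemma yv_sqr lam v : 0 <= 4 * lam ^ 2 + v -> yv lam v ^ 2 = 4 * lam ^ 2 + v.
Proof. by move=> h; rewrite /yv -Rsqr_pow2 Rsqr_sqrt. Qed.

Lemma yv_incr lam v w : v <= w -> yv lam v <= yv lam w.
Proof. by move=> h; apply: sqrt_le_1_alt; lra. Qed.

Lemma is_derive_yv_v lam v : 0 < 4 * lam ^ 2 + v ->
  is_derive (yv lam) v (/ (2 * yv lam v)).
Proof.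
move=> h; rewrite /yv; auto_derive; first by lra.
by rewrite /= Rmult_1_l.
Qed.

Lemma is_derive_Psi_v lam v : 0 < 4 * lam ^ 2 + v ->
  is_derive (Psi lam) v (sv lam v).
Proof.
move=> h; have y0 := yv_pos h; have D := is_derive_yv_v h.
have -> : sv lam v = (yv lam v ^ 2 - 2 * lam * yv lam v) * / (2 * yv lam v).
  by rewrite /sv; field; lra.
apply: (@is_derive_compR (fun y => y ^ 3 / 3 - lam * y ^ 2 + 4 * lam ^ 3 / 3)) => //.
by auto_derive => //; field.
Qed.

Lemma is_derive_yv_l lam v : 0 < 4 * lam ^ 2 + v ->
  is_derive (fun l => yv l v) lam (4 * lam / yv lam v).
Proof.
move=> h; have y0 := yv_pos h; rewrite /yv; auto_derive.
  by lra.
rewrite /yv in y0 *.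
rewrite (_ : sqrt (4 * (lam * (lam * 1)) + v) = sqrt (4 * lam ^ 2 + v)) //.
by field; lra.
Qed.

Lemma is_derive_sv_l lam v : 0 < 4 * lam ^ 2 + v ->
  is_derive (fun l => sv l v) lam (- 2 * sv lam v / yv lam v).
Proof.
move=> h; have y0 := yv_pos h; have D := is_derive_yv_l h.
rewrite /sv; auto_derive; first by exists (4 * lam / yv lam v).
rewrite (is_derive_unique _ _ _ D); field; lra.
Qed.

Lemma is_derive_Psi_l lam v : 0 < 4 * lam ^ 2 + v ->
  is_derive (fun l => Psi l v) lam (- 4 * sv lam v ^ 2).
Proof.
move=> h; have y0 := yv_pos h; have D := is_derive_yv_l h.
have y2 : yv lam v ^ 2 = 4 * lam ^ 2 + v by apply: yv_sqr; lra.
rewrite /Psi; auto_derive; first by repeat split; exists (4 * lam / yv lam v).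
rewrite (is_derive_unique _ _ _ D) /sv.
by field; lra.
Qed.

(** Since [y^2 = 4 lam^2 + v], the window [|s| < 1] is
    [4 - 8 lam < v < 4 + 8 lam]. *)
Lemma sv_lt1 lam v : 0 <= lam -> 0 <= 4 * lam ^ 2 + v ->
  v < 8 * lam + 4 -> sv lam v < 1.
Proof.
move=> l0 h hv; rewrite /sv; have y2 := yv_sqr h.
have y0 : 0 <= yv lam v := sqrt_pos _.
suff : yv lam v < 2 * lam + 2 by lra.
by nra.
Qed.

Lemma sv_ge1 lam v : 0 <= lam -> 0 <= 4 * lam ^ 2 + v ->
  8 * lam + 4 <= v -> 1 <= sv lam v.
Proof.
move=> l0 h hv; rewrite /sv; have y2 := yv_sqr h.
have y0 : 0 <= yv lam v := sqrt_pos _.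
suff : 2 * lam + 2 <= yv lam v by lra.
by nra.
Qed.

Lemma sv_gtN1 lam v : 1 <= lam -> 0 <= 4 * lam ^ 2 + v ->
  4 - 8 * lam < v -> - 1 < sv lam v.
Proof.
move=> l0 h hv; rewrite /sv; have y2 := yv_sqr h.
have y0 : 0 <= yv lam v := sqrt_pos _.
suff : 2 * lam - 2 < yv lam v by lra.
by nra.
Qed.

Lemma sv_leN1 lam v : 1 <= lam -> 0 <= 4 * lam ^ 2 + v ->
  v <= 4 - 8 * lam -> sv lam v <= - 1.
Proof.
move=> l0 h hv; rewrite /sv; have y2 := yv_sqr h.
have y0 : 0 <= yv lam v := sqrt_pos _.
suff : yv lam v <= 2 * lam - 2 by lra.
by nra.
Qed.

Lemma Psi_increment lam v : 0 < 4 * lam ^ 2 + v ->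
  sv lam v <= Psi lam (v + 1) - Psi lam v <= sv lam (v + 1).
Proof.
move=> h.
have [c [hc ->]] := @mvt (Psi lam) (sv lam) v (v + 1) ltac:(lra)
  (fun x hx => @is_derive_Psi_v lam x ltac:(lra)).
rewrite (_ : v + 1 - v = 1) ?Rmult_1_r; last by ring.
have := @yv_incr lam v c ltac:(lra); have := @yv_incr lam c (v + 1) ltac:(lra).
by rewrite /sv; lra.
Qed.

Lemma yv_diff lam v : 0 < 4 * lam ^ 2 + v ->
  yv lam (v + 1) - yv lam v = / (yv lam (v + 1) + yv lam v).
Proof.
move=> h; have y1 := yv_pos h; have y2 := @yv_pos lam (v + 1) ltac:(lra).
have e1 := @yv_sqr lam v ltac:(lra); have e2 := @yv_sqr lam (v + 1) ltac:(lra).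
apply: (Rmult_eq_reg_r (yv lam (v + 1) + yv lam v)); last by lra.
by rewrite Rinv_l; [nra | lra].
Qed.

(** The second derivative of [Psi] in [v] is that of [y / 2], namely
    [1 / (4 y)], and [y] increases. *)
Lemma Psi_second_diff lam v : 0 < 4 * lam ^ 2 + v ->
  / (4 * yv lam (v + 2)) <=
  (Psi lam (v + 2) - Psi lam (v + 1)) - (Psi lam (v + 1) - Psi lam v).
Proof.
move=> h.
pose D x := Psi lam (x + 1) - Psi lam x.
have HD x : v <= x <= v + 1 -> is_derive D x (sv lam (x + 1) - sv lam x).
  move=> hx; rewrite /D; apply: (@is_derive_minus R_AbsRing R_NormedModule).
    rewrite -[sv lam (x + 1)]Rmult_1_r.
    apply: (@is_derive_compR (Psi lam) (fun t => t + 1)).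
      by apply: is_derive_Psi_v; lra.
    by auto_derive => //; ring.
  by apply: is_derive_Psi_v; lra.
have [c [hc]] := @mvt D _ v (v + 1) ltac:(lra) HD.
rewrite {1 2}/D (_ : v + 1 + 1 = v + 2); last by ring.
move=> ->; rewrite (_ : v + 1 - v = 1) ?Rmult_1_r; last by ring.
rewrite /sv (_ : yv lam (c + 1) / 2 - lam - (yv lam c / 2 - lam)
   = (yv lam (c + 1) - yv lam c) / 2); last by field.
rewrite yv_diff; last by lra.
have y1 := @yv_pos lam c ltac:(lra); have y2 := @yv_pos lam (c + 1) ltac:(lra).
have y3 := @yv_incr lam (c + 1) (v + 2) ltac:(lra).
have y4 := @yv_incr lam c (v + 2) ltac:(lra).
rewrite /Rdiv -Rinv_mult; apply: Rinv_le_contravar; first by lra.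
by lra.
Qed.

(** The decay in the distance from resonance that the Kusmin-Landau bound gives,
    capped at 1. *)
Definition wz (h : Z) : R := / IZR (Z.max 1 (Z.abs h)).

Lemma wz_pos h : 0 < wz h.
Proof. by apply/Rinv_0_lt_compat/IZR_lt; lia. Qed.

Lemma wz_le1 h : wz h <= 1.
Proof. by rewrite -Rinv_1; apply: Rinv_le_contravar; [lra | apply: IZR_le; lia]. Qed.

Lemma wz_1 h : (Z.abs h <= 1)%Z -> wz h = 1.
Proof. by move=> H; rewrite /wz (_ : Z.max 1 (Z.abs h) = 1%Z) ?Rinv_1 //; lia. Qed.

(** Its derivative in [v] is [(s + h) / q], which vanishes inside the window
    [|s| <= 1] only when [|h| <= 1]. *)
Definition phase (q lam : R) (h : Z) (v : Z) : R :=
  (Psi lam (IZR v) + IZR h * IZR v) / q.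

(** For [|h| <= 1] the second-derivative test applies with second differences
    of size [1 / (lam q)].  For larger [h] the increments of the phase are at
    least [(|h| - 1) / q] away from the integers and the Kusmin-Landau bound
    gives [q / |h|]; here [q] is [O(sqrt (lam q))] because it is [O(lam)]. *)
Lemma phase_sum c : 0 < c -> exists C, 0 < C /\
  forall lam q h v0 n, 4 <= lam -> 9 <= q -> c * q <= lam ->
  2 * IZR (Z.abs h) <= q ->
  0 < 4 * lam ^ 2 + IZR v0 -> -1 <= sv lam (IZR v0) ->
  sv lam (IZR v0 + INR n) <= 1 ->
  Cmod (\csum_(i < n.+1) ec (phase q lam h (v0 + Z.of_nat i)))
    <= C * sqrt (lam * q) * wz h.
Proof.
move=> c0; exists (60 + 14 / sqrt c).
have sc : 0 < sqrt c by apply: sqrt_lt_R0.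
have C2 : 0 < 14 / sqrt c by apply: Rdiv_lt_0_compat; lra.
split; first by lra.
move=> lam q h v0 n l4 q9 cq hq v0p s0 s1.
have lq : 0 < lam * q by nra.
have slq : 0 < sqrt (lam * q) by apply: sqrt_lt_R0.
have qlq : q * sqrt c <= sqrt (lam * q).
  rewrite -[q in q * _]sqrt_square -?sqrt_mult; try by nra.
  by apply: sqrt_le_1_alt; nra.
have V i : IZR (v0 + Z.of_nat i) = IZR v0 + INR i by rewrite plus_IZR -INR_IZR_INZ.
set phi := fun i => phase q lam h (v0 + Z.of_nat i).
have pos i : 0 < 4 * lam ^ 2 + (IZR v0 + INR i) by have := pos_INR i; lra.
have inc i : phi i.+1 - phi i =
    (Psi lam ((IZR v0 + INR i) + 1) - Psi lam (IZR v0 + INR i) + IZR h) / q.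
  by rewrite /phi /phase !V S_INR -Rplus_assoc; field; lra.
have s_mon i j : (i <= j)%coq_nat -> sv lam (IZR v0 + INR i) <= sv lam (IZR v0 + INR j).
  move=> ij; have := le_INR _ _ ij => hij.
  by have := @yv_incr lam (IZR v0 + INR i) (IZR v0 + INR j) ltac:(lra); rewrite /sv; lra.
have inc_bd i : (i < n)%coq_nat ->
    (-1 + IZR h) / q <= phi i.+1 - phi i <= (1 + IZR h) / q.
  move=> hi; rewrite inc.
  have [b1 b2] := Psi_increment (pos i).
  have m1 := s_mon 0%N i ltac:(lia); have m2 := s_mon i.+1 n ltac:(lia).
  rewrite S_INR -Rplus_assoc in m2; rewrite /= Rplus_0_r in m1.
  by split; apply: Rmult_le_compat_r; try lra; apply/Rlt_le/Rinv_0_lt_compat; lra.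
have inc_mon i : (i.+1 < n)%coq_nat ->
    / (12 * lam * q) <= (phi i.+2 - phi i.+1) - (phi i.+1 - phi i).
  move=> hi; rewrite !inc S_INR.
  have := Psi_second_diff (pos i).
  rewrite (_ : IZR v0 + (INR i + 1) + 1 = IZR v0 + INR i + 2); last by ring.
  rewrite (_ : IZR v0 + (INR i + 1) = IZR v0 + INR i + 1); last by ring.
  set P2 := Psi _ _; set P1 := Psi _ _; set P0 := Psi _ _ => H.
  have -> : (P2 - P1 + IZR h) / q - (P1 - P0 + IZR h) / q = (P2 - P1 - (P1 - P0)) / q.
    by field; lra.
  rewrite Rinv_mult; apply: Rmult_le_compat_r.
    by apply/Rlt_le/Rinv_0_lt_compat; lra.
  apply: Rle_trans H; apply: Rinv_le_contravar.
    by have := @yv_pos lam (IZR v0 + INR i + 2) ltac:(have := pos i; lra); lra.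
  have m2 := s_mon i.+2 n ltac:(lia); rewrite !S_INR in m2.
  rewrite (_ : IZR v0 + (INR i + 1 + 1) = IZR v0 + INR i + 2) in m2; last by ring.
  by rewrite /sv in m2 s1; lra.
have inc_mon0 i : (i.+1 < n)%coq_nat -> phi i.+1 - phi i <= phi i.+2 - phi i.+1.
  move=> hi; have := inc_mon i hi.
  have : 0 < / (12 * lam * q) by apply: Rinv_0_lt_compat; nra.
  by lra.
case: (Z_le_dec (Z.abs h) 1) => h1.
  rewrite wz_1 // Rmult_1_r.
  have hR : -1 <= IZR h <= 1 by split; apply: IZR_le; lia.
  have rp : 0 < / (12 * lam * q) by apply: Rinv_0_lt_compat; nra.
  apply: (Rle_trans (@second_derivative_test n phi (/ (12 * lam * q)) rp _ _ inc_mon)).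
  - rewrite (_ : 1 / 4 = / 4); last by field.
    by apply: Rinv_le_contravar; nra.
  - move=> i hi; have [b1 b2] := inc_bd i hi.
    have e1 : -1/2 <= (-1 + IZR h) / q.
      by apply: (Rmult_le_reg_r q); rewrite ?Rmult_assoc ?Rinv_l; nra.
    have e2 : (1 + IZR h) / q <= 1 / 2.
      by apply: (Rmult_le_reg_r q); rewrite ?Rmult_assoc ?Rinv_l; nra.
    by split_Rabs; lra.
  rewrite sqrt_inv /Rdiv Rinv_inv.
  have -> : sqrt (12 * lam * q) = sqrt 12 * sqrt (lam * q).
    by rewrite -sqrt_mult; [congr sqrt; ring | lra | lra].
  have : sqrt 12 <= sqrt (3.5 * 3.5) by apply: sqrt_le_1_alt; lra.
  by rewrite sqrt_square; [nra | lra].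
have hz : 2 <= IZR (Z.abs h) by apply: IZR_le; lia.
pose d := (IZR (Z.abs h) - 1) / q.
have d0 : 0 < d by apply: Rdiv_lt_0_compat; lra.
have d1 : d <= 1 / 2 by apply: (Rmult_le_reg_r q); rewrite /d ?Rmult_assoc ?Rinv_l; nra.
have iq : 0 < / q by apply: Rinv_0_lt_compat; lra.
have qiq : q * / q = 1 by apply: Rinv_r; lra.
have KL : Cmod (\csum_(i < n.+1) ec (phi i)) <= 7 / d.
  case: (Z_le_dec 0 h) => hs.
    rewrite Z.abs_eq // in hz hq d d0 d1 *.
    apply: kusmin_landau => // i hi; have [b1 b2] := inc_bd i hi.
    rewrite /d; split; first by apply: Rle_trans b1; rewrite /Rdiv; nra.
    by apply: (Rle_trans b2); rewrite /Rdiv; nra.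
  have hE : IZR (Z.abs h) = - IZR h by rewrite -opp_IZR; congr IZR; lia.
  rewrite hE in hz hq d d0 d1 *.
  apply: (@kusmin_landau_shift n phi d 1) => // i hi; have [b1 b2] := inc_bd i hi.
  by rewrite /d; rewrite /Rdiv in b1 b2 *; split; nra.
apply: (Rle_trans KL); rewrite /wz Z.max_r; last by lia.
set H := IZR (Z.abs h) in hz d d0 d1 KL *.
have -> : 7 / d = 7 * q / (H - 1) by rewrite /d; field; lra.
apply: (@Rle_trans _ (14 * q / H)).
  apply: (Rmult_le_reg_r (H * (H - 1))); first by nra.
  rewrite (_ : 7 * q / (H - 1) * (H * (H - 1)) = 7 * q * H); last by field; lra.
  by rewrite (_ : 14 * q / H * (H * (H - 1)) = 14 * q * (H - 1)); [nra | field; lra].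
rewrite /Rdiv; apply: Rmult_le_compat_r; first by apply/Rlt_le/Rinv_0_lt_compat; lra.
have : q <= sqrt (lam * q) * / sqrt c.
  apply: (Rmult_le_reg_r (sqrt c)) => //; rewrite Rmult_assoc Rinv_l; lra.
by nra.
Qed.

Lemma Cmod_le_Re_Im z : Cmod z <= Rabs (Re z) + Rabs (Im z).
Proof.
have E : z = (RtoC (Re z) + Ci * RtoC (Im z))%C.
  by case: z => a b; rewrite /RtoC /Ci /Cplus /Cmult /=; congr pair; ring.
rewrite {1}E; apply: (Rle_trans (Cmod_triangle _ _)).
rewrite Cmod_mult !Cmod_R.
rewrite Cmod_Ci.
by lra.
Qed.

Lemma im_le_Cmod z : Rabs (Im z) <= Cmod z.
Proof. by apply: Rle_trans (Rmax_r _ _) (Rmax_Cmod z). Qed.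

Lemma Cmod_mean_value (F F' : R -> C) a b D :
  (forall x, a <= x <= b -> is_derive (fun t => Re (F t)) x (Re (F' x))) ->
  (forall x, a <= x <= b -> is_derive (fun t => Im (F t)) x (Im (F' x))) ->
  (forall x, a <= x <= b -> Cmod (F' x) <= D) ->
  forall x y, a <= x <= b -> a <= y <= b ->
  Cmod (F x - F y)%C <= 2 * D * Rabs (x - y).
Proof.
move=> hr hi hD x y hx hy; apply: (Rle_trans (Cmod_le_Re_Im _)).
have h1 := @lipschitz_of_derive _ _ a b D hr
  (fun z hz => Rle_trans (re_le_Cmod _) (hD z hz)) x y hx hy.
have h2 := @lipschitz_of_derive _ _ a b D hi
  (fun z hz => Rle_trans (im_le_Cmod _) (hD z hz)) x y hx hy.
rewrite (_ : Re (F x - F y)%C = Re (F x) - Re (F y)) //.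
rewrite (_ : Im (F x - F y)%C = Im (F x) - Im (F y)) //.
by lra.
Qed.

Lemma is_derive_rsum n (f f' : nat -> R -> R) x :
  (forall i, (i < n)%coq_nat -> is_derive (f i) x (f' i x)) ->
  is_derive (fun t => \rsum_(i < n) f i t) x (\rsum_(i < n) f' i x).
Proof.
elim: n => [|n IH] H.
  rewrite gsum_0; apply: (@is_derive_ext _ _ (fun=> 0)); first by move=> t; rewrite gsum_0.
  by auto_derive.
rewrite gsum_recr /=.
apply: (@is_derive_ext _ _ (fun t => rsum n (fun i => f i t) + f n t)).
  by move=> t; rewrite gsum_recr.
apply: (@is_derive_plus R_AbsRing R_NormedModule); last by apply: H; lia.
by apply: IH => i hi; apply: H; lia.
Qed.

(** The support of the cut-off around the stationary point. *)
Definition in_window lam v := -1 <= sv lam v <= 1.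

Lemma window_y lam v : 4 <= lam -> -1 <= sv lam v ->
  0 < 4 * lam ^ 2 + v /\ lam <= yv lam v.
Proof.
rewrite /sv => l4 h; split; last by lra.
apply: Rnot_le_lt => hn.
by have : yv lam v = 0; [exact: sqrt_neg_0 | lra].
Qed.

(** Amplitudes bounded by [a] whose variation along the window is [O(a)]: the
    window has [O(lam)] integer points. *)
Definition tame (lam a : R) (A : R -> R) :=
  (forall v, in_window lam v -> Rabs (A v) <= a) /\
  (forall v, in_window lam v -> in_window lam (v + 1) ->
     Rabs (A (v + 1) - A v) <= a / lam).

Lemma window_0 lam : 0 <= lam -> in_window lam 0.
Proof.
move=> l0; rewrite /in_window /sv /yv Rplus_0_r.
by rewrite (_ : 4 * lam ^ 2 = (2 * lam) * (2 * lam)) ?sqrt_square; lra.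
Qed.

Lemma tame_ge0 lam a A : 4 <= lam -> tame lam a A -> 0 <= a.
Proof.
move=> l4 [A1 _]; apply: Rle_trans (A1 0 _); first exact: Rabs_pos.
by apply: window_0; lra.
Qed.

Lemma tame_mul lam a b A B : 4 <= lam ->
  tame lam a A -> tame lam b B -> tame lam (2 * (a * b)) (fun v => A v * B v).
Proof.
move=> l4 At Bt; have l0 : 0 < lam by lra.
have a0 := tame_ge0 l4 At; have b0 := tame_ge0 l4 Bt.
case: At Bt => [A1 A2] [B1 B2]; split=> [v hv|v hv hv'].
  rewrite Rabs_mult; have := A1 v hv; have := B1 v hv.
  by have := Rabs_pos (A v); have := Rabs_pos (B v); nra.
have -> : A (v + 1) * B (v + 1) - A v * B v =
  (A (v + 1) - A v) * B (v + 1) + A v * (B (v + 1) - B v) by ring.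
apply: (Rle_trans (Rabs_triang _ _)); rewrite !Rabs_mult.
have -> : 2 * (a * b) / lam = (a / lam) * b + a * (b / lam) by field; lra.
apply: Rplus_le_compat; apply: Rmult_le_compat => //; try exact: Rabs_pos.
- by apply: A2.
- by apply: B1.
- by apply: A1.
- by apply: B2.
Qed.

Lemma tame_scal lam a c A :
  tame lam a A -> tame lam (Rabs c * a) (fun v => c * A v).
Proof.
move=> [A1 A2]; split=> [v hv|v hv hv'].
  by rewrite Rabs_mult; apply: Rmult_le_compat_l; [exact: Rabs_pos | apply: A1].
rewrite -Rmult_minus_distr_l Rabs_mult /Rdiv Rmult_assoc.
by apply: Rmult_le_compat_l; [exact: Rabs_pos | apply: A2].
Qed.

Lemma tame_plus lam a b A B :
  tame lam a A -> tame lam b B -> tame lam (a + b) (fun v => A v + B v).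
Proof.
move=> [A1 A2] [B1 B2]; split=> [v hv|v hv hv'].
  by apply: (Rle_trans (Rabs_triang _ _)); have := A1 v hv; have := B1 v hv; lra.
have -> : A (v + 1) + B (v + 1) - (A v + B v) = (A (v + 1) - A v) + (B (v + 1) - B v) by ring.
apply: (Rle_trans (Rabs_triang _ _)); have := A2 v hv hv'; have := B2 v hv hv'.
by rewrite /Rdiv; lra.
Qed.

Lemma tame_le lam a b A : 0 < lam -> a <= b -> tame lam a A -> tame lam b A.
Proof.
move=> l0 ab [A1 A2]; split=> [v hv|v hv hv']; first by have := A1 v hv; lra.
apply: (Rle_trans (A2 v hv hv')); apply: Rmult_le_compat_r => //.
by apply/Rlt_le/Rinv_0_lt_compat.
Qed.

Lemma sv_step lam v : 4 <= lam -> in_window lam v ->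
  0 <= sv lam (v + 1) - sv lam v <= / (4 * lam).
Proof.
move=> l4 hv; have [p y1] := window_y l4 (proj1 hv).
have y2 := @yv_incr lam v (v + 1) ltac:(lra).
have -> : sv lam (v + 1) - sv lam v = (yv lam (v + 1) - yv lam v) / 2.
  by rewrite /sv; field.
rewrite yv_diff //; split.
  by apply: Rdiv_le_0_compat; [apply/Rlt_le/Rinv_0_lt_compat|]; lra.
by rewrite /Rdiv -Rinv_mult; apply: Rinv_le_contravar; lra.
Qed.

Lemma tame_sv lam : 4 <= lam -> tame lam 1 (sv lam).
Proof.
move=> l4; split=> [v [h1 h2]|v hv _]; first by split_Rabs; lra.
have [h1 h2] := sv_step l4 hv; rewrite Rabs_pos_eq //.
apply: (Rle_trans h2); rewrite /Rdiv Rmult_1_l; apply: Rinv_le_contravar; lra.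
Qed.

Lemma tame_lip lam F L b : 4 <= lam -> L <= 4 * b ->
  (forall s, Rabs (F s) <= b) ->
  (forall s t, Rabs (F s - F t) <= L * Rabs (s - t)) ->
  tame lam b (fun v => F (sv lam v)).
Proof.
move=> l4 Lb hb hL; split=> [v _|v hv _]; first exact: hb.
apply: (Rle_trans (hL _ _)); have [h1 h2] := sv_step l4 hv; rewrite Rabs_pos_eq //.
have b0 : 0 <= b by apply: Rle_trans (hb 0); exact: Rabs_pos.
apply: (@Rle_trans _ (4 * b * / (4 * lam))); last by right; field; lra.
apply: (@Rle_trans _ (4 * b * (sv lam (v + 1) - sv lam v))).
  by apply: Rmult_le_compat_r.
by apply: Rmult_le_compat_l; lra.
Qed.

Lemma tame_inv_y lam : 4 <= lam -> tame lam (/ lam) (fun v => / yv lam v).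
Proof.
move=> l4; split=> [v [h1 h2]|v hv _].
  have [p y1] := window_y l4 h1.
  rewrite Rabs_pos_eq; last by apply/Rlt_le/Rinv_0_lt_compat; lra.
  by apply: Rinv_le_contravar; lra.
have [p y1] := window_y l4 (proj1 hv).
have y2 := @yv_incr lam v (v + 1) ltac:(lra).
have -> : / yv lam (v + 1) - / yv lam v =
  - ((yv lam (v + 1) - yv lam v) * (/ yv lam (v + 1) * / yv lam v)).
  by field; lra.
rewrite Rabs_Ropp yv_diff //.
have i1 : / yv lam v <= / lam by apply: Rinv_le_contravar; lra.
have i2 : / yv lam (v + 1) <= / lam by apply: Rinv_le_contravar; lra.
have i3 : / (yv lam (v + 1) + yv lam v) <= 1.
  by rewrite -[X in _ <= X]Rinv_1; apply: Rinv_le_contravar; lra.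
have j1 : 0 < / yv lam v by apply: Rinv_0_lt_compat; lra.
have j2 : 0 < / yv lam (v + 1) by apply: Rinv_0_lt_compat; lra.
have j3 : 0 < / (yv lam (v + 1) + yv lam v) by apply: Rinv_0_lt_compat; lra.
rewrite Rabs_pos_eq; last by apply: Rmult_le_pos; nra.
rewrite -[X in _ <= X]Rmult_1_l; apply: Rmult_le_compat => //; try nra.
Qed.

(** Partial summation from [phase_sum]: a tame amplitude varies by [O(a)] in
    total, since the window has [O(lam)] points.  The amplitude vanishes
    outside the window, so the range [|v| <= V] only has to contain it. *)
Lemma phase_amplitude_sum c : 0 < c -> exists C, 0 < C /\
  forall lam q h (V : nat) a A, 4 <= lam -> 9 <= q -> c * q <= lam ->
  2 * IZR (Z.abs h) <= q -> 8 * lam + 4 <= INR V -> INR V < 4 * lam ^ 2 ->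
  tame lam a A ->
  (forall v, 0 < 4 * lam ^ 2 + v -> 1 <= Rabs (sv lam v) -> A v = 0) ->
  Cmod (czsum (- Z.of_nat V) (2 * V + 1)
          (fun v => RtoC (A (IZR v)) * ec (phase q lam h v))%C)
    <= C * a * sqrt (lam * q) * wz h.
Proof.
move=> c0; have [C [C0 HC]] := phase_sum c0.
exists (C * 19); split; first by lra.
move=> lam q h V a A l4 q9 cq hq V1 V2 At A0.
have [u1 u2] := archimed (4 - 8 * lam).
have [w1 w2] := archimed (- (8 * lam + 4)).
set v0 := up (4 - 8 * lam) in u1 u2.
set v1 := (- up (- (8 * lam + 4)))%Z.
have v1E : IZR v1 = - IZR (up (- (8 * lam + 4))) by rewrite opp_IZR.
have v01 : (v0 <= v1)%Z by apply: le_IZR; lra.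
pose n := Z.to_nat (v1 - v0).
have nE : INR n = IZR v1 - IZR v0.
  by rewrite INR_IZR_INZ /n Z2Nat.id ?minus_IZR //; lia.
have VR : IZR (- Z.of_nat V) = - INR V by rewrite opp_IZR -INR_IZR_INZ.
have V0 : (- Z.of_nat V <= v0)%Z by apply: le_IZR; rewrite VR; lra.
have V3 : (v1 <= Z.of_nat V)%Z by apply: le_IZR; rewrite -INR_IZR_INZ; lra.
have l2 : 8 * lam + 4 < 4 * lam ^ 2 by nra.
have s0 : -1 <= sv lam (IZR v0) by apply/Rlt_le/sv_gtN1; lra.
have s1 : sv lam (IZR v1) <= 1.
  by apply/Rlt_le/sv_lt1; [lra | lra | lra].
have smon v w : v <= w -> sv lam v <= sv lam w.
  by move=> hvw; rewrite /sv; have := @yv_incr lam v w hvw; lra.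
have hwin i : (i <= n)%coq_nat -> in_window lam (IZR v0 + INR i).
  move=> hi; have := le_INR _ _ hi => hi'; have := pos_INR i => i0.
  split; first by apply: Rle_trans s0 (smon _ _ _); lra.
  by apply: Rle_trans (smon _ _ _) s1; lra.
pose f v := (if (Z.ltb v v0 || Z.ltb v1 v)%bool then RtoC 0
             else RtoC (A (IZR v)) * ec (phase q lam h v))%C.
rewrite (@zsum_eq _ _ _ _ _ _ f); last first.
  move=> v hv; rewrite /f; case: ifP => //.
  have vV1 : - INR V <= IZR v by rewrite -VR; apply: IZR_le; lia.
  have vp : 0 < 4 * lam ^ 2 + IZR v by lra.
  case: Z.ltb_spec => [hv0 _|hv0]; last case: Z.ltb_spec => [hv1 _|//].
    rewrite A0 ?Cmult_0_l //.
    have hle : IZR v <= IZR v0 - 1 by rewrite -minus_IZR; apply: IZR_le; lia.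
    have := @sv_leN1 lam (IZR v) ltac:(lra) ltac:(lra) ltac:(lra).
    by split_Rabs; lra.
  rewrite A0 ?Cmult_0_l //.
  have hle : IZR v1 + 1 <= IZR v by rewrite -plus_IZR; apply: IZR_le; lia.
  have := @sv_ge1 lam (IZR v) ltac:(lra) ltac:(lra) ltac:(lra).
  by split_Rabs; lra.
rewrite (@zsum_widen _ _ _ v0 n.+1); last first.
- by rewrite /n; lia.
- by lia.
- move=> v hv; rewrite /f; case: Z.ltb_spec => h1 //=.
  by case: Z.ltb_spec => h2 //; rewrite /n in hv; lia.
rewrite /zsum (@gsum_eq _ _ _ _ _ (fun i => RtoC (A (IZR v0 + INR i)%R) *
   ec (phase q lam h (v0 + Z.of_nat i)))%C); last first.
  move=> i hi; rewrite /f; case: Z.ltb_spec => h1 /=; first by lia.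
  case: Z.ltb_spec => h2 /=; first by rewrite /n in hi; lia.
  by rewrite plus_IZR -INR_IZR_INZ.
have Hps j : (j <= n)%coq_nat ->
    Cmod (\csum_(i < j.+1) ec (phase q lam h (v0 + Z.of_nat i)))
    <= C * sqrt (lam * q) * wz h.
  move=> hj; apply: HC => //; first by lra.
  by case: (hwin j hj).
have [At1 At2] := At.
have a0 := tame_ge0 l4 At.
apply: (Rle_trans (@abel_ineq_lip n _ _ _ a (a / lam) Hps _ _)).
- by rewrite Cmod_R; apply/At1/hwin.
- move=> i hi; rewrite -RtoC_minus Cmod_R S_INR -Rplus_assoc; apply: At2.
    by apply: hwin; lia.
  by rewrite Rplus_assoc -S_INR; apply: hwin; lia.
have hn : INR n <= 18 * lam by lra.
have -> : C * 19 * a * sqrt (lam * q) * wz h =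
  C * sqrt (lam * q) * wz h * (19 * a) by ring.
apply: Rmult_le_compat_l.
  apply: Rmult_le_pos; last by apply/Rlt_le/wz_pos.
  by apply: Rmult_le_pos; [lra | apply: sqrt_pos].
suff : INR n * (a / lam) <= 18 * a by lra.
apply: (@Rle_trans _ (18 * lam * (a / lam))); last by right; field; lra.
by apply: Rmult_le_compat_r => //; apply: Rdiv_le_0_compat; lra.
Qed.

(** All that is used of a smooth compactly supported weight; a single constant
    bounds the function, its derivative and the Lipschitz constant of the
    latter. *)
Definition lip_weight (g g' : R -> R) (G : R) :=
  [/\ 0 < G, forall x, is_derive g x (g' x), forall x, Rabs (g x) <= G,
      forall x, Rabs (g' x) <= G
    & forall x y, Rabs (g' x - g' y) <= G * Rabs (x - y)].

Lemma lip_weight_lip g g' G : lip_weight g g' G ->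
  forall x y, Rabs (g x - g y) <= G * Rabs (x - y).
Proof.
case=> G0 Hd _ Hb _ x y.
apply: (@lipschitz_of_derive g g' (Rmin x y) (Rmax x y)) => //.
- by split; [apply: Rmin_l | apply: Rmax_l].
- by split; [apply: Rmin_r | apply: Rmax_r].
Qed.

Definition ampl (g : R -> R) (P lam v : R) :=
  g ((4 * lam ^ 2 + v) / P) * om (sv lam v).

(** Derivative of [ampl] in [lam] at fixed [v]. *)
Definition ampl' (g g' : R -> R) (P lam v : R) :=
  8 * lam / P * (g' ((4 * lam ^ 2 + v) / P) * om (sv lam v)) +
  - 2 * (g ((4 * lam ^ 2 + v) / P) * om' (sv lam v) * sv lam v * / yv lam v).

(** The sum over the integer points [v] near the stationary point indexed by
    [lam]; it makes sense for real [lam], hence can be differentiated. *)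
Definition bsum (g : R -> R) (P q : R) (V : nat) (h : Z) (lam : R) : C :=
  czsum (- Z.of_nat V) (2 * V + 1)
    (fun v => RtoC (ampl g P lam (IZR v)) * ec (phase q lam h v))%C.

Lemma is_derive_ampl g g' G P lam v : lip_weight g g' G -> 0 < P ->
  0 < 4 * lam ^ 2 + v ->
  is_derive (fun l => ampl g P l v) lam (ampl' g g' P lam v).
Proof.
case=> _ Hd _ _ _ P0 h; have y0 := yv_pos h.
have D1 : is_derive (fun l => g ((4 * l ^ 2 + v) / P)) lam
    (g' ((4 * lam ^ 2 + v) / P) * (8 * lam / P)).
  apply: (@is_derive_compR g (fun l => (4 * l ^ 2 + v) / P)) => //.
  by auto_derive => //; field; lra.
have D2 := @is_derive_compR om (fun l => sv l v) lam _ _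
  (is_derive_om _) (is_derive_sv_l h).
have D := @is_derive_mult R_AbsRing _ _ lam _ _ D1 D2 Rmult_comm.
rewrite /plus /mult /= in D.
have -> : ampl' g g' P lam v =
  g' ((4 * lam ^ 2 + v) / P) * (8 * lam / P) * om (sv lam v) +
  g ((4 * lam ^ 2 + v) / P) * (om' (sv lam v) * (-2 * sv lam v / yv lam v)).
  by rewrite /ampl'; field; lra.
exact: D.
Qed.

Lemma is_derive_phase q lam h v : 0 < q -> 0 < 4 * lam ^ 2 + IZR v ->
  is_derive (fun l => phase q l h v) lam (- 4 * sv lam (IZR v) ^ 2 / q).
Proof.
move=> q0 hv; have D := is_derive_Psi_l hv.
rewrite /phase; auto_derive; first by exists (- 4 * sv lam (IZR v) ^ 2).
by rewrite (is_derive_unique _ _ _ D); field; lra.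
Qed.

Definition bterm' (g g' : R -> R) (P q : R) (h : Z) (lam : R) (v : Z) : C :=
  ((RtoC (ampl' g g' P lam (IZR v)) +
    Ci * RtoC (2 * PI * (ampl g P lam (IZR v) * (- 4 * sv lam (IZR v) ^ 2 / q)))) *
   ec (phase q lam h v))%C.

Lemma is_derive_bterm g g' G P q lam h v : lip_weight g g' G -> 0 < P -> 0 < q ->
  0 < 4 * lam ^ 2 + IZR v ->
  is_derive (fun l => Re (RtoC (ampl g P l (IZR v)) * ec (phase q l h v))%C) lam
    (Re (bterm' g g' P q h lam v)) /\
  is_derive (fun l => Im (RtoC (ampl g P l (IZR v)) * ec (phase q l h v))%C) lam
    (Im (bterm' g g' P q h lam v)).
Proof.
move=> Hg P0 q0 hv.
have D1 := is_derive_ampl Hg P0 hv; have D2 := is_derive_phase h q0 hv.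
set a' := ampl' _ _ _ _ _ in D1; set p' := _ / q in D2.
split.
  apply: (@is_derive_ext _ _ (fun l => ampl g P l (IZR v) * cos (2 * PI * phase q l h v))).
    by move=> t; rewrite /= Rmult_0_l Rminus_0_r.
  have D3 := @is_derive_compR cos (fun l => 2 * PI * phase q l h v) lam
    (- sin (2 * PI * phase q lam h v)) (2 * PI * p').
  have {}D3 := D3 ltac:(by auto_derive => //; ring) ltac:(by apply: is_derive_scal).
  have D := @is_derive_mult R_AbsRing _ _ lam _ _ D1 D3 Rmult_comm.
  rewrite /plus /mult /= in D.
  suff -> : Re (bterm' g g' P q h lam v) = a' * cos (2 * PI * phase q lam h v) +
     ampl g P lam (IZR v) * (- sin (2 * PI * phase q lam h v) * (2 * PI * p')) by exact: D.
  by rewrite /bterm' -/a' -/p' /=; ring.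
apply: (@is_derive_ext _ _ (fun l => ampl g P l (IZR v) * sin (2 * PI * phase q l h v))).
  by move=> t; rewrite /= Rmult_0_l Rplus_0_r.
have D3 := @is_derive_compR sin (fun l => 2 * PI * phase q l h v) lam
  (cos (2 * PI * phase q lam h v)) (2 * PI * p').
have {}D3 := D3 ltac:(by auto_derive => //; ring) ltac:(by apply: is_derive_scal).
have D := @is_derive_mult R_AbsRing _ _ lam _ _ D1 D3 Rmult_comm.
rewrite /plus /mult /= in D.
suff -> : Im (bterm' g g' P q h lam v) = a' * sin (2 * PI * phase q lam h v) +
   ampl g P lam (IZR v) * (cos (2 * PI * phase q lam h v) * (2 * PI * p')) by exact: D.
by rewrite /bterm' -/a' -/p' /=; ring.
Qed.

Lemma tame_weight (f : R -> R) G lam P : 4 <= lam -> lam <= P ->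
  (forall x, Rabs (f x) <= G) ->
  (forall x y, Rabs (f x - f y) <= G * Rabs (x - y)) ->
  tame lam G (fun v => f ((4 * lam ^ 2 + v) / P)).
Proof.
move=> l4 lP hb hl; split=> [v _|v _ _]; first exact: hb.
have G0 : 0 <= G by apply: Rle_trans (hb 0); exact: Rabs_pos.
apply: (Rle_trans (hl _ _)).
have -> : (4 * lam ^ 2 + (v + 1)) / P - (4 * lam ^ 2 + v) / P = / P by field; lra.
rewrite Rabs_pos_eq; last by apply/Rlt_le/Rinv_0_lt_compat; lra.
by apply: Rmult_le_compat_l => //; apply: Rinv_le_contravar; lra.
Qed.

Lemma tame_ampl g g' G lam P : lip_weight g g' G -> 4 <= lam -> lam <= P ->
  tame lam (4 * G) (ampl g P lam).
Proof.
move=> Hg l4 lP; have [G0 _ hb _ _] := Hg.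
have t1 := tame_weight l4 lP hb (lip_weight_lip Hg).
have t2 := @tame_lip lam om 2 2 l4 ltac:(lra) _ om_lip.
have {}t2 := t2 (fun s => ltac:(have := om_range s; split_Rabs; lra)).
apply: tame_le (tame_mul l4 t1 t2); lra.
Qed.

(** Differentiating in [lam] multiplies the amplitude by [O(lam / P + 1 / lam)],
    which is [O(1 / q)] when [q] is [O(lam)] and [lam q] is [O(P)]. *)
Lemma tame_ampl' g g' G lam P q K : lip_weight g g' G -> 4 <= lam -> lam <= P ->
  0 < q -> q <= K * lam -> lam * q <= K * P ->
  tame lam (64 * G * K / q) (ampl' g g' P lam).
Proof.
move=> Hg l4 lP q0 K1 K2; have [G0 _ hb hb' hl'] := Hg.
have K0 : 0 < K.
  apply: Rnot_le_lt => hK.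
  by have := @Rmult_le_compat_r lam K 0 ltac:(lra) hK; lra.
have t1 := tame_weight l4 lP hb (lip_weight_lip Hg).
have t1' := tame_weight l4 lP hb' hl'.
have t2 := @tame_lip lam om 2 2 l4 ltac:(lra) _ om_lip.
have {}t2 := t2 (fun s => ltac:(have := om_range s; split_Rabs; lra)).
have t3 := @tame_lip lam om' 8 2 l4 ltac:(lra) om'_bound om'_lip.
have il : 0 < / lam by apply: Rinv_0_lt_compat; lra.
have iq : 0 < / q by apply: Rinv_0_lt_compat; lra.
have A := @tame_scal _ _ (8 * lam / P) _
  (tame_mul l4 t1' t2).
have B1 := tame_mul l4 t1 t3.
have B2 := tame_mul l4 B1 (tame_sv l4).
have B3 := tame_mul l4 B2 (tame_inv_y l4).
have B := @tame_scal _ _ (- 2) _ B3.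
apply: tame_le (tame_plus A B); first by lra.
  rewrite (Rabs_pos_eq (8 * lam / P)); last by apply: Rdiv_le_0_compat; lra.
  have -> : Rabs (- 2) = 2 by split_Rabs; lra.
  have e1 : lam / P <= K / q.
    apply: (Rmult_le_reg_r (P * q)); first by nra.
    rewrite (_ : lam / P * (P * q) = lam * q); last by field; lra.
    by rewrite (_ : K / q * (P * q) = K * P) //; field; lra.
  have e2 : / lam <= K / q.
    apply: (Rmult_le_reg_r (lam * q)); first by nra.
    rewrite (_ : / lam * (lam * q) = q); last by field; lra.
    by rewrite (_ : K / q * (lam * q) = K * lam) //; field; lra.
  rewrite (_ : 8 * lam / P = 8 * (lam / P)); last by rewrite /Rdiv; ring.
  rewrite (_ : 64 * G * K / q = 64 * G * (K / q)); last by rewrite /Rdiv; ring.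
  by move: (lam / P) (/ lam) (K / q) e1 e2 => x y z *; nra.
Qed.

Lemma sv_vanish g P lam v : 1 <= Rabs (sv lam v) -> ampl g P lam v = 0.
Proof. by move=> h; rewrite /ampl om_zero ?Rmult_0_r. Qed.

(** The derivative of a term of [bsum] in [lam] is again an amplitude times the
    same exponential, with amplitude smaller by a factor [q]: the phase
    contributes [- 4 s^2 / q], which is bounded by [4 / q] in the window.  So
    both assertions follow from [phase_amplitude_sum]. *)
Lemma bsum_bounds c K : 0 < c -> 0 < K -> exists C, 0 < C /\
  forall g g' G P q h (V : nat) l1 l2, lip_weight g g' G ->
  4 <= l1 -> 9 <= q -> c * q <= l1 -> q <= K * l1 -> l2 <= P ->
  l2 * q <= K * P -> 2 * IZR (Z.abs h) <= q ->
  8 * l2 + 4 <= INR V -> INR V < 4 * l1 ^ 2 ->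
  (forall l, l1 <= l <= l2 ->
     Cmod (bsum g P q V h l) <= C * G * sqrt (l2 * q) * wz h) /\
  (forall l l', l1 <= l <= l2 -> l1 <= l' <= l2 ->
     Cmod (bsum g P q V h l - bsum g P q V h l')%C
       <= C * G * sqrt (l2 * q) * wz h / q * Rabs (l - l')).
Proof.
move=> c0 K0; have [C [C0 HC]] := phase_amplitude_sum c0.
exists (C * (128 * K + 1024)); split; first by nra.
move=> g g' G P q h V l1 l2 Hg l4 q9 cq qK l2P l2q hq V2 V1.
have [G0 _ _ _ _] := Hg.
have wp := wz_pos h.
have sq l : l1 <= l <= l2 -> sqrt (l * q) <= sqrt (l2 * q).
  by move=> hl; apply: sqrt_le_1_alt; nra.
have core l a A : l1 <= l <= l2 -> tame l a A ->
    (forall v, 0 < 4 * l ^ 2 + v -> 1 <= Rabs (sv l v) -> A v = 0) ->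
    Cmod (czsum (- Z.of_nat V) (2 * V + 1)
            (fun v => RtoC (A (IZR v)) * ec (phase q l h v))%C)
      <= C * a * sqrt (l2 * q) * wz h.
  move=> hl At A0.
  apply: (Rle_trans (HC l q h V a A ltac:(lra) q9 ltac:(lra) hq ltac:(lra) ltac:(nra) At A0)).
  have a0 : 0 <= a by apply: (tame_ge0 _ At); lra.
  have := sq l hl; have := sqrt_pos (l * q) => *.
  apply: Rmult_le_compat_r; first by lra.
  by apply: Rmult_le_compat_l => //; nra.
have s0 := sqrt_pos (l2 * q).
split=> [l hl|l l' hl hl'].
  apply: (Rle_trans (core l (4 * G) _ hl _ _)).
  - by apply: (tame_ampl Hg); lra.
  - by move=> v _; apply: sv_vanish.
  apply: Rmult_le_compat_r; first by lra.
  by apply: Rmult_le_compat_r => //; rewrite Rmult_assoc; apply: Rmult_le_compat_l; nra.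
have P0 : 0 < P by lra.
have q0 : 0 < q by lra.
pose F' l := czsum (- Z.of_nat V) (2 * V + 1) (bterm' g g' P q h l).
have pos x v : l1 <= x <= l2 -> (- Z.of_nat V <= v)%Z -> 0 < 4 * x ^ 2 + IZR v.
  move=> hx hv; have : - INR V <= IZR v by rewrite INR_IZR_INZ -opp_IZR; apply: IZR_le.
  have : l1 * l1 <= x * x by nra.
  by nra.
have := @Cmod_mean_value (bsum g P q V h) F' l1 l2 (C * (64 * G * K / q + 512 * G / q) * sqrt (l2 * q) * wz h).
move=> /(_ _ _ _ l l' hl hl') H.
have {H} H : Cmod (bsum g P q V h l - bsum g P q V h l')%C <=
   2 * (C * (64 * G * K / q + 512 * G / q) * sqrt (l2 * q) * wz h) * Rabs (l - l').
  apply: H => x hx.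
  - rewrite /F' /zsum Re_csum.
    apply: (@is_derive_ext _ _ (fun t => \rsum_(i < (2 * V + 1)%N)
       Re (RtoC (ampl g P t (IZR (- Z.of_nat V + Z.of_nat i))) *
           ec (phase q t h (- Z.of_nat V + Z.of_nat i)))%C)).
      by move=> t; rewrite /bsum /zsum Re_csum.
    apply: (@is_derive_rsum _ (fun i t => Re (RtoC (ampl g P t (IZR (- Z.of_nat V + Z.of_nat i))) *
           ec (phase q t h (- Z.of_nat V + Z.of_nat i)))%C)
           (fun i t => Re (bterm' g g' P q h t (- Z.of_nat V + Z.of_nat i)))) => i _.
    by apply: (proj1 (is_derive_bterm h Hg P0 q0 _)); apply: pos => //; lia.
  - rewrite /F' /zsum Im_csum.
    apply: (@is_derive_ext _ _ (fun t => \rsum_(i < (2 * V + 1)%N)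
       Im (RtoC (ampl g P t (IZR (- Z.of_nat V + Z.of_nat i))) *
           ec (phase q t h (- Z.of_nat V + Z.of_nat i)))%C)).
      by move=> t; rewrite /bsum /zsum Im_csum.
    apply: (@is_derive_rsum _ (fun i t => Im (RtoC (ampl g P t (IZR (- Z.of_nat V + Z.of_nat i))) *
           ec (phase q t h (- Z.of_nat V + Z.of_nat i)))%C)
           (fun i t => Im (bterm' g g' P q h t (- Z.of_nat V + Z.of_nat i)))) => i _.
    by apply: (proj2 (is_derive_bterm h Hg P0 q0 _)); apply: pos => //; lia.
  have -> : F' x = (czsum (- Z.of_nat V) (2 * V + 1)
      (fun v => RtoC (ampl' g g' P x (IZR v)) * ec (phase q x h v)) +
    Ci * czsum (- Z.of_nat V) (2 * V + 1)
      (fun v => RtoC (- 8 * PI / q * (ampl g P x (IZR v) * sv x (IZR v) * sv x (IZR v))) * ec (phase q x h v)))%C.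
    rewrite -czsum_scal -[RHS]/(Cplus _ _) -zsum_split /F'; apply: zsum_eq => v _ /=.
    rewrite /bterm' (_ : 2 * PI * _ = - 8 * PI / q * (ampl g P x (IZR v) * sv x (IZR v) * sv x (IZR v))); first by ring.
    by field; lra.
  apply: (Rle_trans (Cmod_triangle _ _)); rewrite Cmod_mult.
  rewrite Cmod_Ci.
  rewrite Rmult_1_l.
  have c1 := core x (64 * G * K / q) (ampl' g g' P x) hx.
  have {}c1 := c1 ltac:(by apply: (tame_ampl' Hg); nra).
  have {}c1 := c1 ltac:(by move=> v _ hv; rewrite /ampl' om_zero // om'_zero //; ring).
  have t4 := tame_ampl Hg (P := P) (lam := x) ltac:(lra) ltac:(lra).
  have x4 : 4 <= x by lra.
  have t5 := tame_mul x4 t4 (tame_sv x4).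
  have t6 := tame_mul x4 t5 (tame_sv x4).
  have t7 := @tame_scal _ _ (- 8 * PI / q) _ t6.
  have iq : 0 < / q by apply: Rinv_0_lt_compat; lra.
  have t8 : tame x (512 * G / q) (fun v => - 8 * PI / q * (ampl g P x v * sv x v * sv x v)).
    apply: tame_le t7; first by lra.
    have -> : - 8 * PI / q = - (8 * PI * / q) by rewrite /Rdiv; ring.
    have [p1 p2] := PI_bounds.
    rewrite Rabs_Ropp Rabs_pos_eq; last by nra.
    rewrite /Rdiv; have : 8 * PI * / q <= 32 * / q by nra.
    by move: (8 * PI * / q) => y; nra.
  have c2 := core x _ _ hx t8.
  have {}c2 := c2 ltac:(by move=> v _ hv; rewrite sv_vanish //; ring).
  by lra.
apply: (Rle_trans H); right; field; lra.
Qed.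

(** * From the sum over m to the sum over stationary points *)

Lemma ec_neq1 t : 0 < t < 1 -> ec t <> RtoC 1.
Proof.
move=> ht; rewrite /ec (_ : 2 * PI * t = 2 * (PI * t)); last by ring.
have s0 : 0 < sin (PI * t) by have [h1 h2] := PI_bounds; apply: sin_gt_0; nra.
by rewrite cos_2a_sin => -[h _]; nra.
Qed.

(** Shifting [h] by 1 multiplies the sum by [ec (Y / q)], hence the sum vanishes
    unless this root of unity is 1. *)
Lemma ec_orthogonality (q : nat) a Y : (0 < q)%coq_nat ->
  czsum a q (fun h => ec (IZR (h * Y) / INR q)) =
  if (Y mod Z.of_nat q =? 0)%Z then RtoC (INR q) else RtoC 0.
Proof.
move=> q0; have qp : 0 < INR q by apply: lt_0_INR.
have qZ : IZR (Z.of_nat q) = INR q by rewrite -INR_IZR_INZ.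
have Ymod := Z.mod_pos_bound Y (Z.of_nat q) ltac:(lia).
have Ydiv := Z.div_mod Y (Z.of_nat q) ltac:(lia).
case: Z.eqb_spec => hY.
  rewrite (@zsum_eq _ _ _ _ _ _ (fun=> RtoC 1)).
    by rewrite -RtoC_rzsum rzsum_const Rmult_1_r.
  move=> h _; rewrite (_ : _ / _ = IZR (h * (Y / Z.of_nat q))) ?ec_IZR //.
  rewrite {1}Ydiv hY Z.add_0_r !mult_IZR qZ; field; lra.
set S := czsum _ _ _.
have : (S * ec (IZR Y / INR q))%C = S.
  rewrite /S Cmult_comm -czsum_scal.
  rewrite (@zsum_eq _ _ _ _ _ _ (fun h => ec (IZR ((h + 1) * Y) / INR q))); last first.
    by move=> h _; rewrite -ec_plus; congr ec; rewrite !mult_IZR plus_IZR; field; lra.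
  rewrite (zsum_shift _ _ _ _ (fun h => ec (IZR (h * Y) / INR q))).
  have spR c f : czsum c q f = Cplus (czsum c q.-1 f) (f (c + Z.of_nat q.-1)%Z).
    have -> : czsum c q f = czsum c (q.-1 + 1) f by congr zsum; lia.
    by rewrite zsum_cat /zsum (gsum_recr _ 0) gsum_0 /= Cplus_0_l Z.add_0_r.
  have spL c f : czsum c q f = Cplus (f c) (czsum (c + 1) q.-1 f).
    have -> : czsum c q f = czsum c (1 + q.-1) f by congr zsum; lia.
    by rewrite zsum_cat {1}/zsum gsum_recr gsum_0 /= Cplus_0_l Z.add_0_r.
  rewrite spR spL Cplus_comm; congr Cplus.
  apply: (@ec_int_diff _ _ Y).
  rewrite (_ : (a + 1 + Z.of_nat q.-1 = a + Z.of_nat q)%Z); last by lia.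
  by rewrite !mult_IZR plus_IZR qZ; field; lra.
move=> E; have {E} : (S * (ec (IZR Y / INR q) - 1))%C = RtoC 0.
  have -> : (S * (ec (IZR Y / INR q) - 1) = S * ec (IZR Y / INR q) - S)%C by ring.
  by rewrite E; ring.
move=> E; case: (Ceq_dec S 0) => // S0.
have ne : ec (IZR Y / INR q) <> RtoC 1.
  rewrite (@ec_int_diff _ (IZR (Y mod Z.of_nat q) / INR q) (Y / Z.of_nat q)).
    apply: ec_neq1; split.
      by apply: Rdiv_lt_0_compat => //; apply: IZR_lt; lia.
    apply: (Rmult_lt_reg_r (INR q)) => //; rewrite Rmult_1_l.
    rewrite (_ : _ / _ * _ = IZR (Y mod Z.of_nat q)); last by field; lra.
    by rewrite -qZ; apply: IZR_lt; lia.
  by rewrite {1}Ydiv plus_IZR mult_IZR qZ; field; lra.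
exfalso; apply: (@Cmult_neq_0 S (ec (IZR Y / INR q) - 1)%C S0 _ E) => E1; apply: ne.
have -> : ec (IZR Y / INR q) = (ec (IZR Y / INR q) - 1 + 1)%C by ring.
by rewrite E1; ring.
Qed.

(** Detecting the multiples of [q] by additive characters. *)
Lemma csum_multiples (q n : nat) a (F : Z -> C) : (0 < q)%coq_nat ->
  \csum_(m < n) F (Z.of_nat m * Z.of_nat q)%Z =
  (RtoC (/ INR q) * czsum a q (fun h =>
     czsum 0 (n * q) (fun Y => F Y * ec (IZR (h * Y) / INR q))))%C.
Proof.
move=> q0; have qp : 0 < INR q by apply: lt_0_INR.
rewrite zsum_exchange zsum_block -csum_scal; apply: gsum_eq => m _.
rewrite (@zsum_eq _ _ _ _ _ _ (fun Y => F Y *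
    (if (Y mod Z.of_nat q =? 0)%Z then RtoC (INR q) else RtoC 0))%C); last first.
  move=> Y _; rewrite -(ec_orthogonality a Y q0) -czsum_scal.
  by apply: zsum_eq.
rewrite Z.add_0_l (@zsum_eq _ _ _ _ _ _ (fun Y => if (Y =? Z.of_nat m * Z.of_nat q)%Z
    then F Y * RtoC (INR q) else RtoC 0)%C); last first.
  move=> Y hY; rewrite (_ : (Y mod Z.of_nat q =? 0)%Z = (Y =? Z.of_nat m * Z.of_nat q)%Z).
    by case: ifP => // _; ring.
  rewrite (_ : (Y mod Z.of_nat q = Y - Z.of_nat m * Z.of_nat q)%Z); last first.
    by symmetry; apply: (Z.mod_unique_pos _ _ (Z.of_nat m)); lia.
  by case: Z.eqb_spec => h1; case: Z.eqb_spec => h2 //; lia.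
rewrite (@zsum_widen _ _ _ (Z.of_nat m * Z.of_nat q)%Z 1); [|move=> Y hY|lia|lia].
  rewrite /zsum gsum_recr gsum_0 /= Z.add_0_r Z.eqb_refl Cplus_0_l.
  rewrite RtoC_inv; last by lra.
  have : RtoC (INR q) <> RtoC 0 by move=> /RtoC_inj; lra.
  by move=> h; field.
by case: Z.eqb_spec => h //; lia.
Qed.

(** Distance from [n] to the nearest multiple of [k]. *)
Definition zdist (n k : Z) := Z.min (n mod k) (k - n mod k).

(** A geometric sum of ratio [ec (N / k)], whose distance from resonance is
    [zdist N k / k], with a weight [b] of size [beta] that varies by
    [beta / k] at each step.  When [k] divides [N] there is no cancellation and
    the number of terms, at most [L], is the bound. *)
Lemma geometric_abel (n k : nat) (z0 N : Z) (b : nat -> C) beta L :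
  (0 < k)%coq_nat -> 0 <= L ->
  (forall z, (z <= n)%coq_nat -> Cmod (b z) <= beta) ->
  (forall z, (z < n)%coq_nat -> Cmod (b z.+1 - b z)%C <= beta / INR k) ->
  INR n.+1 <= L -> INR k <= L ->
  Cmod (\csum_(z < n.+1) (b z * ec (IZR ((z0 + Z.of_nat z) * N) / INR k))) <=
  14 * L * beta * wz (zdist N (Z.of_nat k)).
Proof.
move=> k0 L0 hb hb' nL kL.
have kp : 0 < INR k by apply: lt_0_INR.
have kZ : IZR (Z.of_nat k) = INR k by rewrite -INR_IZR_INZ.
have beta0 : 0 <= beta := Rle_trans (Cmod_ge_0 _) (hb 0%N ltac:(lia)).
have Nmod := Z.mod_pos_bound N (Z.of_nat k) ltac:(lia).
have Ndiv := Z.div_mod N (Z.of_nat k) ltac:(lia).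
set d := zdist N (Z.of_nat k); have d0 : (0 <= d)%Z by rewrite /d /zdist; lia.
case: (Z.eq_dec d 0) => dE.
  rewrite dE wz_1 ?Rmult_1_r; last by lia.
  apply: (@Rle_trans _ (INR n.+1 * beta)); last by nra.
  rewrite -rsum_const; apply: (@Cmod_csum_le _ _ (fun=> beta)) => z hz.
  by rewrite Cmod_mult Cmod_ec Rmult_1_r; apply: hb; lia.
have wd : wz d = / IZR d by rewrite /wz; congr (/ IZR _); lia.
have dp : 1 <= IZR d by apply: IZR_le; lia.
have hd : 0 < IZR d / INR k by apply: Rdiv_lt_0_compat; lra.
have hps j : (j <= n)%coq_nat ->
    Cmod (\csum_(z < j.+1) ec (IZR ((z0 + Z.of_nat z) * N) / INR k)) <= 7 / (IZR d / INR k).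
  move=> _; apply: (@kusmin_landau_shift j (fun z => IZR ((z0 + Z.of_nat z) * N) / INR k) _ (- (N / Z.of_nat k))) => //.
  - apply: (Rmult_le_reg_r (2 * INR k)); first by lra.
    rewrite (_ : IZR d / INR k * (2 * INR k) = 2 * IZR d); last by field; lra.
    rewrite (_ : 1 / 2 * (2 * INR k) = INR k); last by field.
    by rewrite -kZ -mult_IZR; apply: IZR_le; rewrite /d /zdist; lia.
  - move=> i _.
    have -> : IZR ((z0 + Z.of_nat i.+1) * N) / INR k - IZR ((z0 + Z.of_nat i) * N) / INR k
       + IZR (- (N / Z.of_nat k)) = IZR (N mod Z.of_nat k) / INR k.
      rewrite opp_IZR (_ : ((z0 + Z.of_nat i.+1) * N = (z0 + Z.of_nat i) * N + N)%Z); last by lia.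
      by rewrite (plus_IZR (_ * N)) {2}Ndiv plus_IZR (mult_IZR (Z.of_nat k)) kZ; field; lra.
    have -> : 1 - IZR d / INR k = (INR k - IZR d) / INR k by field; lra.
    split; apply: Rmult_le_compat_r; try by apply/Rlt_le/Rinv_0_lt_compat.
      by apply: IZR_le; rewrite /d /zdist; lia.
    by rewrite -kZ -minus_IZR; apply: IZR_le; rewrite /d /zdist; lia.
  - move=> i _; right.
    rewrite (_ : ((z0 + Z.of_nat i.+1) * N = (z0 + Z.of_nat i) * N + N)%Z); last by lia.
    rewrite (_ : ((z0 + Z.of_nat i.+2) * N = (z0 + Z.of_nat i) * N + N + N)%Z); last by lia.
    by rewrite !plus_IZR; field; lra.
apply: (Rle_trans (@abel_ineq_lip n b _ _ beta (beta / INR k) hps _ hb')).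
  exact: hb.
rewrite wd.
have -> : 7 / (IZR d / INR k) * (beta + INR n * (beta / INR k)) =
  7 * beta * (INR k + INR n) * / IZR d by field; lra.
apply: Rmult_le_compat_r; first by apply/Rlt_le/Rinv_0_lt_compat; lra.
by rewrite S_INR in nL; nra.
Qed.

Definition alpha (m : nat) : R := sqrt (INR m) ^ 3.

Definition Esum (g : R -> R) (T : R) (n : nat) (x : R) : C :=
  \csum_(m < n) (RtoC (g (INR m / T ^ 2)%R) * ec (x * alpha m)).

(** The condition [0 < a] keeps the sums away from 0, where [m^(3/2)] is not
    smooth. *)
Definition supported (g : R -> R) (a b : R) :=
  0 < a /\ a < b /\ (forall x, x <= a \/ b <= x -> g x = 0).

(** The residues modulo [9 k^2] are represented by the integers of least absolute
    value, and this is the first of them. *)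
Definition freq0 (k : nat) : Z := (- (Z.of_nat (9 * (k * k)) / 2))%Z.

Lemma alpha_dilate k m : (0 < k)%coq_nat ->
  sqrt (INR (m * (9 * (k * k)))) = 3 * INR k * sqrt (INR m).
Proof.
move=> k0; rewrite !mult_INR.
have -> : INR m * (INR 9 * (INR k * INR k)) = (3 * INR k) * (3 * INR k) * INR m.
  by rewrite (_ : INR 9 = 9); [ring | rewrite INR_IZR_INZ].
have := pos_INR k => h.
by rewrite sqrt_mult ?sqrt_square //; [nra | nra | exact: pos_INR].
Qed.

(** With [Y = q m] the phase of [E(k)] is [Y^(3/2) / (3 q)].  After the partition
    of unity in [sqrt Y / 2 - l] and the detection of [q | Y], the character
    [h - l] makes the phase [(y^3 / 3 + (h - l) y^2) / q], and substituting
    [y^2 = 4 l^2 + v] this is [(Psi + h v) / q] plus the constant displayed in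
    front of [bsum].  The shift of the frequency by [l] is free, since any
    complete system of residues detects [q | Y]. *)
Lemma Esum_stationary g a b T n k L0 Ln V : supported g a b -> 0 < T ->
  (0 < k)%coq_nat -> b * T ^ 2 <= INR n ->
  IZR L0 <= 3 / 2 * INR k * (sqrt a * T) - 1 ->
  3 / 2 * INR k * (sqrt b * T) + 1 <= IZR (L0 + Z.of_nat Ln) ->
  (4 <= L0)%Z -> (forall l, (l < L0 + Z.of_nat Ln)%Z -> 8 * IZR l + 4 <= INR V) ->
  let q := INR (9 * (k * k)) in
  Esum g T n (INR k) =
  (RtoC (/ q) * czsum (freq0 k) (9 * (k * k)) (fun h =>
     czsum L0 Ln (fun l =>
       ec ((- (4 / 3) * IZR l ^ 3 + 4 * IZR h * IZR l ^ 2) / q) *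
       bsum g (q * T ^ 2) q V h (IZR l))))%C.
Proof.
move=> [a0 [ab Hsup]] T0 k0 bn HL0 HLn L4 HV q.
have kp : 0 < INR k by apply: lt_0_INR.
have qE : q = 9 * (INR k * INR k).
  by rewrite /q !mult_INR (_ : INR 9 = 9) // INR_IZR_INZ.
have qp : 0 < q by rewrite qE; nra.
have T2 : 0 < T ^ 2 by nra.
pose f (Y : Z) : C := (RtoC (g (IZR Y / (q * T ^ 2))%R) * ec (sqrt (IZR Y) ^ 3 / (3 * q)))%C.
have fE m : f (Z.of_nat m * Z.of_nat (9 * (k * k)))%Z = (RtoC (g (INR m / T ^ 2)%R) * ec (INR k * alpha m))%C.
  rewrite /f -Nat2Z.inj_mul -INR_IZR_INZ.
  have -> : (m * (9 * (k * k)))%coq_nat = (m * (9 * (k * k)))%N by [].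
  rewrite alpha_dilate // mult_INR -/q; congr (RtoC (g _) * ec _)%C; first by field; lra.
  by rewrite /alpha qE; field; lra.
have part m : f (Z.of_nat m * Z.of_nat (9 * (k * k)))%Z =
   czsum L0 Ln (fun l => RtoC (om (sqrt (IZR (Z.of_nat m * Z.of_nat (9 * (k * k)))) / 2 - IZR l)%R) *
     f (Z.of_nat m * Z.of_nat (9 * (k * k)))%Z)%C.
  set F := f _; rewrite (@zsum_eq _ _ _ _ _ _ (fun l => F *
    RtoC (om (sqrt (IZR (Z.of_nat m * Z.of_nat (9 * (k * k)))) / 2 - IZR l)%R))%C); last first.
    by move=> l _; rewrite Cmult_comm.
  rewrite czsum_scal -RtoC_rzsum.
  case: (Req_dec (g (INR m / T ^ 2)) 0) => g0.
    by rewrite /F fE g0; ring.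
  have h1 : a < INR m / T ^ 2 by apply: Rnot_le_lt => h; apply: g0; apply: Hsup; left.
  have h2 : INR m / T ^ 2 < b by apply: Rnot_le_lt => h; apply: g0; apply: Hsup; right.
  rewrite om_partition ?Cmult_1_r //; rewrite -Nat2Z.inj_mul -INR_IZR_INZ alpha_dilate //.
    have : sqrt a * T <= sqrt (INR m).
      rewrite -[T in _ * T](sqrt_square T) -?sqrt_mult; try lra; try nra.
      apply: sqrt_le_1_alt; apply: (Rmult_le_reg_r (/ T ^ 2)); first exact: Rinv_0_lt_compat.
      by rewrite (_ : a * (T * T) * / T ^ 2 = a); [rewrite -/(_ / _); lra | field; lra].
    by move=> h; have := @Rmult_le_compat_l (INR k) _ _ ltac:(lra) h; lra.
  have : sqrt (INR m) <= sqrt b * T.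
    rewrite -[T in _ * T](sqrt_square T) -?sqrt_mult; try lra; try nra.
    apply: sqrt_le_1_alt; apply: (Rmult_le_reg_r (/ T ^ 2)); first exact: Rinv_0_lt_compat.
    by rewrite (_ : b * (T * T) * / T ^ 2 = b); [rewrite -/(_ / _); lra | field; lra].
  by move=> h; have := @Rmult_le_compat_l (INR k) _ _ ltac:(lra) h; lra.
rewrite /Esum (@gsum_eq _ _ _ _ _ (fun m => czsum L0 Ln (fun l =>
  RtoC (om (sqrt (IZR (Z.of_nat m * Z.of_nat (9 * (k * k)))) / 2 - IZR l)%R) *
     f (Z.of_nat m * Z.of_nat (9 * (k * k)))%Z)%C)); last first.
  by move=> m _; rewrite -part fE.
rewrite -zsum_exchange_nat [in RHS]zsum_exchange -czsum_scal.
apply: zsum_eq => l hl.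
pose F Y := (RtoC (om (sqrt (IZR Y) / 2 - IZR l)%R) * f Y)%C.
rewrite -(@gsum_eq _ _ _ _ (fun m => F (Z.of_nat m * Z.of_nat (9 * (k * k)))%Z)); last by [].
rewrite (@csum_multiples _ _ (freq0 k - l)); last by lia.
rewrite -/q; congr Cmult.
rewrite -[(freq0 k - l)%Z]/((freq0 k + - l)%Z) -zsum_shift.
apply: zsum_eq => h _; rewrite /bsum -czsum_scal.
pose Phi Y := (F Y * ec (IZR ((h + - l) * Y) / q))%C.
rewrite -[LHS]/(czsum 0 (n * (9 * (k * k))) Phi).
rewrite (@zsum_eq _ _ _ (- Z.of_nat V) _ _ (fun v => Phi (v + 4 * l * l)%Z)); last first.
  move=> v hv; rewrite /Phi /F /f.
  have YE : IZR (v + 4 * l * l) = 4 * IZR l ^ 2 + IZR v by rewrite plus_IZR !mult_IZR; ring.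
  rewrite YE; rewrite -/(yv (IZR l) (IZR v)) -/(sv (IZR l) (IZR v)).
  rewrite /ampl.
  case: (Rle_dec (4 * IZR l ^ 2 + IZR v) 0) => hp.
    rewrite (_ : g _ = 0); first by rewrite Rmult_0_l; ring.
    apply: Hsup; left; apply: (@Rle_trans _ 0); last by lra.
    have : 0 < / (q * T ^ 2) by apply: Rinv_0_lt_compat; nra.
    by rewrite /Rdiv; nra.
  have y2 := @yv_sqr (IZR l) (IZR v) ltac:(lra).
  rewrite RtoC_mult.
  have -> : ec ((- (4 / 3) * IZR l ^ 3 + 4 * IZR h * IZR l ^ 2) / q) = 
    (ec (yv (IZR l) (IZR v) ^ 3 / (3 * q)) * ec (IZR ((h + - l) * (v + 4 * l * l)) / q) *
     ec (- phase q (IZR l) h v))%C.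
    rewrite -!ec_plus; congr ec; rewrite mult_IZR YE plus_IZR opp_IZR /phase /Psi y2.
    by field; lra.
  have -> : ec (phase q (IZR l) h v) = (/ ec (- phase q (IZR l) h v))%C.
    have E : (ec (phase q (IZR l) h v) * ec (- phase q (IZR l) h v) = 1)%C.
      by rewrite -ec_plus Rplus_opp_r ec_0.
    have ne : ec (- phase q (IZR l) h v) <> RtoC 0.
      by move=> e0; have := Cmod_ec (- phase q (IZR l) h v); rewrite e0 Cmod_0; lra.
    by rewrite -[LHS]Cmult_1_r -(Cinv_r _ ne) Cmult_assoc E Cmult_1_l.
  have ne : ec (- phase q (IZR l) h v) <> RtoC 0.
    by move=> e0; have := Cmod_ec (- phase q (IZR l) h v); rewrite e0 Cmod_0; lra.
  by field.
rewrite zsum_shift.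
have l4 : 4 <= IZR l by apply: IZR_le; lia.
have gneg Y : (Y < 0)%Z -> Phi Y = RtoC 0.
  move=> hY; rewrite /Phi /F /f (_ : g _ = 0); first by ring.
  apply: Hsup; left; have : IZR Y <= 0 by apply: IZR_le; lia.
  have : 0 < / (q * T ^ 2) by apply: Rinv_0_lt_compat; nra.
  by rewrite /Rdiv; nra.
apply: zsum_window => Y hY.
  case: hY => hY; first exact: gneg.
  rewrite /Phi /F /f (_ : g _ = 0); first by ring.
  apply: Hsup; right; apply: (Rmult_le_reg_r (q * T ^ 2)); first by nra.
  rewrite (_ : IZR Y / (q * T ^ 2) * (q * T ^ 2) = IZR Y); last by field; lra.
  have : IZR (Z.of_nat (n * (9 * (k * k)))) <= IZR Y by apply: IZR_le; lia.
  by rewrite -INR_IZR_INZ mult_INR -/q; nra.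
case: (Z_lt_dec Y 0) => Y0; first exact: gneg.
have Y0R : 0 <= IZR Y by apply: IZR_le; lia.
rewrite /Phi /F om_zero; first by ring.
pose v := (Y - 4 * l * l)%Z.
have vE : IZR Y = 4 * IZR l ^ 2 + IZR v by rewrite /v minus_IZR !mult_IZR; ring.
rewrite vE -/(yv (IZR l) (IZR v)) -/(sv (IZR l) (IZR v)).
have hV := HV l ltac:(lia).
have VR := INR_IZR_INZ V.
case: hY => hY.
  have : IZR v <= - INR V by rewrite VR -opp_IZR; apply: IZR_le; rewrite /v; lia.
  by move=> hv; have := @sv_leN1 (IZR l) (IZR v) ltac:(lra) ltac:(lra) ltac:(lra); split_Rabs; lra.
have : INR V <= IZR v by rewrite VR; apply: IZR_le; rewrite /v; lia.
by move=> hv; have := @sv_ge1 (IZR l) (IZR v) ltac:(lra) ltac:(lra) ltac:(lra); split_Rabs; lra.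
Qed.

(** Only the [m] up to [b T^2] contribute. *)
Lemma weight_count g a b G T n : supported g a b -> (forall x, Rabs (g x) <= G) ->
  0 < T -> \rsum_(m < n) Rabs (g (INR m / T ^ 2)) <= G * (b * T ^ 2 + 1).
Proof.
move=> [a0 [ab Hsup]] hG T0.
have T2 : 0 < T ^ 2 by nra.
have G0 : 0 <= G := Rle_trans (Rabs_pos _) (hG 0).
have bT : 0 < b * T ^ 2 by nra.
have [u1 u2] := archimed (b * T ^ 2).
pose n0 := Z.to_nat (up (b * T ^ 2)).
have u0 : (0 < up (b * T ^ 2))%Z by apply: lt_IZR; lra.
have n0E : INR n0 = IZR (up (b * T ^ 2)) by rewrite INR_IZR_INZ /n0 Z2Nat.id //; lia.
have H m : (m <= n0)%coq_nat -> \rsum_(i < m) Rabs (g (INR i / T ^ 2)) <= G * (b * T ^ 2 + 1).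
  move=> hm; apply: (Rle_trans (@rsum_le_const m G (fun m => Rabs (g (INR m / T ^ 2))) _)) => //.
  by have := le_INR _ _ hm; nra.
case: (le_dec n n0) => h; first exact: H.
have -> : n = (n0 + (n - n0))%N by lia.
rewrite gsum_cat /= [X in _ + X](@gsum_idx _ _ _ _ (fun i => _)).
  by rewrite Rplus_0_r; apply: H.
move=> i _; rewrite Hsup ?Rabs_R0 //; right.
apply: (Rmult_le_reg_r (T ^ 2)) => //.
rewrite (_ : INR (n0 + i) / T ^ 2 * T ^ 2 = INR (n0 + i)); last by field; lra.
by rewrite plus_INR n0E; have := pos_INR i; lra.
Qed.

Lemma Esum_trivial g a b G T n x : supported g a b -> (forall x, Rabs (g x) <= G) ->
  0 < T -> Cmod (Esum g T n x) <= G * (b * T ^ 2 + 1).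
Proof.
move=> Hs hG T0; apply: Rle_trans (weight_count n Hs hG T0).
apply: (@Cmod_csum_le n _ (fun m => Rabs (g (INR m / T ^ 2)))) => m _.
by rewrite Cmod_mult Cmod_R Cmod_ec; lra.
Qed.

(** The arithmetic factor left by the stationary phase and the completion: the
    residue [r] of the frequency [l] modulo [9k] enters through the quadratic
    polynomial [8hr - 4r^2] modulo [k]. *)
Definition arith_sum (k : nat) : R :=
  rzsum (freq0 k) (9 * (k * k)) (fun h => wz h *
    rzsum 0 (9 * k) (fun r => wz (zdist (8 * h * r - 4 * r * r) (Z.of_nat k)))).

Lemma freq_bound k h : (freq0 k <= h < freq0 k + Z.of_nat (9 * (k * k)))%Z ->
  (2 * Z.abs h <= Z.of_nat (9 * (k * k)))%Z.
Proof.
rewrite /freq0; set q := Z.of_nat _.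
have := Z.div_mod q 2 ltac:(lia); have := Z.mod_pos_bound q 2 ltac:(lia).
by lia.
Qed.

Lemma arith_sum_ge1 k : (0 < k)%coq_nat -> 1 <= arith_sum k.
Proof.
move=> k0.
have in0 h : 0 <= rzsum 0 (9 * k) (fun r => wz (zdist (8 * h * r - 4 * r * r) (Z.of_nat k))).
  by apply: rzsum_ge0 => r _; apply/Rlt_le/wz_pos.
rewrite /arith_sum.
apply: (Rle_trans _ (@rzsum_ge_term _ _ (fun h => wz h * _) 0%Z _ _)).
- rewrite wz_1 ?Rmult_1_l //.
  apply: (Rle_trans _ (@rzsum_ge_term _ _ (fun r => wz (zdist (8 * 0 * r - 4 * r * r) (Z.of_nat k))) 0%Z _ _)).
  + by rewrite wz_1; [lra | rewrite /zdist Z.mod_0_l; lia].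
  + by lia.
  + by move=> r _; apply/Rlt_le/wz_pos.
- rewrite /freq0; set q := Z.of_nat _; have q1 : (1 <= q)%Z by rewrite /q; nia.
  by have := Z.div_mod q 2 ltac:(lia); have := Z.mod_pos_bound q 2 ltac:(lia); lia.
- by move=> h _; apply: Rmult_le_pos => //; apply/Rlt_le/wz_pos.
Qed.

(** Order-of-magnitude bookkeeping: the frequencies [l] lie between [l1] and
    [l2], of order [k T], with [k <= T] and modulus [q = 9 k^2]. *)
Lemma stationary_parameters sa sb : 0 < sa -> sa < sb ->
  exists K T0, 0 < K /\ forall k T, T0 <= T -> 1 <= k -> k <= T ->
  let l1 := sa * (k * T) in let l2 := 2 * sb * (k * T) in
  let q := 9 * (k * k) in
  [/\ 24 * k <= l1, sa / 9 * q <= l1, q <= K * l1, l2 <= q * T ^ 2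
    & l2 * q <= K * (q * T ^ 2) /\ 8 * l2 + 5 < 4 * l1 ^ 2].
Proof.
move=> sa0 sab.
have isa : 0 < / sa by apply: Rinv_0_lt_compat.
exists (9 * / sa + 2 * sb), (24 * / sa + 2 * sb + (16 * sb + 6) * / (sa * sa)).
have ia : 0 < / (sa * sa) by apply: Rinv_0_lt_compat; nra.
split; first by lra.
move=> k T TT k1 kT l1 l2 q.
have Ta : 24 <= sa * T.
  have h : 24 * / sa <= T by nra.
  have := @Rmult_le_compat_l sa _ _ ltac:(lra) h.
  by rewrite (_ : sa * (24 * / sa) = 24) //; field; lra.
have Tb : 2 * sb <= T by nra.
have Tc : 16 * sb + 6 <= sa * sa * T.
  have h : (16 * sb + 6) * / (sa * sa) <= T by nra.
  have := @Rmult_le_compat_l (sa * sa) _ _ ltac:(nra) h.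
  by rewrite (_ : sa * sa * ((16 * sb + 6) * / (sa * sa)) = 16 * sb + 6) //; field; lra.
have l1E : l1 = k * (sa * T) by rewrite /l1; ring.
have kT1 : k * k <= k * T by apply: Rmult_le_compat_l; lra.
have kT0 : 0 <= k * T by nra.
clear TT.
split.
- by rewrite l1E Rmult_comm; apply: Rmult_le_compat_l; lra.
- rewrite (_ : sa / 9 * q = sa * (k * k)); last by rewrite /q; field.
  by apply: Rmult_le_compat_l; lra.
- rewrite (_ : (9 * / sa + 2 * sb) * l1 = 9 * (k * T) + 2 * sb * sa * (k * T)).
    have : 0 <= 2 * sb * sa * (k * T) by apply: Rmult_le_pos => //; nra.
    by rewrite /q; lra.
  by rewrite /l1; field; lra.
- have e1 : l2 <= T * (k * T) by rewrite /l2; apply: Rmult_le_compat_r.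
  have e2 : 1 * (T * (k * T)) <= k * (T * (k * T)).
    by apply: Rmult_le_compat_r => //; apply: Rmult_le_pos; lra.
  have e3 : 0 <= T * (k * T) by apply: Rmult_le_pos; lra.
  have -> : q * T ^ 2 = 9 * (k * (T * (k * T))) by rewrite /q; ring.
  by lra.
- split.
    have -> : (9 * / sa + 2 * sb) * (q * T ^ 2) = ((9 * / sa + 2 * sb) * T ^ 2) * q by ring.
    apply: Rmult_le_compat_r; first by rewrite /q; nra.
    have e1 : k * T <= T ^ 2 by rewrite /= Rmult_1_r; apply: Rmult_le_compat_r; lra.
    have e2 : l2 <= 2 * sb * T ^ 2 by rewrite /l2; apply: Rmult_le_compat_l; lra.
    have e3 : 0 <= 9 * / sa * T ^ 2 by apply: Rmult_le_pos; [lra | apply: pow2_ge_0].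
    by lra.
  have -> : 4 * l1 ^ 2 = 4 * (k * (k * T)) * (sa * sa * T) by rewrite /l1; ring.
  have e1 : 1 * (k * T) <= k * (k * T) by apply: Rmult_le_compat_r.
  have e2 : (k * T) * (16 * sb + 6) <= (k * (k * T)) * (sa * sa * T).
    by apply: Rmult_le_compat; lra.
  by rewrite /l2; nra.
Qed.

(** In [Esum_stationary] the frequency is written [l = r + 9 k z].  Modulo 1,
    [(- 4 l^3 / 3 + 4 h l^2) / (9 k^2)] is its value at [r] plus
    [z (8 h r - 4 r^2) / k], so [geometric_abel] applies to the sum over [z]
    with the weight [bsum], which by [bsum_bounds] varies slowly enough. *)
Lemma Esum_bound_large g g' a b G : lip_weight g g' G -> supported g a b ->
  exists C T0, 0 < C /\ forall T n k, T0 <= T -> 1 <= T -> (0 < k)%coq_nat ->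
  INR k <= T -> b * T ^ 2 <= INR n ->
  Cmod (Esum g T n (INR k)) <= C * (T * sqrt (T / INR k)) * arith_sum k.
Proof.
move=> Hg Hs; have [a0 [ab _]] := Hs; have [G0 _ _ _ _] := Hg.
set sa := sqrt a; set sb := sqrt b.
have sa0 : 0 < sa by apply: sqrt_lt_R0.
have sab : sa < sb by apply: sqrt_lt_1; lra.
have [K [T0 [K0 HK]]] := stationary_parameters sa0 sab.
have [C1 [C10 HC1]] := @bsum_bounds (sa / 9) K ltac:(lra) K0.
exists (14 * (1 + 2 * sb) * (C1 * G * sqrt (2 * sb))).
have sb2 : 0 < sqrt (2 * sb) by apply: sqrt_lt_R0; lra.
exists T0.
split; first by apply: Rmult_lt_0_compat; [lra | apply: Rmult_lt_0_compat => //; nra].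
move=> T n k TT T1 k0 kT bn.
have kp : 1 <= INR k by rewrite -[1]/(INR 1); apply: le_INR; lia.
pose kT' := INR k * T; have kT1 : 1 <= kT'.
  by rewrite /kT' -[X in X <= _]Rmult_1_l; apply: Rmult_le_compat; lra.
set q := INR (9 * (k * k)).
have qE : q = 9 * (INR k * INR k).
  by rewrite /q !mult_INR (_ : INR 9 = 9) // INR_IZR_INZ.
have qp : 9 <= q by rewrite qE; nra.
pose l1 := sa * kT'; pose l2 := 2 * sb * kT'.
have [P1 D2 D3 D4 [D5 D6']] := HK (INR k) T TT kp kT.
rewrite -/kT' -/l1 -/l2 -qE in P1 D2 D3 D4 D5 D6'.
(* the range of [l] begins and ends at multiples of [9k], so that every residue
   [r] modulo [9k] has the same range of [z] *)
pose k9 := 9 * INR k.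
have [u1 u2] := archimed (l1 / k9).
have [v1 v2] := archimed ((3 / 2 * sb * kT' + 1) / k9).
set z0 := up (l1 / k9) in u1 u2; set z1 := up _ in v1 v2.
have k9p : 0 < k9 by rewrite /k9; lra.
have U1 : l1 < k9 * IZR z0.
  by have := @Rmult_lt_compat_l k9 _ _ k9p u1; rewrite (_ : k9 * (l1 / k9) = l1) //; field; lra.
have U2 : k9 * IZR z0 <= l1 + k9.
  have := @Rmult_le_compat_l k9 _ _ ltac:(lra) u2.
  by rewrite Rmult_minus_distr_l (_ : k9 * (l1 / k9) = l1); [lra | field; lra].
have V1 : 3 / 2 * sb * kT' + 1 < k9 * IZR z1.
  have := @Rmult_lt_compat_l k9 _ _ k9p v1.
  by rewrite (_ : k9 * (_ / k9) = 3 / 2 * sb * kT' + 1) //; field; lra.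
have V2 : k9 * IZR z1 <= 3 / 2 * sb * kT' + 1 + k9.
  have := @Rmult_le_compat_l k9 _ _ ltac:(lra) v2.
  by rewrite Rmult_minus_distr_l (_ : k9 * (_ / k9) = 3 / 2 * sb * kT' + 1); [lra | field; lra].
have skT : sa * kT' < sb * kT' by apply: Rmult_lt_compat_r; lra.
have z01 : (z0 < z1)%Z by apply/lt_IZR/(Rmult_lt_reg_l k9) => //; rewrite /l1 /k9 in U2 V1 P1 *; lra.
have z0p : (0 < z0)%Z by apply/lt_IZR/(Rmult_lt_reg_l k9) => //; rewrite /l1 in U1 P1; lra.
pose n1 := Z.to_nat (z1 - z0 - 1).
have n1E : Z.of_nat n1.+1 = (z1 - z0)%Z by rewrite /n1; lia.
have L2 : k9 * IZR z1 <= l2.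
  by rewrite /l2 /k9 in V2 *; rewrite /l1 in P1; lra.
have n1T : INR n1.+1 <= (1 + 2 * sb) * T.
  rewrite INR_IZR_INZ n1E minus_IZR.
  have z0R : 0 < IZR z0 by apply: IZR_lt.
  have z1T : IZR z1 <= 2 * sb * T.
    apply: (Rmult_le_reg_l k9) => //; apply: (Rle_trans L2).
    rewrite /l2 /kT' /k9 (_ : 9 * INR k * (2 * sb * T) = 9 * (2 * sb * (INR k * T))); last by ring.
    have : 0 <= 2 * sb * (INR k * T) by apply: Rmult_le_pos; rewrite -/kT'; lra.
    by lra.
  by lra.
have LT0 : 0 <= (1 + 2 * sb) * T by apply: Rmult_le_pos; lra.
have LT1 : INR k <= (1 + 2 * sb) * T.
  apply: (Rle_trans kT); rewrite -[X in X <= _]Rmult_1_l.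
  by apply: Rmult_le_compat_r; lra.
pose L0 := (z0 * (9 * Z.of_nat k))%Z; pose Ln := (n1.+1 * (9 * k))%N.
have kZ : IZR (Z.of_nat k) = INR k by rewrite -INR_IZR_INZ.
have L0E : IZR L0 = k9 * IZR z0 by rewrite /L0 !mult_IZR kZ /k9; ring.
have LnE : IZR (L0 + Z.of_nat Ln) = k9 * IZR z1.
  have -> : (L0 + Z.of_nat Ln = z1 * (9 * Z.of_nat k))%Z by rewrite /L0 /Ln; nia.
  by rewrite !mult_IZR kZ /k9; ring.
have [V [hV1 hV2]] : exists V : nat, 8 * l2 + 4 <= INR V <= 8 * l2 + 5 .
  have [w1 w2] := archimed (8 * l2 + 4).
  exists (Z.to_nat (up (8 * l2 + 4))).
  rewrite INR_IZR_INZ Z2Nat.id; first by lra.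
  have l20 : 0 <= l2 by rewrite /l2; apply: Rmult_le_pos; lra.
  by apply: le_IZR; lra.
have D6 : INR V < 4 * l1 ^ 2 by lra.
have lrange l : (L0 <= l < L0 + Z.of_nat Ln)%Z -> l1 <= IZR l <= l2.
  move=> [h1 h2].
  have h3 : IZR L0 <= IZR l by apply: IZR_le.
  have h4 : IZR l <= IZR (L0 + Z.of_nat Ln) by apply: IZR_le; lia.
  by rewrite LnE in h4; rewrite L0E in h3; lra.
rewrite (@Esum_stationary g a b T n k L0 Ln V) //; try lra; try lia.
- rewrite -/q Cmod_mult Cmod_R Rabs_pos_eq; last by apply/Rlt_le/Rinv_0_lt_compat; lra.
  have inner h r : (freq0 k <= h < freq0 k + Z.of_nat (9 * (k * k)))%Z ->
      (0 <= r < Z.of_nat (9 * k))%Z ->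
      Cmod (\csum_(z < n1.+1) (ec ((- (4 / 3) * IZR (L0 + Z.of_nat z * Z.of_nat (9 * k) + r)%Z ^ 3
          + 4 * IZR h * IZR (L0 + Z.of_nat z * Z.of_nat (9 * k) + r)%Z ^ 2) / q) *
        bsum g (q * T ^ 2) q V h (IZR (L0 + Z.of_nat z * Z.of_nat (9 * k) + r)%Z)))
      <= 14 * ((1 + 2 * sb) * T) * (C1 * G * sqrt (l2 * q) * wz h) *
         wz (zdist (8 * h * r - 4 * r * r) (Z.of_nat k)).
    move=> hh hr.
    have hq : 2 * IZR (Z.abs h) <= q.
      by rewrite -mult_IZR /q INR_IZR_INZ; apply: IZR_le; apply: freq_bound.
    have [B1 B2] := @HC1 g g' G (q * T ^ 2) q h V l1 l2 Hg
      ltac:(lra) qp D2 D3 D4 D5 hq hV1 D6.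
    pose N := (8 * h * r - 4 * r * r)%Z.
    pose c0 := (- (4 / 3) * IZR r ^ 3 + 4 * IZR h * IZR r ^ 2) / q.
    pose bz z := bsum g (q * T ^ 2) q V h (IZR (L0 + Z.of_nat z * Z.of_nat (9 * k) + r)%Z).
    rewrite (@gsum_eq _ _ _ _ _ (fun z => ec c0 * (bz z * ec (IZR ((z0 + Z.of_nat z) * N) / INR k)))%C); last first.
      move=> z _; rewrite -/(bz z).
      pose w := (z0 + Z.of_nat z)%Z.
      have -> : (L0 + Z.of_nat z * Z.of_nat (9 * k) + r = r + 9 * Z.of_nat k * w)%Z by rewrite /L0 /w; nia.
      rewrite -/w (@ec_int_diff _ (c0 + IZR (w * N) / INR k) (36 * h * w * w - 36 * r * w * w - 108 * Z.of_nat k * w * w * w)).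
        by rewrite ec_plus; ring.
      rewrite /N /c0 !minus_IZR plus_IZR !mult_IZR minus_IZR !mult_IZR kZ qE.
      by field; lra.
    rewrite csum_scal Cmod_mult Cmod_ec Rmult_1_l.
    have inr z : (z < n1.+1)%coq_nat -> l1 <= IZR (L0 + Z.of_nat z * Z.of_nat (9 * k) + r) <= l2.
      by move=> hz; apply: lrange; rewrite /Ln; nia.
    apply: geometric_abel => //.
    - by move=> z hz; apply: B1; apply: inr; lia.
    - move=> z hz; apply: (Rle_trans (B2 _ _ (inr z.+1 _) (inr z _))); try lia.
      rewrite -minus_IZR (_ : (_ - _ = 9 * Z.of_nat k)%Z); last by lia.
      rewrite Rabs_pos_eq; last by apply: IZR_le; lia.
      by rewrite mult_IZR kZ; right; rewrite {2}qE; field; lra.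
  rewrite (@zsum_eq _ _ _ _ _ _ (fun h => czsum 0 (9 * k) (fun r =>
    \csum_(z < n1.+1) (ec ((- (4 / 3) * IZR (L0 + Z.of_nat z * Z.of_nat (9 * k) + r)%Z ^ 3
          + 4 * IZR h * IZR (L0 + Z.of_nat z * Z.of_nat (9 * k) + r)%Z ^ 2) / q) *
        bsum g (q * T ^ 2) q V h (IZR (L0 + Z.of_nat z * Z.of_nat (9 * k) + r)%Z)))%C)); last first.
    move=> h _; rewrite zsum_exchange_nat /Ln zsum_block; apply: gsum_eq => z _.
    set F := fun l => (ec _ * _)%C.
    rewrite -[RHS]/(czsum 0 (9 * k) (fun r => F (L0 + Z.of_nat z * Z.of_nat (9 * k) + r)%Z)).
    rewrite -[LHS]/(czsum (0 + (L0 + Z.of_nat z * Z.of_nat (9 * k))) (9 * k) F) -zsum_shift.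
    by apply: zsum_eq => r _; rewrite Z.add_comm.
  apply: (@Rle_trans _ (/ q * rzsum (freq0 k) (9 * (k * k)) (fun h =>
     14 * ((1 + 2 * sb) * T) * (C1 * G * sqrt (l2 * q)) * (wz h *
     rzsum 0 (9 * k) (fun r => wz (zdist (8 * h * r - 4 * r * r) (Z.of_nat k))))))).
    apply: Rmult_le_compat_l; first by apply/Rlt_le/Rinv_0_lt_compat; lra.
    apply: Cmod_czsum_le => h hh.
    rewrite -Rmult_assoc -rzsum_scal.
    apply: Cmod_czsum_le => r hr.
    apply: (Rle_trans (inner h r hh ltac:(lia))); right; ring.
  rewrite rzsum_scal -/(arith_sum k).
  have A1 := arith_sum_ge1 k0.
  have -> : sqrt (l2 * q) = sqrt (2 * sb) * (sqrt (T / INR k) * (3 * INR k * INR k)).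
    have -> : l2 * q = (2 * sb) * ((T / INR k) * ((3 * INR k * INR k) * (3 * INR k * INR k))).
      by rewrite /l2 /kT' qE; field; lra.
    have Tk : 0 <= T / INR k by apply: Rdiv_le_0_compat; lra.
    have k2 : 0 <= 3 * INR k * INR k by nra.
    rewrite (sqrt_mult (2 * sb)); [|lra|by apply: Rmult_le_pos => //; apply: Rmult_le_pos].
    by rewrite (sqrt_mult (T / INR k)) ?sqrt_square //; apply: Rmult_le_pos.
  have S0 : 0 <= sqrt (T / INR k) := sqrt_pos _.
  have X0 : 0 <= 14 * (1 + 2 * sb) * (C1 * G * sqrt (2 * sb)) * (T * sqrt (T / INR k)) * arith_sum k.
    by repeat apply: Rmult_le_pos; lra.
  apply: (@Rle_trans _ (14 * (1 + 2 * sb) * (C1 * G * sqrt (2 * sb)) * (T * sqrt (T / INR k)) * arith_sum k * (/ 3))).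
    by right; rewrite qE; field; lra.
  by lra.
- by rewrite L0E -/sa; rewrite /l1 /k9 /kT' in U2 P1 *; lra.
- by rewrite LnE -/sb; rewrite /kT' in V1; lra.
- move=> l hl; have : IZR l <= IZR (L0 + Z.of_nat Ln) by apply: IZR_le; lia.
  by rewrite LnE; lra.
Qed.

(** For bounded [T] the trivial bound is enough, because the right-hand side is
    at least a constant: [arith_sum k] is at least 1 and [k <= T]. *)
Lemma Esum_bound g g' a b G : lip_weight g g' G -> supported g a b ->
  exists C, 0 < C /\ forall T n k, 1 <= T -> (0 < k)%coq_nat ->
  INR k <= T -> b * T ^ 2 <= INR n ->
  Cmod (Esum g T n (INR k)) <= C * (T * sqrt (T / INR k)) * arith_sum k.
Proof.
move=> Hg Hs; have [C [T0 [C0 H]]] := Esum_bound_large Hg Hs.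
have [G0 _ hG _ _] := Hg; have [a0 [ab _]] := Hs.
pose D := G * (b * T0 ^ 2 + 1).
have D0 : 0 <= D by apply: Rmult_le_pos; [lra | have := pow2_ge_0 T0; nra].
exists (C + D); split; first by lra.
move=> T n k T1 k0 kT bn.
have kp : 1 <= INR k by rewrite -[1]/(INR 1); apply: le_INR; lia.
have A1 := arith_sum_ge1 k0.
have S1 : 1 <= sqrt (T / INR k).
  rewrite -sqrt_1; apply: sqrt_le_1_alt.
  by apply: (Rmult_le_reg_r (INR k)); [lra | rewrite /Rdiv Rmult_assoc Rinv_l; lra].
have TS : 1 <= T * sqrt (T / INR k) by nra.
case: (Rle_dec T0 T) => h.
  apply: (Rle_trans (H T n k h T1 k0 kT bn)).
  apply: Rmult_le_compat_r; first by lra.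
  by apply: Rmult_le_compat_r; lra.
have hE := @Esum_trivial g a b G T n (INR k) Hs hG ltac:(lra).
have hD : G * (b * T ^ 2 + 1) <= D.
  rewrite /D; apply: Rmult_le_compat_l; first by lra.
  have : T ^ 2 <= T0 ^ 2 by apply: pow_incr; lra.
  by nra.
have : 1 <= T * sqrt (T / INR k) * arith_sum k by nra.
by rewrite Rmult_assoc; nra.
Qed.

(** * The arithmetic average: divisors and quadratic congruences *)

(** For each prime power [p^e] of the decomposition the list is lengthened [e]
    times, each time by as many divisors as the primes treated before it had
    given. *)
Lemma size_divisors n :
  size (divisors n) = \prod_(f <- prime_decomp n) f.2.+1.
Proof.
rewrite /divisors; elim: (prime_decomp n) => [|[p e] s IH] /=; first by rewrite big_nil.
rewrite big_cons /= -IH; set d := foldr _ _ s.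
have H m : forall t, size (iter m (fun d' => merge leq [seq NatTrec.mul p i | i <- d'] d) t)
    = (m * size d + size t)%N.
  elim: m => [|m IHm] t //=.
  by rewrite size_merge size_cat size_map IHm mulSn; lia.
by rewrite H mulSn addnC.
Qed.

Lemma ln_le_x1 x : 0 < x -> ln x <= x - 1.
Proof. by move=> h; have := exp_ineq1_le (ln x); rewrite exp_ln //; lra. Qed.

Lemma Rpower_ge1 x e : 1 <= x -> 0 <= e -> 1 <= Rpower x e.
Proof.
move=> hx he; rewrite /Rpower -exp_0; have : 0 <= e * ln x.
  by apply: Rmult_le_pos => //; rewrite -ln_1; apply: Rcomplements.ln_le; lra.
by move=> h; have := exp_ineq1_le (e * ln x); rewrite exp_0; lra.
Qed.

(** [C1] is paid once for each prime below [P0]. *)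
Lemma prod_divisors_bound eps C1 P0 (s : seq (nat * nat)) :
  0 < eps -> 1 <= C1 ->
  (forall p e, (2 <= p)%N -> INR e.+1 <= C1 * Rpower (INR (p ^ e)) eps) ->
  (forall p e, (P0 <= p)%N -> (2 <= p)%N -> INR e.+1 <= Rpower (INR (p ^ e)) eps) ->
  all (fun f => 2 <= f.1)%N s ->
  INR (\prod_(f <- s) f.2.+1) <=
  C1 ^ (count (fun f => f.1 < P0)%N s) * Rpower (INR (\prod_(f <- s) f.1 ^ f.2)) eps.
Proof.
move=> e0 C11 Hs Hl; elim: s => [|[p e] s IH] /=.
  by rewrite !big_nil /= Rmult_1_l; move=> _; apply: Rpower_ge1; lra.
move=> /andP[p2 als]; have {}IH := IH als.
rewrite !big_cons /= -!multE !mult_INR.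
have pos : (0 < \prod_(f <- s) f.1 ^ f.2)%N.
  elim: s als {IH} => [|[p' e'] s IH] /=; first by rewrite big_nil.
  by move=> /andP[h1 /IH h2]; rewrite big_cons muln_gt0 h2 expn_gt0 /=; lia.
have pos1 : 0 < INR (\prod_(f <- s) f.1 ^ f.2) by apply: lt_0_INR; apply/ltP.
have pos2 : 0 < INR (p ^ e) by apply: lt_0_INR; apply/ltP; rewrite expn_gt0; lia.
rewrite -Rpower_mult_distr //.
set A := INR (\prod_(f <- s) f.2.+1) in IH *.
have A0 : 0 <= A by apply: pos_INR.
set B := Rpower (INR (\prod_(f <- s) _)) _ in IH *.
have B0 : 0 < B by apply: exp_pos.
set D := C1 ^ count _ s in IH *.
have D0 : 0 < D by apply: pow_lt; lra.
set E := Rpower (INR (p ^ e)) eps.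
have E0 : 0 < E by apply: exp_pos.
case: ltnP => hp.
  change (INR e.+1 * A <= C1 * D * (E * B)).
  apply: (@Rle_trans _ ((C1 * E) * (D * B))); last by right; ring.
  by apply: Rmult_le_compat => //; [apply: pos_INR | exact: Hs].
change (INR e.+1 * A <= D * (E * B)).
apply: (@Rle_trans _ (E * (D * B))); last by right; ring.
by apply: Rmult_le_compat => //; [apply: pos_INR | exact: Hl].
Qed.

Lemma Rpower_INR_exp p e eps : (2 <= p)%N ->
  Rpower (INR (p ^ e)) eps = exp (INR e * (eps * ln (INR p))).
Proof.
move=> p2; rewrite /Rpower; congr exp.
have p0 : 0 < INR p by apply: lt_0_INR; lia.
have -> : INR (p ^ e) = INR p ^ e.
  by elim: e => [|e IH] //=; rewrite expnS -multE mult_INR IH.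
by rewrite ln_pow //; ring.
Qed.

(** If [p^eps >= 2] then [e + 1 <= 2^e <= (p^e)^eps]; each of the finitely many
    smaller primes costs at most a constant factor [C1]. *)
Lemma divisor_bound eps : 0 < eps -> exists C, 0 < C /\
  forall n, (0 < n)%N -> INR (size (divisors n)) <= C * Rpower (INR n) eps.
Proof.
move=> e0; have l2 : 0 < ln 2 by rewrite -ln_1; apply: ln_increasing; lra.
pose C1 := 1 + / (eps * ln 2).
have i0 : 0 < / (eps * ln 2) by apply: Rinv_0_lt_compat; nra.
have [P0 hP0] : exists P0 : nat, Rpower 2 (/ eps) <= INR P0.
  have [u1 _] := archimed (Rpower 2 (/ eps)); exists (Z.to_nat (up (Rpower 2 (/ eps)))).
  rewrite INR_IZR_INZ Z2Nat.id; first by lra.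
  by apply: le_IZR; have : 0 < Rpower 2 (/ eps) by [apply: exp_pos]; lra.
exists (C1 ^ P0); split; first by apply: pow_lt; rewrite /C1; lra.
move=> n n0; rewrite size_divisors {2}(prod_prime_decomp n0).
have hprime f : f \in prime_decomp n -> prime f.1.
  by case: f => p e /mem_prime_decomp[].
have lnp p : (2 <= p)%N -> ln 2 <= ln (INR p).
  move=> p2; apply: Rcomplements.ln_le; first by lra.
  by rewrite -[2]/(INR 2); apply: le_INR; lia.
apply: (Rle_trans (@prod_divisors_bound eps C1 P0 _ e0 _ _ _ _)).
- by rewrite /C1; lra.
- move=> p e p2; rewrite Rpower_INR_exp //.
  have h := exp_ineq1_le (INR e * (eps * ln (INR p))).
  have h2 : INR e * (eps * ln 2) <= INR e * (eps * ln (INR p)).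
    apply: Rmult_le_compat_l; first exact: pos_INR.
    by apply: Rmult_le_compat_l; [lra | apply: lnp].
  apply: (@Rle_trans _ (C1 * (1 + INR e * (eps * ln 2)))).
    rewrite S_INR /C1 (_ : (1 + _) * _ = 1 + INR e * (eps * ln 2) + / (eps * ln 2) + INR e).
      by have := pos_INR e; have : 0 <= INR e * (eps * ln 2) by [apply: Rmult_le_pos; [exact: pos_INR | nra]]; lra.
    by field; lra.
  by apply: Rmult_le_compat_l; [rewrite /C1; lra | lra].
- move=> p e hp p2; rewrite Rpower_INR_exp //.
  have h : ln 2 <= eps * ln (INR p).
    have : ln (Rpower 2 (/ eps)) <= ln (INR p).
      apply: Rcomplements.ln_le; first exact: exp_pos.
      by apply: (Rle_trans hP0); apply: le_INR; lia.
    rewrite /Rpower ln_exp => h.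
    have := @Rmult_le_compat_l eps _ _ ltac:(lra) h.
    by rewrite (_ : eps * (/ eps * ln 2) = ln 2) //; field; lra.
  apply: (@Rle_trans _ (2 ^ e)).
    elim: e => [|e IH]; first by rewrite /=; lra.
    rewrite S_INR -tech_pow_Rmult; have : 1 <= 2 ^ e by apply: pow_R1_Rle; lra.
    by lra.
  rewrite -Rpower_pow; last by lra.
  rewrite /Rpower; have := @Rmult_le_compat_l (INR e) _ _ (pos_INR e) h.
  by case => [hlt|->]; [apply/Rlt_le/exp_increasing | lra].
- by apply/allP => f /hprime /prime_gt1.
apply: Rmult_le_compat_r; first by apply/Rlt_le/exp_pos.
apply: Rle_pow; first by rewrite /C1; lra.
apply/leP; rewrite -size_filter -(size_map fst) -[X in (_ <= X)%N](size_iota 0).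
apply: uniq_leq_size.
  have : uniq (unzip1 (prime_decomp n)).
    by have := primes_uniq n; rewrite /primes.
  by apply: subseq_uniq; apply: map_subseq; apply: filter_subseq.
by move=> p /mapP[f]; rewrite mem_filter => /andP[h _] ->; rewrite mem_iota.
Qed.

Lemma count_divisors n K : (0 < n)%N ->
  \rsum_(i < K) (if (i.+1 %| n)%N then 1 else 0) <= INR (size (divisors n)).
Proof.
move=> n0.
have -> : \rsum_(i < K) (if (i.+1 %| n)%N then 1 else 0)
    = INR (count (fun i => i.+1 %| n)%N (iota 0 K)).
  elim: K => [|K IH]; first by rewrite gsum_0.
  have cE (p : pred nat) : count p (iota 0 K.+1) = (count p (iota 0 K) + p K)%N.
    by rewrite -addn1 iotaD count_cat [iota _ 1]/= /= add0n addn0.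
  rewrite gsum_recr IH cE plus_INR.
  by case: (K.+1 %| n)%N.
apply: le_INR; apply/leP; rewrite -size_filter -(size_map S).
apply: uniq_leq_size.
  by rewrite map_inj_uniq ?filter_uniq ?iota_uniq // => x y [].
by move=> d /mapP[i]; rewrite mem_filter => /andP[h _] ->; rewrite -dvdn_divisors.
Qed.

(** Twice the harmonic number of [B], plus 1. *)
Definition harmonic (B : nat) : R := rzsum (- Z.of_nat B) (2 * B + 1) wz.

Lemma wz_opp z : wz (- z) = wz z.
Proof. by rewrite /wz Z.abs_opp. Qed.

Lemma rzsum_1 a f : rzsum a 1 f = f a.
Proof. by rewrite /zsum gsum_recr gsum_0 /= Z.add_0_r Rplus_0_l. Qed.

Lemma rzsum_cat a n m f :
  rzsum a (n + m) f = rzsum a n f + rzsum (a + Z.of_nat n) m f.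
Proof. exact: zsum_cat. Qed.

Lemma harmonic_step B : harmonic B.+1 = harmonic B + 2 * / INR B.+1.
Proof.
have wB : wz (Z.of_nat B.+1) = / INR B.+1.
  by rewrite /wz INR_IZR_INZ; congr (/ IZR _); lia.
rewrite /harmonic (_ : (2 * B.+1 + 1 = 1 + ((2 * B + 1) + 1))%N); last by lia.
set n := (2 * B + 1)%N; rewrite 2!rzsum_cat !rzsum_1.
rewrite (_ : (- Z.of_nat B.+1 + Z.of_nat 1 = - Z.of_nat B)%Z); last by lia.
rewrite (_ : (- Z.of_nat B + Z.of_nat n = Z.of_nat B.+1)%Z); last by rewrite /n; lia.
by rewrite wz_opp wB; ring.
Qed.

Lemma harmonic_ge0 B : 0 <= harmonic B.
Proof. by apply: rzsum_ge0 => z _; apply/Rlt_le/wz_pos. Qed.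

Lemma harmonic_log B : (0 < B)%coq_nat -> harmonic B <= 3 + 2 * ln (INR B).
Proof.
case: B => [|B _]; first by lia.
elim: B => [|B IH].
  have h0 : harmonic 0 = 1 by rewrite /harmonic /zsum gsum_recr gsum_0 /= wz_1; [lra | lia].
  by rewrite harmonic_step h0 /= ln_1; lra.
rewrite harmonic_step.
have p : 0 < INR B.+1 by apply: lt_0_INR; lia.
have p2 : INR B.+2 = INR B.+1 + 1 by rewrite S_INR.
suff : / INR B.+2 <= ln (INR B.+2) - ln (INR B.+1) by lra.
have := @ln_le_x1 (INR B.+1 / INR B.+2) ltac:(apply: Rdiv_lt_0_compat; lra).
rewrite /Rdiv ln_mult ?ln_Rinv; try lra; last by apply: Rinv_0_lt_compat; lra.
have -> : INR B.+1 * / INR B.+2 - 1 = - / INR B.+2 by rewrite p2; field; lra.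
by lra.
Qed.

Lemma harmonic_bound e : 0 < e -> exists C, 0 < C /\
  forall B, (0 < B)%coq_nat -> harmonic B <= C * Rpower (INR B) e.
Proof.
move=> e0; exists (3 + 2 / e); have ie : 0 < / e by apply: Rinv_0_lt_compat.
split; first by rewrite /Rdiv; lra.
move=> B B0; apply: (Rle_trans (harmonic_log B0)).
have h1 : 1 <= INR B by rewrite -[1]/(INR 1); apply: le_INR; lia.
have h2 := @Rpower_ge1 (INR B) e h1 ltac:(lra).
have h3 := exp_ineq1_le (e * ln (INR B)); rewrite -/(Rpower _ _) in h3.
have h4 : ln (INR B) <= / e * Rpower (INR B) e.
  apply: (Rmult_le_reg_l e) => //; rewrite -Rmult_assoc Rinv_r ?Rmult_1_l; lra.
by rewrite /Rdiv; nra.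
Qed.

Definition dvd_ind (k n : Z) : R := if (n mod k =? 0)%Z then 1 else 0.

Lemma dvd_ind_range k n : 0 <= dvd_ind k n <= 1.
Proof. by rewrite /dvd_ind; case: ifP => _; lra. Qed.

(** A residue close to 0 is a multiple of [k] close to [N]. *)
Lemma wz_zdist_le (N : Z) (k K : nat) : (0 < k)%coq_nat -> (k <= K)%coq_nat ->
  wz (zdist N (Z.of_nat k)) <=
  rzsum (- Z.of_nat K) (2 * K + 1) (fun c => wz c * dvd_ind (Z.of_nat k) (N - c)).
Proof.
move=> k0 kK; set kz := Z.of_nat k.
have Nm := Z.mod_pos_bound N kz ltac:(lia).
have Nd := Z.div_mod N kz ltac:(lia).
have [c [h1 [h2 h3]]] : exists c, (Z.abs c = zdist N kz)%Z /\ (Z.abs c <= kz)%Z /\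
    ((N - c) mod kz = 0)%Z.
  case: (Z_le_dec (N mod kz) (kz - N mod kz)) => h.
    exists (N mod kz)%Z; rewrite /zdist; do 2 (split; first by lia).
    rewrite (_ : (N - N mod kz = (N / kz) * kz)%Z); last by lia.
    by rewrite Z_mod_mult.
  exists (N mod kz - kz)%Z; rewrite /zdist; do 2 (split; first by lia).
  rewrite (_ : (N - (N mod kz - kz) = (N / kz + 1) * kz)%Z); last by lia.
  by rewrite Z_mod_mult.
apply: (Rle_trans _ (@rzsum_ge_term _ _ (fun c => wz c * dvd_ind kz (N - c)) c _ _)).
- rewrite /dvd_ind h3 /= Rmult_1_r /wz h1; right; congr (/ IZR (Z.max 1 _)).
  by rewrite Z.abs_eq // -h1; lia.
- by lia.
- move=> z _; apply: Rmult_le_pos; first by apply/Rlt_le/wz_pos.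
  by case: (dvd_ind_range kz (N - z)).
Qed.

Lemma dvd_ind_nat k (n : Z) : (0 < k)%coq_nat ->
  dvd_ind (Z.of_nat k) n = if (k %| Z.abs_nat n)%N then 1 else 0.
Proof.
move=> k0; rewrite /dvd_ind; case: Z.eqb_spec => h; case: ifP => // h2; exfalso.
  move/negP: h2; apply; apply/dvdnP.
  have := Z.div_mod n (Z.of_nat k) ltac:(lia); rewrite h => hn.
  by exists (Z.abs_nat (n / Z.of_nat k)); nia.
apply: h; move/dvdnP: h2 => [m hm].
have [->|->] : n = (Z.of_nat m * Z.of_nat k)%Z \/ n = (- Z.of_nat m * Z.of_nat k)%Z by lia.
  by rewrite Z_mod_mult.
by rewrite Z_mod_mult.
Qed.

(** The weights of the moduli beyond [r0] are at most [W r0.+1], and the number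
    of those moduli that divide [n] is at most the number of divisors of [n]. *)
Lemma weighted_divisors (W : nat -> R) (K r0 : nat) (n : Z) :
  (forall k, 0 <= W k) -> (forall j k, (j <= k)%coq_nat -> W k <= W j) ->
  n <> 0%Z ->
  \rsum_(i < K) (W i.+1 * (if (r0 <=? i)%nat then dvd_ind (Z.of_nat i.+1) n else 0))
  <= W r0.+1 * INR (size (divisors (Z.abs_nat n))).
Proof.
move=> W0 Wd n0.
apply: (@Rle_trans _ (W r0.+1 * \rsum_(i < K) (if (i.+1 %| Z.abs_nat n)%N then 1 else 0))).
  rewrite -rsum_scal; apply: (@rsum_le K (fun i => W i.+1 * _)
     (fun i => W r0.+1 * (if (i.+1 %| Z.abs_nat n)%N then 1 else 0))) => i _.
  rewrite -(dvd_ind_nat n); last by lia.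
  have [d0 d1] := dvd_ind_range (Z.of_nat i.+1) n.
  case: Nat.leb_spec => h; last by rewrite Rmult_0_r; apply: Rmult_le_pos.
  by apply: Rmult_le_compat_r => //; apply: Wd; lia.
by apply: Rmult_le_compat_l => //; apply: count_divisors; lia.
Qed.

Lemma rzsum_split a n f g :
  rzsum a n (fun z => f z + g z) = rzsum a n f + rzsum a n g.
Proof. exact: zsum_split. Qed.

Lemma rzsum_delta a n (F : Z -> R) N : (forall c, 0 <= F c) ->
  rzsum a n (fun c => F c * (if (c =? N)%Z then 1 else 0)) <= F N.
Proof.
move=> F0; case: (Z_le_dec a N) => h1; first case: (Z_lt_dec N (a + Z.of_nat n)) => h2.
- rewrite (@zsum_widen _ _ _ N 1); [|move=> z hz|lia|lia].
    by rewrite rzsum_1 Z.eqb_refl; lra.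
  by case: Z.eqb_spec => h //=; [lia | ring].
- rewrite zsum_idx; first exact: F0.
  by move=> z hz; case: Z.eqb_spec => h //=; [lia | ring].
- rewrite zsum_idx; first exact: F0.
  by move=> z hz; case: Z.eqb_spec => h //=; [lia | ring].
Qed.

Lemma wz_le h1 h2 : (Z.abs h1 <= Z.abs h2)%Z -> wz h2 <= wz h1.
Proof.
move=> h; rewrite /wz; apply: Rinv_le_contravar; first by apply: IZR_lt; lia.
by apply: IZR_le; lia.
Qed.

(** The quadratic form factors as [4 r (2 h - r)], so its absolute value is at
    least [|r|] unless [r = 2 h]. *)
Lemma wz_quadratic h r : wz (8 * h * r - 4 * r * r) <= wz r * 1 + 1 * (if (r =? 2 * h)%Z then 1 else 0).
Proof.
case: Z.eqb_spec => E.
  by have := wz_le1 (8 * h * r - 4 * r * r); have := wz_pos r; lra.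
rewrite Rmult_0_r Rplus_0_r Rmult_1_r; apply: wz_le.
rewrite (_ : (8 * h * r - 4 * r * r = (4 * (2 * h - r)) * r)%Z); last by ring.
by rewrite Z.abs_mul; nia.
Qed.

(** Each value of [r / 9] occurs nine times. *)
Lemma sum_by_nines (W : nat -> R) K :
  rzsum 0 (9 * K) (fun r => W (Z.to_nat (r / 9)).+1) = 9 * \rsum_(i < K) W i.+1.
Proof.
rewrite mulnC zsum_block -rsum_scal; apply: gsum_eq => i _.
rewrite (@zsum_eq _ _ _ _ _ _ (fun=> W i.+1)).
  by rewrite rzsum_const INR_IZR_INZ.
move=> r hr; congr (W _.+1).
have -> : (r / 9 = Z.of_nat i)%Z.
  by symmetry; apply: (Z.div_unique_pos r 9 _ (r - 9 * Z.of_nat i)); lia.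
by lia.
Qed.

(** Interchanging the summations leaves, for fixed [h, r, c], the number of
    [k] dividing [8hr - 4r^2 - c]: a divisor function, unless this integer
    vanishes, which is rare. *)
Lemma arith_average eps : 0 < eps -> exists C, 0 < C /\
  forall K W, (0 < K)%coq_nat -> (forall k, 0 <= W k) ->
  (forall j k, (j <= k)%coq_nat -> W k <= W j) ->
  \rsum_(i < K) (W i.+1 * arith_sum i.+1) <=
  C * Rpower (INR K) eps * \rsum_(i < K) W i.+1.
Proof.
move=> eps0; pose e := eps / 6; have e0 : 0 < e by rewrite /e; lra.
have [Ch [Ch0 Hh]] := harmonic_bound e0.
have [Cd [Cd0 Hd]] := divisor_bound e0.
pose c5 := Rpower 5 e; pose c9 := Rpower 9 e; pose cm := Rpower 1000 e.
have c50 : 0 < c5 by apply: exp_pos.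
have c90 : 0 < c9 by apply: exp_pos.
have cm0 : 0 < cm by apply: exp_pos.
(* [1000 K^3] bounds [|n h r c|], [5 K^2] and [9 K] the ranges of [h] and [r] *)
exists (Ch * c5 * (9 * (Cd * cm) * Ch + (Ch * c9 + 1))).
have p1 : 0 < Ch * c5 by apply: Rmult_lt_0_compat.
have p2 : 0 < 9 * (Cd * cm) * Ch.
  by repeat apply: Rmult_lt_0_compat => //; lra.
have p3 : 0 < Ch * c9 by apply: Rmult_lt_0_compat.
split; first by apply: Rmult_lt_0_compat; lra.
move=> K W K0 W0 Wd.
pose H := (5 * (K * K))%N.
set Wt := \rsum_(i < K) W i.+1.
have Wt0 : 0 <= Wt by apply: rsum_ge0.
have KR : 1 <= INR K by rewrite -[1]/(INR 1); apply: le_INR; lia.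
pose Ke := Rpower (INR K) e; have Ke1 : 1 <= Ke by apply: Rpower_ge1; lra.
pose n h r c := (8 * h * r - 4 * r * r - c)%Z.
pose r9 r := Z.to_nat (r / 9).
pose ind i h r c := if (r9 r <=? i)%nat then dvd_ind (Z.of_nat i.+1) (n h r c) else 0.
have ind0 i h r c : 0 <= ind i h r c.
  by rewrite /ind; case: ifP => _; [case: (dvd_ind_range (Z.of_nat i.+1) (n h r c)) | lra].
pose Dm := Cd * (cm * (Ke * Ke * Ke)).
(* make the ranges of [h] and [r] independent of [k]; the condition [r < 9k]
   survives in [ind] *)
have S1 i : (i < K)%coq_nat -> W i.+1 * arith_sum i.+1 <=
    rzsum (- Z.of_nat H) (2 * H + 1) (fun h => rzsum 0 (9 * K) (fun r =>
      rzsum (- Z.of_nat K) (2 * K + 1) (fun c => wz h * (wz c * (W i.+1 * ind i h r c))))).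
  move=> iK; rewrite /arith_sum -rzsum_scal.
  have hH : forall h, 0 <= rzsum 0 (9 * K) (fun r =>
      rzsum (- Z.of_nat K) (2 * K + 1) (fun c => wz h * (wz c * (W i.+1 * ind i h r c)))).
    move=> h; apply: rzsum_ge0 => r _; apply: rzsum_ge0 => c _.
    by repeat apply: Rmult_le_pos => //; apply/Rlt_le/wz_pos.
  apply: (Rle_trans _ (@rzsum_incl (freq0 i.+1) (9 * (i.+1 * i.+1)) _ _ _ _ _ _)).
  - apply: rzsum_le => h _.
    rewrite (_ : W i.+1 * _ = wz h * W i.+1 * rzsum 0 (9 * i.+1) (fun r =>
      wz (zdist (8 * h * r - 4 * r * r) (Z.of_nat i.+1)))); last by ring.
    rewrite -rzsum_scal.
    apply: (Rle_trans _ (@rzsum_incl 0 (9 * i.+1) _ _ _ _ _ _)).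
    + apply: rzsum_le => r hr.
      have := @wz_zdist_le (8 * h * r - 4 * r * r) i.+1 K ltac:(lia) ltac:(lia).
      move=> /(Rmult_le_compat_l (wz h * W i.+1)) hle.
      apply: (Rle_trans (hle _)).
        by apply: Rmult_le_pos => //; apply/Rlt_le/wz_pos.
      rewrite -rzsum_scal; apply: rzsum_le => c _; right.
      rewrite /ind (_ : (r9 r <=? i)%nat = true); first by rewrite /n; ring.
      by apply/Nat.leb_le; rewrite /r9; have := Z.div_lt_upper_bound r 9 (Z.of_nat i.+1) ltac:(lia); lia.
    + move=> r _; apply: rzsum_ge0 => c _.
      by repeat apply: Rmult_le_pos => //; apply/Rlt_le/wz_pos.
    + by lia.
    + by lia.
  - by move=> h _; apply: hH.
  - by rewrite /freq0 /H; have := Z.div_pos (Z.of_nat (9 * (i.+1 * i.+1))) 2 ltac:(lia) ltac:(lia);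
      have := Z.div_mod (Z.of_nat (9 * (i.+1 * i.+1))) 2 ltac:(lia);
      have := Z.mod_pos_bound (Z.of_nat (9 * (i.+1 * i.+1))) 2 ltac:(lia); nia.
  - rewrite /freq0 /H; have := Z.div_mod (Z.of_nat (9 * (i.+1 * i.+1))) 2 ltac:(lia).
    by have := Z.mod_pos_bound (Z.of_nat (9 * (i.+1 * i.+1))) 2 ltac:(lia); nia.
(* for fixed [h], [r], [c] the sum over [k] is a divisor sum of [n h r c], unless
   this integer is 0, when every [k] counts *)
have S2 h r c : (- Z.of_nat H <= h <= Z.of_nat H)%Z -> (0 <= r < 9 * Z.of_nat K)%Z ->
    (- Z.of_nat K <= c <= Z.of_nat K)%Z ->
    \rsum_(i < K) (W i.+1 * ind i h r c) <=
    W (r9 r).+1 * Dm + Wt * (if (c =? 8 * h * r - 4 * r * r)%Z then 1 else 0).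
  move=> hh hr hc.
  have Dm0 : 0 <= W (r9 r).+1 * Dm.
    apply: Rmult_le_pos => //; rewrite /Dm.
    by apply: Rmult_le_pos; [lra | apply: Rmult_le_pos; [lra | nra]].
  case: Z.eqb_spec => E.
    rewrite Rmult_1_r; suff : \rsum_(i < K) (W i.+1 * ind i h r c) <= Wt by lra.
    apply: rsum_le => i _; rewrite -[X in _ <= X]Rmult_1_r.
    apply: Rmult_le_compat_l => //; rewrite /ind; case: ifP => _; last by lra.
    by case: (dvd_ind_range (Z.of_nat i.+1) (n h r c)).
  rewrite Rmult_0_r Rplus_0_r.
  have n0 : n h r c <> 0%Z by rewrite /n; lia.
  apply: (Rle_trans (@weighted_divisors W K (r9 r) (n h r c) W0 Wd n0)).
  apply: Rmult_le_compat_l => //.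
  apply: (Rle_trans (Hd _ _)); first by lia.
  apply: Rmult_le_compat_l; first by lra.
  have -> : cm * (Ke * Ke * Ke) = Rpower (1000 * (INR K * INR K * INR K)) e.
    by rewrite /cm /Ke !Rpower_mult_distr //; nra.
  apply: Rle_Rpower_l; first by lra.
  split; first by apply: lt_0_INR; lia.
  have hn : (Z.abs (n h r c) <= 1000 * (Z.of_nat K * Z.of_nat K * Z.of_nat K))%Z.
    rewrite /n; set k := Z.of_nat K in hr hc *.
    have k1 : (1 <= k)%Z by rewrite /k; lia.
    have hhk : (Z.abs h <= 5 * (k * k))%Z by rewrite /k; rewrite /H in hh; lia.
    have e1 : (Z.abs (h * r) <= 45 * (k * k * k))%Z.
      rewrite Z.abs_mul (Z.abs_eq r); last by lia.
      have := Z.mul_le_mono_nonneg (Z.abs h) (5 * (k * k)) r (9 * k) ltac:(lia) hhk ltac:(lia) ltac:(lia).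
      by lia.
    have e2 : (r * r <= 81 * (k * k))%Z.
      by have := Z.mul_le_mono_nonneg r (9 * k) r (9 * k) ltac:(lia) ltac:(lia) ltac:(lia) ltac:(lia); lia.
    have e3 : (k * k <= k * k * k)%Z by nia.
    have e4 : (k <= k * k)%Z by nia.
    have e5 : (0 <= r * r)%Z by nia.
    by rewrite -(Z.mul_assoc 8 h r) -(Z.mul_assoc 4 r r); lia.
  rewrite INR_IZR_INZ Zabs2Nat.id_abs (INR_IZR_INZ K) -!mult_IZR.
  by apply: IZR_le.
apply: (@Rle_trans _ (rzsum (- Z.of_nat H) (2 * H + 1) (fun h => rzsum 0 (9 * K) (fun r =>
   rzsum (- Z.of_nat K) (2 * K + 1) (fun c => wz h * (wz c * \rsum_(i < K) (W i.+1 * ind i h r c))))))).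
  apply: (Rle_trans (@rsum_le K _ _ S1)); right.
  rewrite -zsum_exchange_nat; apply: zsum_eq => h _.
  rewrite -zsum_exchange_nat; apply: zsum_eq => r _.
  rewrite -zsum_exchange_nat; apply: zsum_eq => c _.
  by rewrite -rsum_scal -rsum_scal.
apply: (@Rle_trans _ (rzsum (- Z.of_nat H) (2 * H + 1) (fun h =>
    (Wt * (9 * Dm * harmonic K + (harmonic (9 * K) + 1))) * wz h))).
  apply: rzsum_le => h hh.
  apply: (@Rle_trans _ (wz h * rzsum 0 (9 * K) (fun r => Dm * harmonic K * W (r9 r).+1 +
      Wt * (wz r * 1 + 1 * (if (r =? 2 * h)%Z then 1 else 0))))).
    rewrite -rzsum_scal; apply: rzsum_le => r hr.
    rewrite rzsum_scal; apply: Rmult_le_compat_l; first by apply/Rlt_le/wz_pos.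
    apply: (@Rle_trans _ (rzsum (- Z.of_nat K) (2 * K + 1) (fun c =>
       Dm * W (r9 r).+1 * wz c + Wt * (wz c * (if (c =? 8 * h * r - 4 * r * r)%Z then 1 else 0))))).
      apply: rzsum_le => c hc.
      have := S2 h r c ltac:(lia) ltac:(lia) ltac:(lia).
      move=> /(Rmult_le_compat_l (wz c)) hle; apply: (Rle_trans (hle _)).
        by apply/Rlt_le/wz_pos.
      by right; ring.
    rewrite rzsum_split !rzsum_scal -/(harmonic K).
    have := @rzsum_delta (- Z.of_nat K) (2 * K + 1) wz (8 * h * r - 4 * r * r) (fun c => Rlt_le _ _ (wz_pos c)).
    have := wz_quadratic h r => q1 q2.
    have := Rmult_le_compat_l Wt Wt0 (Rle_trans q2 q1).
    by lra.
  rewrite [X in _ <= X]Rmult_comm; apply: Rmult_le_compat_l; first by apply/Rlt_le/wz_pos.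
  rewrite rzsum_split !rzsum_scal sum_by_nines rzsum_split -/Wt.
  have d1 := @rzsum_delta 0 (9 * K) (fun=> 1) (2 * h) (fun c => Rle_0_1).
  have d2 : rzsum 0 (9 * K) (fun r => wz r * 1) <= harmonic (9 * K).
    rewrite (@zsum_eq _ _ _ _ _ _ wz); last by move=> r _; ring.
    apply: rzsum_incl; [by move=> z _; apply/Rlt_le/wz_pos | lia | lia].
  have := Rmult_le_compat_l Wt Wt0 (Rplus_le_compat d2 d1).
  by lra.
rewrite rzsum_scal -/(harmonic H).
have KeE : Rpower (INR K) eps = Ke * Ke * Ke * Ke * Ke * Ke.
  by rewrite /Ke -!Rpower_plus; congr Rpower; rewrite /e; field.
have hH : harmonic H <= Ch * (c5 * (Ke * Ke)).
  apply: (Rle_trans (Hh H _)); first by rewrite /H; nia.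
  right; rewrite /c5 /Ke !Rpower_mult_distr //; try nra.
  by rewrite /H !mult_INR (_ : INR 5 = 5) // INR_IZR_INZ.
have hK : harmonic K <= Ch * Ke by apply: Hh.
have h9K : harmonic (9 * K) <= Ch * (c9 * Ke).
  apply: (Rle_trans (Hh (9 * K)%N _)); first by lia.
  right; rewrite /c9 /Ke !Rpower_mult_distr //; try nra.
  by rewrite mult_INR (_ : INR 9 = 9) // INR_IZR_INZ.
have g1 := harmonic_ge0 K; have g2 := harmonic_ge0 (9 * K); have g3 := harmonic_ge0 H.
have Ke2 : Ke <= Ke * Ke by nra.
have Ke3 : 1 <= Ke * Ke * Ke by nra.
have Ke4 : Ke <= Ke * Ke * Ke * Ke by nra.
have Ke4' : 1 <= Ke * Ke * Ke * Ke by nra.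
have B1 : 9 * Dm * harmonic K <= (9 * (Cd * cm) * Ch) * (Ke * Ke * Ke * Ke).
  have -> : (9 * (Cd * cm) * Ch) * (Ke * Ke * Ke * Ke) = 9 * Dm * (Ch * Ke) by rewrite /Dm; ring.
  apply: Rmult_le_compat_l => //; rewrite /Dm.
  apply: Rmult_le_pos; first by lra.
  apply: Rmult_le_pos; first by lra.
  by apply: Rmult_le_pos; lra.
have B2 : harmonic (9 * K) + 1 <= (Ch * c9 + 1) * (Ke * Ke * Ke * Ke).
  have : Ch * c9 * Ke <= Ch * c9 * (Ke * Ke * Ke * Ke) by apply: Rmult_le_compat_l; lra.
  by lra.
have B12 : 9 * Dm * harmonic K + (harmonic (9 * K) + 1) <=
  (9 * (Cd * cm) * Ch + (Ch * c9 + 1)) * (Ke * Ke * Ke * Ke) by lra.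
have D0 : 0 <= Dm.
  by rewrite /Dm; apply: Rmult_le_pos; [lra | apply: Rmult_le_pos; lra].
have X0 : 0 <= 9 * Dm * harmonic K + (harmonic (9 * K) + 1).
  have : 0 <= Dm * harmonic K by apply: Rmult_le_pos.
  by lra.
have := Rmult_le_compat X0 g3 B12 hH.
move=> /(Rmult_le_compat_l Wt Wt0); rewrite KeE.
by move=> hfin; apply: Rle_trans (Rle_trans hfin _); right; ring.
Qed.

(** The factor [k^(-1/2)] is the size of the Fourier coefficients met later; with
    that of [Esum_bound] it makes the weight [1 / k] of the average. *)
Lemma Esum_half_average g g' a b G eps : lip_weight g g' G -> supported g a b ->
  0 < eps -> exists C, 0 < C /\ forall T n K, 1 <= T -> (0 < K)%coq_nat ->
  INR K <= T -> b * T ^ 2 <= INR n ->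
  \rsum_(i < K) (/ sqrt (INR i.+1) * Cmod (Esum g T n (INR i.+1)))
    <= C * (T * sqrt T * Rpower T eps).
Proof.
move=> Hg Hs e0.
have [C1 [C10 H1]] := Esum_bound Hg Hs.
have [C2 [C20 H2]] := @arith_average (eps / 2) ltac:(lra).
have [C3 [C30 H3]] := @harmonic_bound (eps / 2) ltac:(lra).
exists (C1 * (C2 * C3)); split; first by repeat apply: Rmult_lt_0_compat.
move=> T n K T1 K0 KT bn.
have KR : 1 <= INR K by rewrite -[1]/(INR 1); apply: le_INR; lia.
(* shifted so that [W] is nonincreasing from 0 on, the inverse of 0 being 0 *)
pose W k := / INR k.-1.+1.
have ip i : 0 < INR i.+1 by apply: lt_0_INR; lia.
have W0 k : 0 <= W k by apply/Rlt_le/Rinv_0_lt_compat.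
have Wd j k : (j <= k)%coq_nat -> W k <= W j.
  by move=> jk; apply: Rinv_le_contravar => //; apply: le_INR; lia.
have KTe : Rpower (INR K) (eps / 2) <= Rpower T (eps / 2).
  by apply: Rle_Rpower_l; lra.
have TT : Rpower T eps = Rpower T (eps / 2) * Rpower T (eps / 2).
  by rewrite -Rpower_plus; congr Rpower; field.
have hW : \rsum_(i < K) W i.+1 <= C3 * Rpower T (eps / 2).
  have hp : \rsum_(i < K) W i.+1 <= harmonic K.
    rewrite (_ : \rsum_(i < K) W i.+1 = rzsum 1 K wz); last first.
      apply: gsum_eq => i _; rewrite /W /wz INR_IZR_INZ.
      by congr (/ IZR _); lia.
    apply: rzsum_incl; [by move=> z _; apply/Rlt_le/wz_pos | lia | lia].
  apply: (Rle_trans hp); apply: (Rle_trans (H3 K K0)).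
  by apply: Rmult_le_compat_l; lra.
apply: (@Rle_trans _ (\rsum_(i < K) (C1 * (T * sqrt T) * (W i.+1 * arith_sum i.+1)))).
  apply: (@rsum_le K (fun i => / sqrt (INR i.+1) * Cmod (Esum g T n (INR i.+1)))) => i iK.
  have kT : INR i.+1 <= T by apply: Rle_trans KT; apply: le_INR; lia.
  have := H1 T n i.+1 T1 ltac:(lia) kT bn.
  have s0 : 0 < sqrt (INR i.+1) by apply: sqrt_lt_R0.
  have is0 : 0 < / sqrt (INR i.+1) by apply: Rinv_0_lt_compat.
  move=> /(Rmult_le_compat_l _ (Rlt_le _ _ is0)) h; apply: (Rle_trans h); right.
  rewrite sqrt_div; [|lra|exact: ip].
  rewrite /W [i.+1.-1.+1]/=.
  rewrite -[in / INR i.+1](sqrt_sqrt (INR i.+1)); last by apply/Rlt_le/ip.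
  by field; lra.
rewrite rsum_scal.
have := H2 K W K0 W0 Wd => h.
have st := sqrt_pos T.
have Q0 : 0 <= T * sqrt T by nra.
have h2 : \rsum_(i < K) (W i.+1 * arith_sum i.+1) <= C2 * C3 * Rpower T eps.
  apply: (Rle_trans h).
  have -> : C2 * C3 * Rpower T eps = (C2 * Rpower T (eps / 2)) * (C3 * Rpower T (eps / 2)).
    by rewrite TT; ring.
  apply: Rmult_le_compat => //.
  - by apply: Rmult_le_pos; [lra | apply/Rlt_le/exp_pos].
  - by apply: rsum_ge0.
  - by apply: Rmult_le_compat_l; lra.
have -> : C1 * (C2 * C3) * (T * sqrt T * Rpower T eps) = C1 * (T * sqrt T) * (C2 * C3 * Rpower T eps) by ring.
by apply: Rmult_le_compat_l => //; nra.
Qed.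

(** * The Fejer kernel *)

Definition fejer (K : nat) (x : R) : R :=
  / INR K * (Cmod (\csum_(p < K) ec (INR p * x))) ^ 2.

Lemma Cmod_sqr_conj z : RtoC (Cmod z ^ 2) = (z * Cconj z)%C.
Proof.
case: z => x y; rewrite /Cmod -Rsqr_pow2 Rsqr_sqrt; last first.
  by apply: Rplus_le_le_0_compat; apply: pow2_ge_0.
rewrite /Cconj /Cmult /RtoC /=.
by congr pair; ring.
Qed.

Lemma Cconj_csum n f : Cconj (\csum_(i < n) f i) = \csum_(i < n) Cconj (f i).
Proof.
elim: n => [|n IH]; first by rewrite !gsum_0 /Cconj /= Ropp_0.
by rewrite !gsum_recr -IH /= /Cconj /Cplus /=; congr pair; ring.
Qed.

Lemma csum_mul_r n f c : Cmult (\csum_(i < n) f i) c = \csum_(i < n) (f i * c).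
Proof. by rewrite Cmult_comm -csum_scal; apply: gsum_eq => i _; rewrite Cmult_comm. Qed.

Lemma fejer_expand K x : RtoC (fejer K x) =
  (RtoC (/ INR K) * \csum_(p < K) \csum_(r < K) ec ((INR p - INR r) * x))%C.
Proof.
rewrite /fejer RtoC_mult Cmod_sqr_conj Cconj_csum csum_mul_r; congr Cmult.
apply: gsum_eq => p _; rewrite -csum_scal; apply: gsum_eq => r _.
by rewrite -ec_opp -ec_plus; congr ec; ring.
Qed.

Lemma fejer_ge0 K x : 0 <= fejer K x.
Proof.
rewrite /fejer; case: K => [|K]; first by rewrite gsum_0 Cmod_0 /=; lra.
apply: Rmult_le_pos; last by apply: pow2_ge_0.
by apply/Rlt_le/Rinv_0_lt_compat/lt_0_INR; lia.
Qed.

Lemma fejer_periodic K x z : fejer K (x + IZR z) = fejer K x.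
Proof.
rewrite /fejer; congr (_ * Cmod _ ^ 2); apply: gsum_eq => p _.
by apply: (@ec_int_diff _ _ (Z.of_nat p * z)); rewrite mult_IZR -INR_IZR_INZ; ring.
Qed.

Lemma fejer_le K x : fejer K x <= INR K.
Proof.
rewrite /fejer; have h : Cmod (\csum_(p < K) ec (INR p * x)) <= INR K.
  apply: (Rle_trans (@Cmod_csum_le K _ (fun=> 1) _)); first by move=> *; rewrite Cmod_ec; lra.
  by rewrite rsum_const; lra.
case: K h => [|K] h; first by rewrite gsum_0 Cmod_0 /=; lra.
have p : 0 < INR K.+1 by apply: lt_0_INR; lia.
apply: (Rmult_le_reg_l (INR K.+1)) => //.
rewrite -Rmult_assoc Rinv_r ?Rmult_1_l; last by lra.
have := Cmod_ge_0 (\csum_(p < K.+1) ec (INR p * x)).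
by move: (Cmod _) h => y; nra.
Qed.

(** The kernel is the square of a geometric sum, to which the Kusmin-Landau bound
    applies. *)
Lemma fejer_decay K x z d : (0 < K)%coq_nat -> 0 < d -> d <= 1 / 2 ->
  d <= x + IZR z <= 1 - d -> fejer K x <= 49 / (INR K * d ^ 2).
Proof.
move=> K0 d0 d1 hx; have p : 0 < INR K by apply: lt_0_INR.
have h : Cmod (\csum_(r < K) ec (INR r * x)) <= 7 / d.
  case: K K0 {p} => [|K _]; first by lia.
  apply: (@kusmin_landau_shift K (fun r => INR r * x) d z) => // i _; rewrite !S_INR; lra.
rewrite /fejer (_ : 49 / (INR K * d ^ 2) = / INR K * (7 / d) ^ 2); last by field; lra.
apply: Rmult_le_compat_l; first by apply/Rlt_le/Rinv_0_lt_compat.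
by apply: pow_incr; split=> //; apply: Cmod_ge_0.
Qed.

(** Within [1 / (8 K)] of an integer all the terms have argument at most
    [pi / 3] in absolute value, so their real parts are at least [1/2]. *)
Lemma fejer_near_integer K x z : (0 < K)%coq_nat ->
  Rabs (IZR z - x) <= / (8 * INR K) -> INR K / 4 <= fejer K x.
Proof.
move=> K0 hx; have p : 0 < INR K by apply: lt_0_INR.
pose y := x - IZR z.
have -> : fejer K x = fejer K y by rewrite -(fejer_periodic K y z) /y; congr fejer; ring.
have hy : Rabs y <= / (8 * INR K) by rewrite /y Rabs_minus_sym.
have re : INR K / 2 <= Re (\csum_(r < K) ec (INR r * y)).
  rewrite Re_csum (_ : INR K / 2 = INR K * (1 / 2)); last by field.
  rewrite -rsum_const; apply: (@rsum_le K (fun=> 1/2)) => r hr.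
  have hr2 : INR r <= INR K by apply: le_INR; lia.
  have r0 := pos_INR r.
  have hry : Rabs (INR r * y) <= 1 / 8.
    rewrite Rabs_mult Rabs_pos_eq //.
    apply: (@Rle_trans _ (INR K * / (8 * INR K))); last by right; field; lra.
    by apply: Rmult_le_compat => //; apply: Rabs_pos.
  have [p1 p2] := PI_bounds.
  rewrite /= ; set t := INR r * y in hry *.
  have ht : Rabs (2 * PI * t) <= PI / 3.
    rewrite Rabs_mult Rabs_pos_eq; last by lra.
    by have := Rabs_pos t; nra.
  rewrite -cos_PI3 -(Rabs_pos_eq (PI / 3)) in ht * ; last by lra.
  have -> : cos (2 * PI * t) = cos (Rabs (2 * PI * t)).
    by rewrite /Rabs; case: Rcase_abs => _ //; rewrite cos_neg.
  have e3 : Rabs (PI / 3) = PI / 3 by rewrite Rabs_pos_eq; lra.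
  rewrite e3 in ht *.
  by apply: cos_decr_1; try lra; apply: Rabs_pos.
have hC : INR K / 2 <= Cmod (\csum_(r < K) ec (INR r * y)).
  apply: (Rle_trans re); apply: Rle_trans (re_le_Cmod _); exact: Rle_abs.
rewrite /fejer (_ : INR K / 4 = / INR K * (INR K / 2) ^ 2); last by field; lra.
apply: Rmult_le_compat_l; first by apply/Rlt_le/Rinv_0_lt_compat.
by apply: pow_incr; split; [apply: Rmult_le_pos; lra | exact: hC].
Qed.

(** Only the diagonal terms survive: the difference of two distinct frequencies
    is nonzero and less than [K <= J], hence not divisible by [J]. *)
Lemma fejer_mean K J a x : (0 < K)%coq_nat -> (K <= J)%coq_nat ->
  rzsum a J (fun j => fejer K (x + IZR j / INR J)) = INR J.
Proof.
move=> K0 KJ; have p : 0 < INR K by apply: lt_0_INR.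
have pJ : 0 < INR J by apply: lt_0_INR; lia.
apply: RtoC_inj; rewrite RtoC_rzsum.
rewrite (@zsum_eq _ _ _ _ _ _ (fun j => RtoC (/ INR K) *
  \csum_(p < K) \csum_(r < K) ec ((INR p - INR r) * (x + IZR j / INR J)))%C); last first.
  by move=> j _; rewrite fejer_expand.
rewrite czsum_scal zsum_exchange_nat.
rewrite (@gsum_eq _ _ _ _ _ (fun p => RtoC (INR J))).
  have -> : \csum_(p < K) RtoC (INR J) = RtoC (INR K * INR J).
    by rewrite -RtoC_rsum rsum_const.
  by rewrite -RtoC_mult; congr RtoC; field; lra.
move=> i iK; rewrite zsum_exchange_nat.
rewrite (@gsum_eq _ _ _ _ _ (fun r => if (r == i) then RtoC (INR J) else RtoC 0)).
  elim: {KJ K0 p} K iK => [|K IH] iK; first by lia.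
  rewrite gsum_recr; case: (Nat.eq_dec i K) => [E|neq].
    rewrite E eqxx gsum_idx /= ?Cplus_0_l // => r hr.
    by case: eqP => // h; lia.
  rewrite IH; last by lia.
  by case: eqP => [h|_]; [lia | rewrite /= Cplus_0_r].
move=> r rK.
rewrite (@zsum_eq _ _ _ _ _ _ (fun j => ec ((INR i - INR r) * x) *
   ec (IZR (j * (Z.of_nat i - Z.of_nat r)) / INR J))%C); last first.
  move=> j _; rewrite -ec_plus; congr ec.
  by rewrite mult_IZR minus_IZR -!INR_IZR_INZ; field; lra.
rewrite czsum_scal ec_orthogonality; last by lia.
case: eqP => [->|neq].
  by rewrite Z.sub_diag Z.mod_0_l /= ?Rminus_diag ?Rmult_0_l ?ec_0 ?Cmult_1_l //; lia.
case: Z.eqb_spec => h; last by rewrite Cmult_0_r.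
exfalso; have := Z.div_mod (Z.of_nat i - Z.of_nat r) (Z.of_nat J) ltac:(lia).
rewrite h; move: (_ / _)%Z => m hm.
have [h0|[h0|h0]] : (m = 0 \/ 1 <= m \/ m <= -1)%Z by lia.
- by rewrite h0 in hm; lia.
- by have := Z.mul_le_mono_nonneg_l 1 m (Z.of_nat J) ltac:(lia) h0; lia.
- by have := Z.mul_le_mono_nonneg_l m (-1) (Z.of_nat J) ltac:(lia) h0; lia.
Qed.

Lemma Esum_opp g T n x : Cmod (Esum g T n (- x)) = Cmod (Esum g T n x).
Proof.
have -> : Esum g T n (- x) = Cconj (Esum g T n x).
  rewrite /Esum Cconj_csum; apply: gsum_eq => m _.
  rewrite Ropp_mult_distr_l_reverse ec_opp.
  by case: (ec _) => u v; rewrite /Cconj /RtoC /Cmult /=; congr pair; ring.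
by rewrite Cmod_conj.
Qed.

(** The absolute value of the frequency [p - r]; exponential sums at opposite
    frequencies are conjugate, so their size depends on nothing else. *)
Definition adist (p r : nat) : nat := Z.abs_nat (Z.of_nat r - Z.of_nat p).

Lemma Esum_adist g T n p r :
  Cmod (Esum g T n (INR p - INR r)) = Cmod (Esum g T n (INR (adist p r))).
Proof.
rewrite /adist [in RHS]INR_IZR_INZ Zabs2Nat.id_abs abs_IZR minus_IZR -!INR_IZR_INZ.
rewrite /Rabs; case: Rcase_abs => _; first by congr (Cmod (Esum _ _ _ _)); ring.
by rewrite -[RHS]Esum_opp; congr (Cmod (Esum _ _ _ _)); ring.
Qed.

Lemma symmetric_sum B (f : nat -> R) :
  rzsum (- Z.of_nat B) (2 * B + 1) (fun z => f (Z.abs_nat z)) =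
  2 * rsum B.+1 f - f 0%N.
Proof.
elim: B => [|B IH].
  rewrite rzsum_1 gsum_recr gsum_0 (_ : Z.abs_nat (- Z.of_nat 0) = 0%N) //=.
  by ring.
rewrite (_ : (2 * B.+1 + 1 = 1 + ((2 * B + 1) + 1))%N); last by lia.
set n := (2 * B + 1)%N; rewrite 2!rzsum_cat !rzsum_1.
rewrite (_ : (- Z.of_nat B.+1 + Z.of_nat 1 = - Z.of_nat B)%Z); last by lia.
rewrite IH (gsum_recr _ B.+1).
rewrite (_ : Z.abs_nat (- Z.of_nat B.+1) = B.+1); last by lia.
rewrite (_ : Z.abs_nat (- Z.of_nat B + Z.of_nat n) = B.+1); last by rewrite /n; lia.
by move: (gsum _ _ _) => x /=; ring.
Qed.

(** Each value of [|p - r|] occurs at most twice for a given [p]. *)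
Lemma adist_sum K (f : nat -> R) : (forall k, 0 <= f k) ->
  \rsum_(p < K) \rsum_(r < K) f (adist p r) <= INR K * (2 * rsum K f).
Proof.
move=> f0; apply: rsum_le_const => p pK.
have -> : \rsum_(r < K) f (adist p r) = rzsum (- Z.of_nat p) K (fun z => f (Z.abs_nat z)).
  by apply: gsum_eq => r _; congr f; rewrite /adist; lia.
apply: (@Rle_trans _ (rzsum (- Z.of_nat K.-1) (2 * K.-1 + 1) (fun z => f (Z.abs_nat z)))).
  by apply: rzsum_incl; [move=> z _; apply: f0 | lia | lia].
rewrite symmetric_sum (_ : K.-1.+1 = K); last by lia.
by have := f0 0%N; lra.
Qed.

(** Expanding the kernel turns a weighted sum over the points [alpha m + beta]
    into exponential sums. *)
Lemma fejer_weighted g T n K beta :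
  RtoC (\rsum_(m < n) (g (INR m / T ^ 2) * fejer K (alpha m + beta))) =
  (RtoC (/ INR K) * \csum_(p < K) \csum_(r < K)
     (ec ((INR p - INR r) * beta) * Esum g T n (INR p - INR r)))%C.
Proof.
rewrite RtoC_rsum.
rewrite (@gsum_eq _ _ _ _ _ (fun m => RtoC (/ INR K) * \csum_(p < K) \csum_(r < K)
   (RtoC (g (INR m / T ^ 2)%R) * ec ((INR p - INR r) * (alpha m + beta))))%C); last first.
  move=> m _; rewrite RtoC_mult fejer_expand Cmult_assoc (Cmult_comm (RtoC (g _))) -Cmult_assoc.
  congr Cmult; rewrite -csum_scal; apply: gsum_eq => p _; rewrite -csum_scal.
  by apply: gsum_eq.
rewrite csum_scal gsum_exchange; congr Cmult; apply: gsum_eq => p _.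
rewrite gsum_exchange; apply: gsum_eq => r _.
rewrite /Esum -csum_scal; apply: gsum_eq => m _.
by rewrite Rmult_plus_distr_l ec_plus; ring.
Qed.

(** The terms [1 <= k < K] come from [Esum_half_average], as
    [1 <= sqrt T / sqrt k]; the term [k = 0] is bounded trivially. *)
Lemma Esum_average g g' a b G eps : lip_weight g g' G -> supported g a b ->
  0 < eps -> exists C, 0 < C /\ forall T n K, 1 <= T -> (0 < K)%coq_nat ->
  INR K <= T -> b * T ^ 2 <= INR n ->
  \rsum_(k < K) Cmod (Esum g T n (INR k)) <= C * (T ^ 2 * Rpower T eps).
Proof.
move=> Hg Hs e0; have [C [C0 H]] := Esum_half_average Hg Hs e0.
have [G0 _ hG _ _] := Hg; have [a0 [ab _]] := Hs.
exists (G * (b + 1) + C); split; first by nra.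
move=> T n K T1 K0 KT bn; have {}H := H T n K T1 K0 KT bn.
have Te := @Rpower_ge1 T eps T1 (Rlt_le _ _ e0).
have h0 : Cmod (Esum g T n (INR 0)) <= G * (b + 1) * (T ^ 2 * Rpower T eps).
  apply: (Rle_trans (@Esum_trivial g a b G T n _ Hs hG _)); first by lra.
  rewrite Rmult_assoc; apply: Rmult_le_compat_l; first by lra.
  have T2 : 1 <= T ^ 2 by nra.
  have T3 : T ^ 2 <= T ^ 2 * Rpower T eps by rewrite -[X in X <= _]Rmult_1_r; apply: Rmult_le_compat_l; lra.
  have : (b + 1) * T ^ 2 <= (b + 1) * (T ^ 2 * Rpower T eps) by apply: Rmult_le_compat_l; lra.
  by lra.
have h1 : \rsum_(i < K.-1) Cmod (Esum g T n (INR i.+1)) <= C * (T ^ 2 * Rpower T eps).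
  apply: (@Rle_trans _ (sqrt T * \rsum_(i < K) (/ sqrt (INR i.+1) * Cmod (Esum g T n (INR i.+1))))).
    rewrite -rsum_scal.
    apply: (@Rle_trans _ (\rsum_(i < K.-1) (sqrt T * (/ sqrt (INR i.+1) * Cmod (Esum g T n (INR i.+1)))))).
      apply: (@rsum_le K.-1 (fun i => Cmod (Esum g T n (INR i.+1)))) => i iK.
      have ip : 0 < INR i.+1 by apply: lt_0_INR; lia.
      have iT : INR i.+1 <= T by apply: Rle_trans KT; apply: le_INR; lia.
      have s0 : 0 < sqrt (INR i.+1) by apply: sqrt_lt_R0.
      have s1 : sqrt (INR i.+1) <= sqrt T by apply: sqrt_le_1_alt.
      have s2 : 1 <= sqrt T * / sqrt (INR i.+1).
        by apply: (Rmult_le_reg_r (sqrt (INR i.+1))) => //; rewrite Rmult_assoc Rinv_l; lra.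
      by rewrite -Rmult_assoc; have := Cmod_ge_0 (Esum g T n (INR i.+1)); nra.
    rewrite (_ : K = (K.-1 + 1)%N) ?[in X in _ <= X]gsum_cat; last by lia.
    rewrite addn1 /= gsum_recr gsum_0 /= addn0.
    set x := rsum _ _; suff : 0 <= sqrt T * (/ sqrt (INR K.-1.+1) * Cmod (Esum g T n (INR K.-1.+1))).
      by rewrite -/(INR K.-1.+1); lra.
    apply: Rmult_le_pos; first exact: sqrt_pos.
    apply: Rmult_le_pos; last exact: Cmod_ge_0.
    by apply/Rlt_le/Rinv_0_lt_compat/sqrt_lt_R0/lt_0_INR; lia.
  apply: (Rle_trans (Rmult_le_compat_l _ (sqrt_pos T) H)); right.
  have st : sqrt T * sqrt T = T by apply: sqrt_sqrt; lra.
  have -> : T ^ 2 = T * (sqrt T * sqrt T) by rewrite st; ring.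
  by ring.
have -> : \rsum_(k < K) Cmod (Esum g T n (INR k)) =
   Cmod (Esum g T n (INR 0)) + \rsum_(i < K.-1) Cmod (Esum g T n (INR i.+1)).
  rewrite (_ : K = (1 + K.-1)%N); last by lia.
  by rewrite gsum_cat gsum_recr gsum_0 /= Rplus_0_l.
by lra.
Qed.

(** * Density of the points alpha m modulo 1 *)

Definition near (d y : R) : R := if Rle_dec (Rabs y) d then 1 else 0.

Lemma near_in d y : Rabs y <= d -> near d y = 1.
Proof. by rewrite /near; case: Rle_dec. Qed.

Lemma near_out d y : ~ Rabs y <= d -> near d y = 0.
Proof. by rewrite /near; case: Rle_dec. Qed.

Lemma near_range d y : 0 <= near d y <= 1.
Proof.
by case: (Rle_dec (Rabs y) d) => h; rewrite ?(near_in h) ?(near_out h); lra.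
Qed.

(** At most one integer is that close to [x], and if there is one the kernel is
    at least [K / 4]. *)
Lemma near_le_fejer K x A n : (0 < K)%coq_nat ->
  rzsum A n (fun z => near (/ (8 * INR K)) (IZR z - x)) <= 4 / INR K * fejer K x.
Proof.
move=> K0; have p : 1 <= INR K by rewrite -[1]/(INR 1); apply: le_INR; lia.
have i8 : / (8 * INR K) <= / 8 by apply: Rinv_le_contravar; lra.
case: (Classical_Prop.classic (exists z, Rabs (IZR z - x) <= / (8 * INR K))) => [[z0 hz0]|hno].
  apply: (@Rle_trans _ 1); last first.
    have := fejer_near_integer K0 hz0 => h.
    apply: (@Rle_trans _ (4 / INR K * (INR K / 4))); first by right; field; lra.
    by apply: Rmult_le_compat_l => //; apply: Rdiv_le_0_compat; lra.
  apply: Rle_trans (@rzsum_delta A n (fun=> 1) z0 (fun _ => Rle_0_1)).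
  apply: rzsum_le => z _; case: Z.eqb_spec => E; first by have := near_range (/ (8 * INR K)) (IZR z - x); lra.
  case: (Rle_dec (Rabs (IZR z - x)) (/ (8 * INR K))) => h; last by rewrite near_out //; lra.
  exfalso; have : Rabs (IZR z - IZR z0) < 1 by split_Rabs; lra.
  by rewrite -minus_IZR -abs_IZR => /lt_IZR; lia.
rewrite zsum_idx.
  by apply: Rmult_le_pos; [apply: Rdiv_le_0_compat; lra | apply: fejer_ge0].
by move=> z _; apply: near_out => h; apply: hno; exists z.
Qed.

(** An interval of half-length [d] is covered by about [d / d0] intervals of
    half-length [d0]. *)
Lemma near_cover d d0 : 0 < d0 -> 0 <= d -> exists J : nat,
  INR (2 * J + 1) <= d / d0 + 4 /\ forall y, near d y <=
  rzsum (- Z.of_nat J) (2 * J + 1) (fun j => near d0 (y - 2 * IZR j * d0)).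
Proof.
move=> p0 p.
have dd : 0 <= d / d0 by apply: Rdiv_le_0_compat.
have [u1 u2] := archimed (d / d0 / 2 + 1 / 2).
exists (Z.to_nat (up (d / d0 / 2 + 1 / 2))); set U := up _ in u1 u2.
have U0 : (0 <= U)%Z by apply: le_IZR; lra.
split.
  rewrite INR_IZR_INZ (_ : Z.of_nat (2 * Z.to_nat U + 1) = (2 * U + 1)%Z); last by lia.
  by rewrite plus_IZR mult_IZR; lra.
move=> y; case: (Rle_dec (Rabs y) d) => h; last first.
  by rewrite near_out //; apply: rzsum_ge0 => j _; case: (near_range d0 (y - 2 * IZR j * d0)).
rewrite near_in //.
have [j hj] := Zfloor_ex (y / (2 * d0) + 1 / 2).
have yE : y = 2 * d0 * (y / (2 * d0)) by field; lra.
set t := y / (2 * d0) in hj yE.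
have ht : Rabs t <= d / d0 / 2.
  apply: (Rmult_le_reg_l (2 * d0)); first by lra.
  rewrite (_ : 2 * d0 * (d / d0 / 2) = d); last by field; lra.
  by rewrite -{1}(Rabs_pos_eq (2 * d0)) -?Rabs_mult -?yE; lra.
apply: (Rle_trans _ (@rzsum_ge_term _ _ (fun j => near d0 (y - 2 * IZR j * d0)) j _ _)).
- rewrite near_in; first by lra.
  rewrite yE (_ : _ - _ = 2 * d0 * (t - IZR j)); last by ring.
  rewrite Rabs_mult (Rabs_pos_eq (2 * d0)); last by lra.
  have : Rabs (t - IZR j) <= 1 / 2 by split_Rabs; lra.
  by nra.
- have b1 : (j <= U)%Z by apply: le_IZR; split_Rabs; lra.
  have b2 : (- U <= j)%Z.
    have : (- U < j + 1)%Z by apply: lt_IZR; rewrite opp_IZR plus_IZR; split_Rabs; lra.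
    by lia.
  by lia.
- by move=> z _; case: (near_range d0 (y - 2 * IZR z * d0)).
Qed.

Lemma floor_half T : 1 <= T -> exists K : nat,
  (0 < K)%coq_nat /\ INR K <= T /\ T <= 2 * INR K.
Proof.
move=> T1; have [z hz] := Zfloor_ex T.
have z1 : (0 < z)%Z by apply: lt_IZR; lra.
have z2 : 1 <= IZR z by apply: IZR_le; lia.
exists (Z.to_nat z); rewrite INR_IZR_INZ Z2Nat.id; last by lia.
by split; [lia | lra].
Qed.

(** Positivity of the kernel turns the bound for exponential sums into an upper
    bound for the number of [alpha m] near a translate of the integers, valid
    down to the scale [1/T]. *)
Lemma density g g' a b G eps : lip_weight g g' G -> supported g a b ->
  (forall x, 0 <= g x) -> 0 < eps -> exists C, 0 < C /\
  forall T n beta d A L, 1 <= T -> b * T ^ 2 <= INR n -> 0 <= d ->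
  \rsum_(m < n) (g (INR m / T ^ 2) *
     rzsum A L (fun z => near d (IZR z - (alpha m + beta))))
  <= C * (1 + d * T) * (T * Rpower T eps).
Proof.
move=> Hg Hs g0 e0; have [C [C0 H]] := Esum_average Hg Hs e0.
exists (8 * (16 * C)); split; first by lra.
move=> T n beta d A L T1 bn d0.
have [K [K0 [KT TK]]] := floor_half T1.
have {}H := H T n K T1 K0 KT bn.
have Kp : 0 < INR K by lra.
have TE : 0 < Rpower T eps := exp_pos _.
have base be : \rsum_(m < n) (g (INR m / T ^ 2) *
     rzsum A L (fun z => near (/ (8 * INR K)) (IZR z - (alpha m + be)))) <= 16 * C * (T * Rpower T eps).
  apply: (@Rle_trans _ (4 / INR K * \rsum_(m < n) (g (INR m / T ^ 2) * fejer K (alpha m + be)))).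
    rewrite -rsum_scal; apply: (@rsum_le n (fun m => g (INR m / T ^ 2) *
     rzsum A L (fun z => near (/ (8 * INR K)) (IZR z - (alpha m + be))))) => m _.
    rewrite -Rmult_assoc (Rmult_comm (4 / _)) Rmult_assoc.
    by apply: Rmult_le_compat_l => //; apply: near_le_fejer.
  have hF : \rsum_(m < n) (g (INR m / T ^ 2) * fejer K (alpha m + be)) <= 2 * (C * (T ^ 2 * Rpower T eps)).
    apply: (Rle_trans (Rle_abs _)); rewrite -Cmod_R fejer_weighted Cmod_mult Cmod_R.
    rewrite Rabs_pos_eq; last by apply/Rlt_le/Rinv_0_lt_compat.
    apply: (@Rle_trans _ (/ INR K * (INR K * (2 * rsum K (fun k => Cmod (Esum g T n (INR k))))))).
      apply: Rmult_le_compat_l; first by apply/Rlt_le/Rinv_0_lt_compat.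
      apply: Rle_trans (@adist_sum K (fun k => Cmod (Esum g T n (INR k))) (fun k => Cmod_ge_0 _)).
      apply: (@Cmod_csum_le K _ (fun p => rsum K (fun r => Cmod (Esum g T n (INR (adist p r)))))) => p _.
      apply: (@Cmod_csum_le K _ (fun r => Cmod (Esum g T n (INR (adist p r))))) => r _.
      by rewrite Cmod_mult Cmod_ec Rmult_1_l Esum_adist; lra.
    rewrite -Rmult_assoc Rinv_l ?Rmult_1_l; last by lra.
    by lra.
  have iK : 4 / INR K <= 8 / T.
    apply: (Rmult_le_reg_r (INR K * T)); first by nra.
    rewrite (_ : 4 / INR K * (INR K * T) = 4 * T); last by field; lra.
    by rewrite (_ : 8 / T * (INR K * T) = 8 * INR K); [lra | field; lra].
  apply: (@Rle_trans _ (8 / T * (2 * (C * (T ^ 2 * Rpower T eps))))); last by right; field; lra.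
  apply: Rmult_le_compat => //; first by apply: Rdiv_le_0_compat; lra.
  apply: rsum_ge0 => m _; apply: Rmult_le_pos => //; exact: fejer_ge0.
have [J [hJ cov]] := @near_cover d (/ (8 * INR K)) ltac:(apply: Rinv_0_lt_compat; lra) d0.
apply: (@Rle_trans _ (\rsum_(m < n) (g (INR m / T ^ 2) * rzsum A L (fun z =>
   rzsum (- Z.of_nat J) (2 * J + 1) (fun j => near (/ (8 * INR K)) (IZR z - (alpha m + (beta + 2 * IZR j * / (8 * INR K))))))))).
  apply: (@rsum_le n (fun m => g (INR m / T ^ 2) * rzsum A L (fun z => near d (IZR z - (alpha m + beta))))) => m _.
  apply: Rmult_le_compat_l => //; apply: rzsum_le => z _.
  apply: (Rle_trans (cov _)); apply: rzsum_le => j _; right; congr near; ring.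
apply: (@Rle_trans _ (rzsum (- Z.of_nat J) (2 * J + 1) (fun j => 16 * C * (T * Rpower T eps)))).
  rewrite (@gsum_eq _ _ _ _ _ (fun m => rzsum (- Z.of_nat J) (2 * J + 1) (fun j =>
     g (INR m / T ^ 2) * rzsum A L (fun z => near (/ (8 * INR K)) (IZR z - (alpha m + (beta + 2 * IZR j * / (8 * INR K)))))))).
    by rewrite -zsum_exchange_nat; apply: rzsum_le => j _; apply: base.
  by move=> m _; rewrite zsum_exchange rzsum_scal.
rewrite rzsum_const.
have hJ2 : INR (2 * J + 1) <= 8 * (1 + d * T).
  apply: (Rle_trans hJ); rewrite (_ : d / / (8 * INR K) = 8 * d * INR K); last by field; lra.
  by nra.
have := @Rmult_le_compat_r (16 * C * (T * Rpower T eps)) _ _ ltac:(apply: Rmult_le_pos; nra) hJ2.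
by lra.
Qed.

(** * Smoothing the sum over n *)

(** The shape in which both weights enter Riemann sums. *)
Definition lip_bump (w : R -> R) (r L : R) :=
  [/\ 0 < r, 0 < L, forall x, Rabs (w x) <= L,
      forall x y, Rabs (w x - w y) <= L * Rabs (x - y)
    & forall x, r <= Rabs x -> w x = 0].

Lemma lip_bump_continuous w r L x : lip_bump w r L -> continuous w x.
Proof.
case=> _ L0 _ hl _ P [e he].
have p : 0 < e / L by apply: Rdiv_lt_0_compat => //; case: e {he}.
exists (mkposreal _ p) => y hy; apply: he.
have {}hy : Rabs (y - x) < e / L by exact: hy.
apply: (Rle_lt_trans (hl y x)).
have := Rmult_lt_compat_l L _ _ L0 hy.
by rewrite (_ : L * (e / L) = e) //; field; lra.
Qed.

Lemma lip_bump_ex_RInt w r L a b : lip_bump w r L -> ex_RInt w a b.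
Proof. by move=> hw; apply: ex_RInt_continuous => z _; apply: lip_bump_continuous hw. Qed.

Lemma RInt_outside w r L a b : lip_bump w r L -> (r <= a /\ r <= b) \/ (a <= - r /\ b <= - r) ->
  RInt w a b = 0.
Proof.
move=> [r0 _ _ _ hz] hab.
rewrite (@RInt_ext _ w (fun=> 0)); first by rewrite RInt_const /scal /= /mult /= Rmult_0_r.
move=> x hx; apply: hz.
have := Rmin_l a b; have := Rmin_r a b; have := Rmax_l a b; have := Rmax_r a b.
by case: hab => hab; move: hx; rewrite /Rmin /Rmax; case: Rle_dec => /= *; split_Rabs; lra.
Qed.

Lemma RInt_enlarge w r L x y : lip_bump w r L -> x <= - r -> r <= y ->
  RInt w x y = RInt w (- r) r.
Proof.
move=> hw hx hy; have ex a b := @lip_bump_ex_RInt w r L a b hw.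
rewrite -(RInt_Chasles w x (- r) y) // -(RInt_Chasles w (- r) r y) //.
rewrite (@RInt_outside w r L x (- r)) // ?(@RInt_outside w r L r y) //.
- by rewrite /plus /= ; ring.
- by left; lra.
- by right; lra.
Qed.

Lemma RInt_blocks w r L h a n : lip_bump w r L ->
  RInt w (h * IZR a) (h * IZR (a + Z.of_nat n)) =
  rzsum a n (fun i => RInt w (h * IZR i) (h * (IZR i + 1))).
Proof.
move=> hw; have ex x y := @lip_bump_ex_RInt w r L x y hw.
elim: n => [|n IH]; first by rewrite Z.add_0_r RInt_point /zsum gsum_0.
rewrite -(RInt_Chasles w _ (h * IZR (a + Z.of_nat n))) // IH /zsum gsum_recr.
rewrite /plus /=; congr Rplus.
rewrite (_ : Z.pos _ = Z.of_nat n.+1) //; congr (RInt w _ (h * _)).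
by rewrite -plus_IZR; congr IZR; lia.
Qed.

(** Riemann sums of a Lipschitz function converge at the rate of the mesh. *)
Lemma riemann_sum w r L : lip_bump w r L -> exists C, 0 < C /\
  forall h (I : nat), 0 < h -> h <= 1 -> r <= h * INR I ->
  Rabs (h * rzsum (- Z.of_nat I) (2 * I + 1) (fun i => w (h * IZR i))
        - RInt w (- r) r) <= C * h.
Proof.
move=> hw; have [r0 L0 _ hl hz] := hw.
have ex x y := @lip_bump_ex_RInt w r L x y hw.
exists (L * (2 * r + 5)); split; first by apply: Rmult_lt_0_compat; lra.
move=> h I h0 h1 hI.
have [u1 u2] := archimed (r / h).
have rh : 0 < r / h by apply: Rdiv_lt_0_compat.
pose B := Z.to_nat (up (r / h)).
have u0 : (0 < up (r / h))%Z by apply: lt_IZR; lra.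
have BE : INR B = IZR (up (r / h)) by rewrite INR_IZR_INZ /B Z2Nat.id //; lia.
have hB : r <= h * INR B.
  have := Rmult_lt_compat_l h _ _ h0 u1; rewrite -BE (_ : h * (r / h) = r); first by lra.
  by field; lra.
have hB2 : h * INR B <= r + h.
  have := Rmult_le_compat_l h (Rlt_le _ _ h0) u2; rewrite -BE Rmult_minus_distr_l.
  by rewrite (_ : h * (r / h) = r); [lra | field; lra].
have van (B' : nat) z : r <= h * INR B' -> (z < - Z.of_nat B' \/ - Z.of_nat B' + Z.of_nat (2 * B' + 1) <= z)%Z ->
    w (h * IZR z) = 0.
  move=> hB' hz'; apply: hz; rewrite Rabs_mult (Rabs_pos_eq h); last by lra.
  apply: (Rle_trans hB'); apply: Rmult_le_compat_l; first by lra.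
  by rewrite INR_IZR_INZ -abs_IZR; apply: IZR_le; lia.
rewrite (@zsum_window _ _ _ (- Z.of_nat I) _ (- Z.of_nat B) (2 * B + 1)); last first.
- by move=> z; apply: van.
- by move=> z; apply: van.
rewrite -(@RInt_enlarge w r L (- (h * INR B)) (h * (INR B + 1)) hw); try lra.
have -> : RInt w (- (h * INR B)) (h * (INR B + 1)) =
  RInt w (h * IZR (- Z.of_nat B)) (h * IZR (- Z.of_nat B + Z.of_nat (2 * B + 1))).
  congr (RInt w _ _); first by rewrite opp_IZR INR_IZR_INZ; ring.
  by rewrite (_ : (- Z.of_nat B + Z.of_nat (2 * B + 1) = Z.of_nat B + 1)%Z); [rewrite plus_IZR INR_IZR_INZ | lia].
rewrite (RInt_blocks _ _ _ hw) -rzsum_scal.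
have -> : rzsum (- Z.of_nat B) (2 * B + 1) (fun i => h * w (h * IZR i)) -
  rzsum (- Z.of_nat B) (2 * B + 1) (fun i => RInt w (h * IZR i) (h * (IZR i + 1))) =
  rzsum (- Z.of_nat B) (2 * B + 1) (fun i => h * w (h * IZR i) + (-1) * RInt w (h * IZR i) (h * (IZR i + 1))).
  by rewrite rzsum_split (rzsum_scal (-1)); ring.
apply: (@Rle_trans _ (rzsum (- Z.of_nat B) (2 * B + 1) (fun=> L * h * h))).
  apply: Rabs_rzsum_le => i _.
  have -> : h * w (h * IZR i) + -1 * RInt w (h * IZR i) (h * (IZR i + 1)) =
    RInt (fun x => w (h * IZR i) - w x) (h * IZR i) (h * (IZR i + 1)).
    have -> : RInt (fun x => w (h * IZR i) - w x) (h * IZR i) (h * (IZR i + 1)) =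
      RInt (fun=> w (h * IZR i)) (h * IZR i) (h * (IZR i + 1)) - RInt w (h * IZR i) (h * (IZR i + 1)).
      by apply: (@RInt_minus R_CompleteNormedModule) => //; apply: ex_RInt_const.
    by rewrite RInt_const /scal /= /mult /=; ring.
  have -> : L * h * h = (h * (IZR i + 1) - h * IZR i) * (L * h) by ring.
  apply: abs_RInt_le_const.
  - by nra.
  - apply: (@ex_RInt_minus R_CompleteNormedModule) => //; exact: ex_RInt_const.
  - move=> t ht; apply: (Rle_trans (hl _ _)).
    apply: Rmult_le_compat_l; first by lra.
    by split_Rabs; nra.
rewrite rzsum_const plus_INR mult_INR (_ : INR 2 = 2) // (_ : INR 1 = 1) //.
have -> : (2 * INR B + 1) * (L * h * h) = (L * h) * (2 * (h * INR B) + h) by ring.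
have -> : L * (2 * r + 5) * h = (L * h) * (2 * r + 5) by ring.
by apply: Rmult_le_compat_l; [nra | lra].
Qed.

(** Fourier coefficients of the periodised bump, computed on the grid of mesh
    [1/J]. *)
Definition chat (w : R -> R) (s : R) (J I : nat) (k : R) : C :=
  (RtoC (/ INR J) * czsum (- Z.of_nat I) (2 * I + 1)
    (fun i => RtoC (w (s / INR J * IZR i)%R) * ec (k * (IZR i / INR J))))%C.

Lemma chat_opp w s J I k : Cmod (chat w s J I (- k)) = Cmod (chat w s J I k).
Proof.
have -> : chat w s J I (- k) = Cconj (chat w s J I k).
  rewrite /chat /zsum.
  have -> : forall x y, Cconj (RtoC x * y) = (RtoC x * Cconj y)%C.
    by move=> x [u v]; rewrite /Cconj /RtoC /Cmult /=; congr pair; ring.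
  rewrite Cconj_csum; congr Cmult; apply: gsum_eq => i _.
  rewrite Ropp_mult_distr_l_reverse ec_opp.
  by case: (ec _) => u v; rewrite /Cconj /RtoC /Cmult /=; congr pair; ring.
by rewrite Cmod_conj.
Qed.

Lemma chat_adist w s J I p r :
  Cmod (chat w s J I (INR p - INR r)) = Cmod (chat w s J I (INR (adist p r))).
Proof.
rewrite /adist [in RHS]INR_IZR_INZ Zabs2Nat.id_abs abs_IZR minus_IZR -!INR_IZR_INZ.
rewrite /Rabs; case: Rcase_abs => _; first by congr (Cmod (chat _ _ _ _ _)); ring.
by rewrite -[RHS]chat_opp; congr (Cmod (chat _ _ _ _ _)); ring.
Qed.

(** The coefficient is at most the mass [O(1/s)] of the bump, and by partial
    summation against a geometric progression at most [O(1/k)]; hence it is at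
    most the geometric mean of the two. *)
Lemma chat_bounds w r L : lip_bump w r L -> exists C, 0 < C /\
  forall s J I k, 0 < s -> (0 < J)%coq_nat -> s <= INR J ->
  r * INR J / s <= INR I -> INR I <= r * INR J / s + 1 ->
  (0 < k)%coq_nat -> (2 * k <= J)%coq_nat ->
  Cmod (chat w s J I (INR k)) <= C * sqrt (/ s) * / sqrt (INR k).
Proof.
move=> [r0 L0 hb hl hz].
pose D := L * (2 * r + 3); have D0 : 0 < D by apply: Rmult_lt_0_compat; lra.
pose E := 7 * (L * (2 * r + 4)).
have E0 : 0 < E by apply: Rmult_lt_0_compat; [lra | apply: Rmult_lt_0_compat; lra].
exists (D + E); split; first by lra.
move=> s J I k Z0 J0 ZJ I1 I2 k0 kJ.
have Jp : 0 < INR J by apply: lt_0_INR.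
have kp : 0 < INR k by apply: lt_0_INR.
have kJR : 2 * INR k <= INR J by rewrite -[2]/(INR 2) -mult_INR; apply: le_INR.
have iZ : 0 < / s by apply: Rinv_0_lt_compat.
have iJ : 0 < / INR J by apply: Rinv_0_lt_compat.
have iJZ : / INR J <= / s by apply: Rinv_le_contravar.
have ZiJ : s * / INR J <= 1.
  by apply: (Rmult_le_reg_r (INR J)) => //; rewrite Rmult_assoc Rinv_l; lra.
have I3 : / INR J * INR I <= r * / s + / INR J.
  have := Rmult_le_compat_l _ (Rlt_le _ _ iJ) I2.
  by rewrite (_ : / INR J * (r * INR J / s + 1) = r * / s + / INR J) //; field; lra.
have nI : INR (2 * I + 1) = 2 * INR I + 1 by rewrite plus_INR mult_INR.
have B1 : Cmod (chat w s J I (INR k)) <= D * / s.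
  rewrite /chat Cmod_mult Cmod_R Rabs_pos_eq; last by lra.
  apply: (@Rle_trans _ (/ INR J * (INR (2 * I + 1) * L))).
    apply: Rmult_le_compat_l; first by lra.
    rewrite -(rzsum_const (- Z.of_nat I)); apply: Cmod_czsum_le => i _.
    by rewrite Cmod_mult Cmod_ec Cmod_R Rmult_1_r; apply: hb.
  rewrite nI /D (_ : / INR J * ((2 * INR I + 1) * L) = L * (2 * (/ INR J * INR I) + / INR J)); last by ring.
  rewrite (_ : L * (2 * r + 3) * / s = L * (2 * r * / s + 3 * / s)); last by ring.
  by apply: Rmult_le_compat_l; lra.
have B2 : Cmod (chat w s J I (INR k)) <= E * / INR k.
  rewrite /chat Cmod_mult Cmod_R Rabs_pos_eq; last by lra.
  have hd : 0 < INR k / INR J by apply: Rdiv_lt_0_compat.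
  have hps j : (j <= 2 * I)%coq_nat ->
      Cmod (\csum_(i < j.+1) ec (INR k * (IZR (- Z.of_nat I + Z.of_nat i) / INR J))) <= 7 / (INR k / INR J).
    move=> _; apply: (@kusmin_landau j (fun i => INR k * (IZR (- Z.of_nat I + Z.of_nat i) / INR J))) => //.
    - apply: (Rmult_le_reg_r (INR J)) => //; rewrite /Rdiv Rmult_assoc Rinv_l; lra.
    - move=> i _; rewrite !plus_IZR -!INR_IZR_INZ S_INR.
      have -> : INR k * ((IZR (- Z.of_nat I) + (INR i + 1)) / INR J) -
        INR k * ((IZR (- Z.of_nat I) + INR i) / INR J) = INR k / INR J by field; lra.
      split; first by lra.
      apply: (Rmult_le_reg_r (INR J)) => //.
      rewrite (_ : INR k / INR J * INR J = INR k); last by field; lra.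
      by rewrite (_ : (1 - INR k / INR J) * INR J = INR J - INR k); [lra | field; lra].
    - move=> i _; rewrite !plus_IZR -!INR_IZR_INZ !S_INR; right; field; lra.
  rewrite /zsum addn1.
  have := @abel_ineq_lip (2 * I) (fun i => RtoC (w (s / INR J * IZR (- Z.of_nat I + Z.of_nat i))%R)) _ _
    L (L * (s * / INR J)) hps.
  move=> /(_ _ _) hab.
  apply: (@Rle_trans _ (/ INR J * (7 / (INR k / INR J) * (L + INR (2 * I) * (L * (s * / INR J)))))).
    apply: Rmult_le_compat_l; first by lra.
    apply: hab; first by rewrite Cmod_R.
    move=> i _; rewrite -RtoC_minus Cmod_R; apply: (Rle_trans (hl _ _)).
    apply: Rmult_le_compat_l; first by lra.
    rewrite !plus_IZR -!INR_IZR_INZ S_INR.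
    have -> : s / INR J * (IZR (- Z.of_nat I) + (INR i + 1)) - s / INR J * (IZR (- Z.of_nat I) + INR i) = s * / INR J.
      by rewrite /Rdiv; ring.
    by rewrite Rabs_pos_eq; nra.
  have -> : / INR J * (7 / (INR k / INR J) * (L + INR (2 * I) * (L * (s * / INR J)))) =
    7 * (L * (1 + 2 * (s * (/ INR J * INR I)))) * / INR k.
    by rewrite mult_INR (_ : INR 2 = 2) //; field; lra.
  rewrite /E; apply: Rmult_le_compat_r; first by apply/Rlt_le/Rinv_0_lt_compat.
  apply: Rmult_le_compat_l; first by lra.
  apply: Rmult_le_compat_l; first by lra.
  have := Rmult_le_compat_l s (Rlt_le _ _ Z0) I3.
  rewrite Rmult_plus_distr_l (_ : s * (r * / s) = r); last by field; lra.
  by lra.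
(* the two bounds combine into their geometric mean *)
have sZ : sqrt (/ s) * sqrt (/ s) = / s by apply: sqrt_sqrt; lra.
have ik : 0 < / INR k by apply: Rinv_0_lt_compat.
have sk : sqrt (/ INR k) * sqrt (/ INR k) = / INR k by apply: sqrt_sqrt; lra.
rewrite -sqrt_inv.
have c0 := Cmod_ge_0 (chat w s J I (INR k)).
have sZ0 := sqrt_pos (/ s); have sk0 := sqrt_pos (/ INR k).
set x := Cmod _ in B1 B2 c0 *.
apply: Rsqr_incr_0_var; last first.
  by apply: Rmult_le_pos => //; apply: Rmult_le_pos; lra.
rewrite /Rsqr.
have -> : (D + E) * sqrt (/ s) * sqrt (/ INR k) * ((D + E) * sqrt (/ s) * sqrt (/ INR k)) =
   ((D + E) * (sqrt (/ s) * sqrt (/ s))) * ((D + E) * (sqrt (/ INR k) * sqrt (/ INR k))) by ring.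
rewrite sZ sk.
apply: Rmult_le_compat => //.
  by apply: (Rle_trans B1); apply: Rmult_le_compat_r; lra.
by apply: (Rle_trans B2); apply: Rmult_le_compat_r; lra.
Qed.

Definition per_sum (w : R -> R) (s : R) (A : Z) (n : nat) (x : R) : R :=
  rzsum A n (fun z => w (s * (IZR z - x))).

(** Convolution of [per_sum] with the Fejer kernel, discretised on a grid of
    mesh [1/J]: a trigonometric polynomial in [x]. *)
Definition smoothed (w : R -> R) (s : R) (J I K : nat) (x : R) : R :=
  / INR J * rzsum (- Z.of_nat I) (2 * I + 1) (fun i =>
    w (s / INR J * IZR i) * fejer K (x + IZR i / INR J)).

(** The kernel is at most [K] near 0 and at most [1 / (K d^2)] at distance [d]; so
    times the distance it is at most [1 / (K d)], which is the harmonic weight on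
    the grid. *)
Lemma fejer_moment (K J J2 : nat) tau i : (0 < K)%coq_nat -> (K <= J)%coq_nat ->
  J = (2 * J2)%N -> 0 <= tau -> tau <= / INR J ->
  (- Z.of_nat J2 <= i < Z.of_nat J2)%Z ->
  fejer K (tau + IZR i / INR J) * ((IZR (Z.abs i) + 1) / INR J) <=
  600 * (INR J / INR K) * wz i.
Proof.
move=> K0 KJ JE t0 t1 hi.
have kp : 1 <= INR K by rewrite -[1]/(INR 1); apply: le_INR; lia.
have KJR : INR K <= INR J by apply: le_INR.
have J2R : INR J = 2 * INR J2 by rewrite JE mult_INR.
have hiR : IZR (Z.abs i) <= INR J2 by rewrite INR_IZR_INZ; apply: IZR_le; lia.
case: (Z_le_dec (Z.abs i) 1) => h.
  rewrite wz_1 // Rmult_1_r.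
  have hR : IZR (Z.abs i) <= 1 by apply: IZR_le.
  have h0 : 0 <= IZR (Z.abs i) by apply: IZR_le; lia.
  apply: (@Rle_trans _ (INR K * (2 / INR J))).
    apply: Rmult_le_compat; [exact: fejer_ge0 | apply: Rdiv_le_0_compat; lra | exact: fejer_le |].
    by apply: Rmult_le_compat_r; [apply/Rlt_le/Rinv_0_lt_compat; lra | lra].
  apply: (Rmult_le_reg_r (INR K * INR J)); first by nra.
  rewrite (_ : INR K * (2 / INR J) * (INR K * INR J) = 2 * (INR K * INR K)); last by field; lra.
  rewrite (_ : 600 * (INR J / INR K) * (INR K * INR J) = 600 * (INR J * INR J)); last by field; lra.
  have : INR K * INR K <= INR J * INR J by apply: Rmult_le_compat; lra.
  by nra.
set a := IZR (Z.abs i) in hiR *.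
have a2 : 2 <= a by apply: IZR_le; lia.
have wa : wz i = / a by rewrite /wz Z.max_r; [|lia].
pose d := (a - 1) / INR J.
have d0 : 0 < d by apply: Rdiv_lt_0_compat; lra.
have iJ : 0 < / INR J by apply: Rinv_0_lt_compat; lra.
have JiJ : INR J * / INR J = 1 by apply: Rinv_r; lra.
have d1 : d <= 1 / 2.
  by apply: (Rmult_le_reg_r (INR J)); rewrite /d ?Rmult_assoc ?Rinv_l; lra.
have hF : fejer K (tau + IZR i / INR J) <= 49 / (INR K * d ^ 2).
  case: (Z_le_dec 0 i) => is0.
    have aE : a = IZR i by rewrite /a Z.abs_eq.
    have ai : a + 1 <= INR J2.
      by rewrite aE INR_IZR_INZ -plus_IZR; apply: IZR_le; lia.
    apply: (@fejer_decay _ _ 0) => //.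
    rewrite -aE Rplus_0_r /d /Rdiv; split; first by nra.
    have : (a - 1) * / INR J + / INR J + a * / INR J <= 1 by rewrite -JiJ; nra.
    by lra.
  have aE : IZR i = - a by rewrite /a Z.abs_neq ?opp_IZR; [ring | lia].
  apply: (@fejer_decay _ _ 1) => //.
  rewrite aE /d /Rdiv; split; last by nra.
  have : (a - 1) * / INR J + a * / INR J <= 1 by rewrite -JiJ; nra.
  by lra.
apply: (@Rle_trans _ (49 / (INR K * d ^ 2) * ((a + 1) / INR J))).
  by apply: Rmult_le_compat_r => //; apply: Rdiv_le_0_compat; lra.
rewrite wa.
have -> : 49 / (INR K * d ^ 2) * ((a + 1) / INR J) = INR J / INR K * (49 * (a + 1) / (a - 1) ^ 2).
  by rewrite /d; field; lra.
rewrite (_ : 600 * (INR J / INR K) * / a = INR J / INR K * (600 / a)); last by field; lra.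
apply: Rmult_le_compat_l; first by apply: Rdiv_le_0_compat; lra.
apply: (Rmult_le_reg_r ((a - 1) ^ 2 * a)); first by nra.
rewrite (_ : 49 * (a + 1) / (a - 1) ^ 2 * ((a - 1) ^ 2 * a) = 49 * (a + 1) * a); last by field; lra.
by rewrite (_ : 600 / a * ((a - 1) ^ 2 * a) = 600 * (a - 1) ^ 2); [nra | field; lra].
Qed.

(** By [fejer_mean] the convolution averages [per_sum] over shifts of [x] weighted
    by the kernel.  A shift [t] changes the bump by at most [L s |t|], and only
    for those [z] that are near [x] before or after the shift; the factor
    [|t|] against the kernel is [fejer_moment]. *)
Lemma smoothing_error w r L s K J J2 I A n x : lip_bump w r L ->
  0 < s -> (0 < K)%coq_nat -> (K <= J)%coq_nat -> J = (2 * J2)%N ->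
  r * INR J / s <= INR I ->
  IZR A <= x - (r / s + 2) -> x + (r / s + 3) <= IZR (A + Z.of_nat n) ->
  Rabs (per_sum w s A n x - smoothed w s J I K x) <=
  600 * L * s / INR K * rzsum (- Z.of_nat J2) J (fun i => wz i *
    (rzsum A n (fun z => near (r / s) (IZR z - (x + 0))) +
     rzsum A n (fun z => near (r / s + / INR J) (IZR z - (x + - (IZR i / INR J)))))).
Proof.
move=> [r0 L0 hb hl hz] Z0 K0 KJ JE hI hA hn.
have kp : 1 <= INR K by rewrite -[1]/(INR 1); apply: le_INR; lia.
have KJR : INR K <= INR J by apply: le_INR.
have iJ : 0 < / INR J by apply: Rinv_0_lt_compat; lra.
have JiJ : / INR J * INR J = 1 by apply: Rinv_l; lra.
have iJ1 : / INR J <= 1 by rewrite -Rinv_1; apply: Rinv_le_contravar; lra.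
have eta0 : 0 < r / s by apply: Rdiv_lt_0_compat.
have Zeta : s * (r / s) = r by field; lra.
have J2R : INR J = 2 * INR J2 by rewrite JE mult_INR.
have [jm hjm] := Zfloor_ex (INR J * x).
pose tau := x - IZR jm * / INR J.
have tE : tau * INR J = INR J * x - IZR jm by rewrite /tau; field; lra.
have t0 : 0 <= tau by apply: (Rmult_le_reg_r (INR J)); lra.
have t1 : tau <= / INR J by apply: (Rmult_le_reg_r (INR J)); lra.
have vanish y : r / s <= Rabs y -> w (s * y) = 0.
  move=> hy; apply: hz; rewrite Rabs_mult (Rabs_pos_eq s); last by lra.
  by rewrite -Zeta; apply: Rmult_le_compat_l; lra.
pose f i := w (s / INR J * IZR i) * fejer K (x + IZR i / INR J).
have fZ i : w (s / INR J * IZR i) = w (s * (IZR i * / INR J)).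
  by congr w; rewrite /Rdiv; ring.
have sE : smoothed w s J I K x = / INR J * rzsum (- Z.of_nat J2) J (fun i =>
    fejer K (tau + IZR i / INR J) * rzsum A n (fun z => w (s * (IZR z - x + (tau + IZR i / INR J))))).
  rewrite /smoothed -/f; congr Rmult.
  rewrite (@zsum_window _ _ _ _ _ (A * Z.of_nat J - jm - Z.of_nat J2)%Z (n * J)); last first.
  - move=> i hi; rewrite /f fZ vanish; first by ring.
    rewrite Rabs_mult (Rabs_pos_eq (/ INR J)); last by lra.
    have JZ : IZR (Z.of_nat J) = INR J by rewrite -INR_IZR_INZ.
    have J2Z : IZR (Z.of_nat J2) = INR J2 by rewrite -INR_IZR_INZ.
    apply: (Rmult_le_reg_r (INR J)); first by lra.
    rewrite Rmult_assoc JiJ Rmult_1_r; case: hi => hi.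
      have : IZR i <= IZR (A * Z.of_nat J - jm - Z.of_nat J2) by apply: IZR_le; lia.
      rewrite !minus_IZR mult_IZR JZ J2Z => h.
      have := Rmult_le_compat_r (INR J) ltac:(lra) hA => h2.
      rewrite Rabs_left1; first by nra.
      by nra.
    have : IZR ((A + Z.of_nat n) * Z.of_nat J - jm - Z.of_nat J2) <= IZR i by apply: IZR_le; lia.
    rewrite !minus_IZR mult_IZR JZ J2Z => h.
    have := Rmult_le_compat_r (INR J) ltac:(lra) hn => h2.
    by apply: Rle_trans (Rle_abs _); nra.
  - move=> i hi; rewrite /f fZ vanish; first by ring.
    rewrite Rabs_mult (Rabs_pos_eq (/ INR J)); last by lra.
    apply: (Rmult_le_reg_r (INR J)); first by lra.
    rewrite Rmult_assoc JiJ Rmult_1_r.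
    rewrite (_ : r / s * INR J = r * INR J / s); last by field; lra.
    apply: (Rle_trans hI); rewrite -abs_IZR INR_IZR_INZ; apply: IZR_le; lia.
  rewrite zsum_block.
  rewrite (@gsum_eq _ _ _ _ _ (fun a => rzsum (- Z.of_nat J2) J (fun i =>
     fejer K (tau + IZR i / INR J) * w (s * (IZR (A + Z.of_nat a) - x + (tau + IZR i / INR J)))))).
    rewrite -[LHS]/(rzsum A n (fun z => rzsum (- Z.of_nat J2) J (fun i =>
     fejer K (tau + IZR i / INR J) * w (s * (IZR z - x + (tau + IZR i / INR J)))))).
    by rewrite zsum_exchange; apply: zsum_eq => i _; rewrite rzsum_scal.
  move=> a _.
  rewrite (_ : (A * Z.of_nat J - jm - Z.of_nat J2 + Z.of_nat a * Z.of_nat J =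
    - Z.of_nat J2 + ((A + Z.of_nat a) * Z.of_nat J - jm))%Z); last by lia.
  rewrite -zsum_shift; apply: zsum_eq => i _; rewrite /f fZ Rmult_comm.
  have E : IZR (i + ((A + Z.of_nat a) * Z.of_nat J - jm)) * / INR J =
    IZR (A + Z.of_nat a) - x + (tau + IZR i / INR J).
    by rewrite plus_IZR minus_IZR mult_IZR -(INR_IZR_INZ J) /tau; field; lra.
  rewrite E; congr (_ * _).
  rewrite -(fejer_periodic K (tau + IZR i / INR J) (A + Z.of_nat a)); congr fejer.
  by rewrite [_ / _]E; ring.
have pE : per_sum w s A n x = / INR J * rzsum (- Z.of_nat J2) J (fun i =>
    fejer K (tau + IZR i / INR J) * per_sum w s A n x).
  rewrite (@zsum_eq _ _ _ _ _ _ (fun i => per_sum w s A n x * fejer K (tau + IZR i / INR J))).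
    by rewrite rzsum_scal fejer_mean // Rmult_comm Rmult_assoc (Rmult_comm (INR J)) JiJ Rmult_1_r.
  by move=> i _; ring.
rewrite sE pE -Rmult_minus_distr_l Rabs_mult (Rabs_pos_eq (/ INR J)); last by lra.
have -> : rzsum (- Z.of_nat J2) J (fun i => fejer K (tau + IZR i / INR J) * per_sum w s A n x) -
   rzsum (- Z.of_nat J2) J (fun i =>
    fejer K (tau + IZR i / INR J) * rzsum A n (fun z => w (s * (IZR z - x + (tau + IZR i / INR J))))) =
   rzsum (- Z.of_nat J2) J (fun i => fejer K (tau + IZR i / INR J) *
      rzsum A n (fun z => w (s * (IZR z - x)) + (-1) * w (s * (IZR z - x + (tau + IZR i / INR J))))).
  rewrite (_ : forall u v, u - v = u + (-1) * v); last by move=> *; ring.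
  rewrite -rzsum_scal -rzsum_split; apply: zsum_eq => i _.
  by rewrite rzsum_split (rzsum_scal (-1)) /per_sum; ring.
apply: (@Rle_trans _ (/ INR J * rzsum (- Z.of_nat J2) J (fun i => L * s * (600 * (INR J / INR K) * wz i) *
    (rzsum A n (fun z => near (r / s) (IZR z - (x + 0))) +
     rzsum A n (fun z => near (r / s + / INR J) (IZR z - (x + - (IZR i / INR J)))))))); last first.
  right; rewrite -rzsum_scal -[RHS]rzsum_scal; apply: zsum_eq => i _; field; lra.
apply: Rmult_le_compat_l; first by lra.
apply: Rabs_rzsum_le => i hi.
have hi2 : (- Z.of_nat J2 <= i < Z.of_nat J2)%Z by lia.
have mom := fejer_moment K0 KJ JE t0 t1 hi2.
rewrite Rabs_mult (Rabs_pos_eq (fejer _ _)); last exact: fejer_ge0.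
set NN := _ + rzsum _ _ _.
have NN0 : 0 <= NN.
  by apply: Rplus_le_le_0_compat; apply: rzsum_ge0 => z _; exact: (proj1 (near_range _ _)).
have inner : Rabs (rzsum A n (fun z => w (s * (IZR z - x)) +
     (-1) * w (s * (IZR z - x + (tau + IZR i / INR J))))) <=
     (L * s * ((IZR (Z.abs i) + 1) / INR J)) * NN.
  rewrite /NN -rzsum_split -rzsum_scal; apply: Rabs_rzsum_le => z _.
  rewrite Rplus_0_r; set y := IZR z - x; set t := tau + IZR i / INR J.
  have -> : w (s * y) + -1 * w (s * (y + t)) = w (s * y) - w (s * (y + t)) by ring.
  have ht : Rabs t <= (IZR (Z.abs i) + 1) / INR J.
    apply: (Rle_trans (Rabs_triang _ _)).
    rewrite (Rabs_pos_eq tau) // Rabs_mult (Rabs_pos_eq (/ INR J)); last by lra.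
    by rewrite -abs_IZR /Rdiv; lra.
  have hlip : Rabs (w (s * y) - w (s * (y + t))) <= L * s * ((IZR (Z.abs i) + 1) / INR J).
    apply: (Rle_trans (hl _ _)); rewrite Rmult_assoc; apply: Rmult_le_compat_l; first by lra.
    have -> : s * y - s * (y + t) = - (s * t) by ring.
    rewrite Rabs_Ropp Rabs_mult (Rabs_pos_eq s); last by lra.
    by apply: Rmult_le_compat_l; lra.
  have X0 : 0 <= L * s * ((IZR (Z.abs i) + 1) / INR J) := Rle_trans (Rabs_pos _) hlip.
  have n1 := near_range (r / s) y.
  have n2 := near_range (r / s + / INR J) (IZR z - (x + - (IZR i / INR J))).
  case: (Rle_dec (Rabs y) (r / s)) => h1.
    by rewrite (near_in h1); nra.
  case: (Rle_dec (Rabs (IZR z - (x + - (IZR i / INR J)))) (r / s + / INR J)) => h2.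
    by rewrite (near_in h2); nra.
  rewrite !vanish ?Rminus_diag ?Rabs_R0; try lra.
    by apply: Rmult_le_pos; lra.
  apply: Rlt_le; apply: Rnot_le_lt => h3; apply: h2.
  have -> : IZR z - (x + - (IZR i / INR J)) = (y + t) - tau by rewrite /y /t; ring.
  by split_Rabs; lra.
apply: (@Rle_trans _ (fejer K (tau + IZR i / INR J) * (L * s * ((IZR (Z.abs i) + 1) / INR J) * NN))).
  by apply: Rmult_le_compat_l => //; apply: fejer_ge0.
rewrite (_ : _ * _ = L * s * (fejer K (tau + IZR i / INR J) * ((IZR (Z.abs i) + 1) / INR J)) * NN); last by ring.
apply: Rmult_le_compat_r => //.
by apply: Rmult_le_compat_l => //; nra.
Qed.

(** The convolution multiplies the frequencies of the kernel by the Fourier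
    coefficients of the bump. *)
Lemma smoothed_sum g T n w s J I K :
  RtoC (\rsum_(m < n) (g (INR m / T ^ 2) * smoothed w s J I K (alpha m))) =
  (RtoC (/ INR K) * \csum_(p < K) \csum_(r < K)
     (chat w s J I (INR p - INR r) * Esum g T n (INR p - INR r)))%C.
Proof.
have -> : \rsum_(m < n) (g (INR m / T ^ 2) * smoothed w s J I K (alpha m)) =
  / INR J * rzsum (- Z.of_nat I) (2 * I + 1) (fun i => w (s / INR J * IZR i) *
    \rsum_(m < n) (g (INR m / T ^ 2) * fejer K (alpha m + IZR i / INR J))).
  rewrite (@gsum_eq _ _ _ _ _ (fun m => / INR J * rzsum (- Z.of_nat I) (2 * I + 1) (fun i =>
     w (s / INR J * IZR i) * (g (INR m / T ^ 2) * fejer K (alpha m + IZR i / INR J))))).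
    rewrite rsum_scal -zsum_exchange_nat; congr Rmult.
    by apply: zsum_eq => i _; rewrite rsum_scal.
  move=> m _; rewrite /smoothed -Rmult_assoc (Rmult_comm (g _)) Rmult_assoc; congr Rmult.
  by rewrite -rzsum_scal; apply: zsum_eq => i _; ring.
rewrite RtoC_mult RtoC_rzsum.
rewrite (@zsum_eq _ _ _ _ _ _ (fun i => RtoC (/ INR K) * \csum_(p < K) \csum_(r < K)
   (RtoC (w (s / INR J * IZR i)%R) * ec ((INR p - INR r) * (IZR i / INR J)) * Esum g T n (INR p - INR r)))%C); last first.
  move=> i _; rewrite RtoC_mult fejer_weighted Cmult_assoc (Cmult_comm (RtoC (w _))) -Cmult_assoc.
  congr Cmult; rewrite -csum_scal; apply: gsum_eq => p _; rewrite -csum_scal.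
  by apply: gsum_eq => r _; rewrite Cmult_assoc.
rewrite czsum_scal Cmult_assoc (Cmult_comm (RtoC (/ INR J))) -Cmult_assoc; congr Cmult.
rewrite zsum_exchange_nat -csum_scal; apply: gsum_eq => p _.
rewrite zsum_exchange_nat -csum_scal; apply: gsum_eq => r _.
rewrite /chat -Cmult_assoc; congr Cmult.
rewrite Cmult_comm -czsum_scal; apply: zsum_eq => i _; ring.
Qed.

Lemma csum_delta K i (c : C) : (i < K)%coq_nat ->
  csum K (fun r => if Nat.eqb r i then c else RtoC 0) = c.
Proof.
elim: K => [|K IH] iK; first by lia.
rewrite gsum_recr; case: (Nat.eq_dec i K) => [E|neq].
  rewrite E Nat.eqb_refl gsum_idx /= ?Cplus_0_l // => r hr.
  by case: Nat.eqb_spec => // h; lia.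
rewrite IH; last by lia.
by case: Nat.eqb_spec => [h|_]; [lia | rewrite /= Cplus_0_r].
Qed.

(** The [K] terms with [p = r] give the product of the zero frequencies; in the
    others every [|p - r| = k] with [1 <= k < K] occurs at most [2 K] times. *)
Lemma smoothed_main g T n w s J I K : (0 < K)%coq_nat ->
  let c0 := / INR J * rzsum (- Z.of_nat I) (2 * I + 1) (fun i => w (s / INR J * IZR i)) in
  Rabs (\rsum_(m < n) (g (INR m / T ^ 2) * smoothed w s J I K (alpha m))
        - c0 * \rsum_(m < n) g (INR m / T ^ 2))
  <= 2 * \rsum_(i < K) (Cmod (chat w s J I (INR i.+1)) * Cmod (Esum g T n (INR i.+1))).
Proof.
move=> K0 c0; have kp : 0 < INR K by apply: lt_0_INR.
rewrite -Cmod_R RtoC_minus smoothed_sum RtoC_mult.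
have c0E : chat w s J I 0 = RtoC c0.
  rewrite /chat /c0 RtoC_mult RtoC_rzsum; congr Cmult; apply: zsum_eq => i _.
  by rewrite Rmult_0_l ec_0 Cmult_1_r.
have E0E : Esum g T n 0 = RtoC (\rsum_(m < n) g (INR m / T ^ 2)).
  rewrite RtoC_rsum; apply: gsum_eq => m _.
  by rewrite Rmult_0_l ec_0 Cmult_1_r.
rewrite -c0E -E0E.
pose F p r := (chat w s J I (INR p - INR r) * Esum g T n (INR p - INR r))%C.
pose F0 p r := if Nat.eqb r p then RtoC 0 else F p r.
have -> : csum K (fun p => csum K (fun r => F p r)) =
  (RtoC (INR K) * (chat w s J I 0 * Esum g T n 0) + csum K (fun p => csum K (fun r => F0 p r)))%C.
  have -> : (RtoC (INR K) * (chat w s J I 0 * Esum g T n 0))%C =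
    csum K (fun p => csum K (fun r => if Nat.eqb r p then (chat w s J I 0 * Esum g T n 0)%C else RtoC 0)).
    rewrite [RHS](@gsum_eq _ _ _ _ _ (fun=> RtoC 1 * (chat w s J I 0 * Esum g T n 0))%C); last first.
      by move=> p hp; rewrite csum_delta // Cmult_1_l.
    rewrite -csum_mul_r; congr Cmult.
    by rewrite -RtoC_rsum rsum_const Rmult_1_r.
  rewrite -[RHS]/(Cplus _ _) -gsum_split; apply: gsum_eq => p _.
  rewrite -gsum_split; apply: gsum_eq => r _ /=.
  rewrite /F0; case: Nat.eqb_spec => [->|_]; last by rewrite Cplus_0_l.
  by rewrite Cplus_0_r /F Rminus_diag.
have -> : forall a b : C, (RtoC (/ INR K) * (RtoC (INR K) * a + b) - a)%C = (RtoC (/ INR K) * b)%C.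
  move=> a b; have : (RtoC (/ INR K) * RtoC (INR K) = RtoC 1)%C.
    by rewrite -RtoC_mult Rinv_l //; lra.
  move=> h; rewrite Cmult_plus_distr_l Cmult_assoc h; ring.
rewrite Cmod_mult Cmod_R Rabs_pos_eq; last by apply/Rlt_le/Rinv_0_lt_compat.
pose f k := if Nat.eqb k 0 then 0 else Cmod (chat w s J I (INR k)) * Cmod (Esum g T n (INR k)).
have f0 k : 0 <= f k.
  by rewrite /f; case: ifP => _; [lra | apply: Rmult_le_pos; exact: Cmod_ge_0].
apply: (@Rle_trans _ (/ INR K * (INR K * (2 * rsum K f)))).
  apply: Rmult_le_compat_l; first by apply/Rlt_le/Rinv_0_lt_compat.
  apply: Rle_trans (adist_sum K f0).
  apply: (@Cmod_csum_le K _ (fun p => rsum K (fun r => f (adist p r)))) => p _.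
  apply: (@Cmod_csum_le K _ (fun r => f (adist p r))) => r _.
  rewrite /F0 /f; case: Nat.eqb_spec => h1; case: Nat.eqb_spec => h2.
  - by rewrite Cmod_0; lra.
  - by rewrite h1 /adist Z.sub_diag in h2.
  - by exfalso; apply: h1; rewrite /adist in h2; lia.
  - by rewrite /F Cmod_mult chat_adist Esum_adist; lra.
rewrite -Rmult_assoc Rinv_l ?Rmult_1_l; last by lra.
apply: Rmult_le_compat_l; first by lra.
rewrite (_ : rsum K f = rsum (1 + K.-1) f); last by congr gsum; lia.
rewrite gsum_cat gsum_recr gsum_0 /= {1}/f /= !Rplus_0_l.
rewrite (_ : rsum K _ = rsum (K.-1 + 1) (fun i => Cmod (chat w s J I (INR i.+1)) * Cmod (Esum g T n (INR i.+1)))); last by congr gsum; lia.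
rewrite gsum_cat [rsum 1 _]gsum_recr gsum_0 /= addn0.
rewrite -[X in X <= _]Rplus_0_r; apply: Rplus_le_compat; first by right.
by rewrite Rplus_0_l; apply: Rmult_le_pos; exact: Cmod_ge_0.
Qed.

Lemma weight_lip_bump g g' a b G : lip_weight g g' G -> supported g a b -> lip_bump g b G.
Proof.
move=> Hg [a0 [ab hz]]; have [G0 _ hb _ _] := Hg; split=> //; first by lra.
  exact: lip_weight_lip Hg.
move=> x hx; apply: hz; case: (Rle_dec 0 x) => h; [right | left]; move: hx; split_Rabs; lra.
Qed.

(** A Riemann sum of mesh [1 / T^2]. *)
Lemma weight_sum g g' a b G : lip_weight g g' G -> supported g a b -> exists C, 0 < C /\
  forall T n, 1 <= T -> b * T ^ 2 <= INR n ->
  Rabs (\rsum_(m < n) g (INR m / T ^ 2) - T ^ 2 * RInt g (- b) b) <= C.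
Proof.
move=> Hg Hs; have hw := weight_lip_bump Hg Hs.
have [C [C0 H]] := riemann_sum hw; have [a0 [ab hz]] := Hs.
exists C; split=> // T n T1 bn.
have T2 : 1 <= T ^ 2 by nra.
have iT : 0 < / T ^ 2 by apply: Rinv_0_lt_compat; lra.
have := H (/ T ^ 2) n iT.
move=> /(_ _ _) H1.
have {H1} H1 := H1 ltac:(rewrite -[X in _ <= X]Rinv_1; apply: Rinv_le_contravar; lra)
  ltac:(apply: (Rmult_le_reg_l (T ^ 2)); [lra | rewrite -Rmult_assoc Rinv_r; lra]).
have E : rzsum (- Z.of_nat n) (2 * n + 1) (fun i => g (/ T ^ 2 * IZR i)) =
   \rsum_(m < n) g (INR m / T ^ 2).
  rewrite -[RHS]/(rsum n (fun m => g (INR m / T ^ 2))).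
  rewrite (@zsum_widen _ _ _ 0%Z n); [|move=> z hz'|lia|lia].
    by apply: gsum_eq => m _; rewrite Z.add_0_l -INR_IZR_INZ Rmult_comm.
  apply: hz; case: hz' => hz'.
    left; have : IZR z <= 0 by apply: IZR_le; lia.
    by nra.
  right; apply: (Rmult_le_reg_l (T ^ 2)); first by lra.
  rewrite -Rmult_assoc Rinv_r ?Rmult_1_l; last by lra.
  by apply: (@Rle_trans _ (INR n)); [lra | rewrite INR_IZR_INZ; apply: IZR_le; lia].
rewrite E in H1; move: H1; set S := rsum n _; move: (RInt _ _ _) => I H1.
have -> : S - T ^ 2 * I = T ^ 2 * (/ T ^ 2 * S - I) by field; lra.
rewrite Rabs_mult Rabs_pos_eq; last by lra.
apply: (Rle_trans (Rmult_le_compat_l (T ^ 2) _ H1)); first by lra.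
by right; field; lra.
Qed.

(** The bump has width [1/s], which is at least the resolution [1/T] of the
    kernel, so that smoothing at that resolution is harmless.  The majorant
    [phi] of [|g|] is what [density], which needs a nonnegative weight, is
    applied to. *)
Lemma count_wide g g' a b G phi phi' a' b' G' w r L eps :
  lip_weight g g' G -> supported g a b ->
  lip_weight phi phi' G' -> supported phi a' b' -> (forall x, Rabs (g x) <= phi x) ->
  b <= b' -> lip_bump w r L -> 0 < eps -> exists C, 0 < C /\
  forall T s n A nz, 1 <= T -> 0 < s -> s <= T -> b' * T ^ 2 <= INR n ->
  (forall m, (m < n)%coq_nat -> IZR A <= alpha m - (r / s + 2) /\
     alpha m + (r / s + 3) <= IZR (A + Z.of_nat nz)) ->
  Rabs (\rsum_(m < n) (g (INR m / T ^ 2) * per_sum w s A nz (alpha m))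
        - T ^ 2 / s * (RInt g (- b) b * RInt w (- r) r))
  <= C * (T * Rpower T eps + T * sqrt T * sqrt (/ s) * Rpower T eps + / s).
Proof.
move=> Hg Hs Hp Hps gp bb' Hw e0.
have phi0 x : 0 <= phi x by apply: Rle_trans (gp x); exact: Rabs_pos.
have [C1 [C10 H1]] := @density phi phi' a' b' G' (eps / 2) Hp Hps phi0 ltac:(lra).
have [C2 [C20 H2]] := @harmonic_bound (eps / 4) ltac:(lra).
have [C3 [C30 H3]] := chat_bounds Hw.
have [C4 [C40 H4]] := Esum_half_average Hg Hs e0.
have [C5 [C50 H5]] := riemann_sum Hw.
have [C6 [C60 H6]] := weight_sum Hg Hs.
have [r0 L0 _ _ _] := Hw; have [G0 _ hG _ _] := Hg; have [a0 [ab _]] := Hs.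
set I1 := RInt g (- b) b; set I2 := RInt w (- r) r.
pose c2 := Rpower 2 (eps / 4); have c20 : 0 < c2 by apply: exp_pos.
pose D1 := 600 * L * 2 * (C2 * c2) * (2 * C1 * (r + 2)).
have D10 : 0 < D1 by repeat apply: Rmult_lt_0_compat; lra.
pose D2 := 2 * (C3 * C4); have D20 : 0 < D2 by repeat apply: Rmult_lt_0_compat; lra.
pose D3 := C5 * (G * (b + 1)).
have D30 : 0 < D3 by repeat apply: Rmult_lt_0_compat; lra.
pose D4 := Rabs I2 * C6; have D40 : 0 <= D4 by apply: Rmult_le_pos; [exact: Rabs_pos | lra].
exists (D1 + D2 + D3 + D4); split; first by lra.
move=> T s n A nz T1 s0 sT bn hwin.
have [K [K0 [KT TK]]] := floor_half T1.
have bn' : b * T ^ 2 <= INR n by apply: Rle_trans bn; apply: Rmult_le_compat_r; nra.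
have T2 : 1 <= T ^ 2 by nra.
(* a grid of mesh [1 / J] with [J] about [2 T^2] makes the error of the Riemann
   sum for the zero coefficient, times the number [O(T^2)] of points, bounded *)
have [u1 u2] := archimed (T ^ 2).
pose J2 := Z.to_nat (up (T ^ 2)).
have u0 : (0 < up (T ^ 2))%Z by apply: lt_IZR; lra.
have J2E : INR J2 = IZR (up (T ^ 2)) by rewrite INR_IZR_INZ /J2 Z2Nat.id //; lia.
pose J := (2 * J2)%N.
have JE : INR J = 2 * INR J2 by rewrite mult_INR.
have TT : T <= T ^ 2 by nra.
have KJ : (2 * K <= J)%coq_nat.
  by apply: INR_le; rewrite mult_INR (_ : INR 2 = 2) // JE; lra.
have J0 : (0 < J)%coq_nat by lia.
have iJ : 0 < / INR J by apply: Rinv_0_lt_compat; lra.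
have kp : 1 <= INR K by rewrite -[1]/(INR 1); apply: le_INR; lia.
have is0 : 0 < / s by apply: Rinv_0_lt_compat.
have [v1 v2] := archimed (r * INR J / s).
pose I := Z.to_nat (up (r * INR J / s)).
have rJ : 0 < r * INR J / s by apply: Rdiv_lt_0_compat => //; nra.
have v0 : (0 < up (r * INR J / s))%Z by apply: lt_IZR; lra.
have IE : INR I = IZR (up (r * INR J / s)) by rewrite INR_IZR_INZ /I Z2Nat.id //; lia.
have hI1 : r * INR J / s <= INR I by lra.
have hI2 : INR I <= r * INR J / s + 1 by lra.
have TE := @Rpower_ge1 T eps T1 (Rlt_le _ _ e0).
have TE2 : Rpower T eps = Rpower T (eps / 2) * Rpower T (eps / 2).
  by rewrite -Rpower_plus; congr Rpower; field.
pose c0 := / INR J * rzsum (- Z.of_nat I) (2 * I + 1) (fun i => w (s / INR J * IZR i)).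
pose S0 := \rsum_(m < n) g (INR m / T ^ 2).
pose SS := \rsum_(m < n) (g (INR m / T ^ 2) * smoothed w s J I K (alpha m)).
(* points are moved by [1 / K], up to a logarithm, and [density] counts those
   for which this matters *)
have e1 : Rabs (\rsum_(m < n) (g (INR m / T ^ 2) * per_sum w s A nz (alpha m)) - SS)
    <= D1 * (T * Rpower T eps).
  have -> : \rsum_(m < n) (g (INR m / T ^ 2) * per_sum w s A nz (alpha m)) - SS =
     \rsum_(m < n) (g (INR m / T ^ 2) * (per_sum w s A nz (alpha m) - smoothed w s J I K (alpha m))).
    rewrite (_ : forall x y, x - y = x + (-1) * y); last by move=> *; ring.
    rewrite /SS -rsum_scal -gsum_split; apply: gsum_eq => m _ /=; ring.
  pose N m i := rzsum A nz (fun z => near (r / s) (IZR z - (alpha m + 0))) +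
     rzsum A nz (fun z => near (r / s + / INR J) (IZR z - (alpha m + - (IZR i / INR J)))).
  apply: (@Rle_trans _ (\rsum_(m < n) (600 * L * s / INR K * rzsum (- Z.of_nat J2) J (fun i => wz i *
     (phi (INR m / T ^ 2) * N m i))))).
    apply: (Rle_trans (@Rabs_rsum n (fun m => g (INR m / T ^ 2) * _))).
    apply: (@rsum_le n (fun m => Rabs (g (INR m / T ^ 2) * (per_sum w s A nz (alpha m) - smoothed w s J I K (alpha m))))) => m hm.
    rewrite Rabs_mult; have [w1 w2] := hwin m hm.
    have h := @smoothing_error w r L s K J J2 I A nz (alpha m) Hw s0 K0 ltac:(lia) erefl hI1 w1 w2.
    apply: (@Rle_trans _ (phi (INR m / T ^ 2) * (600 * L * s / INR K * rzsum (- Z.of_nat J2) J (fun i => wz i * N m i)))).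
      by apply: Rmult_le_compat => //; exact: Rabs_pos.
    right; rewrite -rzsum_scal -rzsum_scal -rzsum_scal; apply: zsum_eq => i _; ring.
  rewrite rsum_scal -zsum_exchange_nat.
  have Bi i : \rsum_(m < n) (wz i * (phi (INR m / T ^ 2) * N m i)) <=
      wz i * (2 * C1 * (1 + (r / s + / INR J) * T) * (T * Rpower T (eps / 2))).
    rewrite rsum_scal; apply: Rmult_le_compat_l; first by apply/Rlt_le/wz_pos.
    have rs0 : 0 < r / s by apply: Rdiv_lt_0_compat.
    have d1 := H1 T n 0 (r / s) A nz T1 bn ltac:(lra).
    have d2 := H1 T n (- (IZR i / INR J)) (r / s + / INR J) A nz T1 bn ltac:(lra).
    have -> : \rsum_(m < n) (phi (INR m / T ^ 2) * N m i) =
      \rsum_(m < n) (phi (INR m / T ^ 2) * rzsum A nz (fun z => near (r / s) (IZR z - (alpha m + 0)))) +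
      \rsum_(m < n) (phi (INR m / T ^ 2) * rzsum A nz (fun z => near (r / s + / INR J) (IZR z - (alpha m + - (IZR i / INR J))))).
      rewrite -[RHS]/(Rplus _ _) -gsum_split; apply: gsum_eq => m _ /=; rewrite /N; ring.
    have d3 : C1 * (1 + r / s * T) * (T * Rpower T (eps / 2)) <=
       C1 * (1 + (r / s + / INR J) * T) * (T * Rpower T (eps / 2)).
      apply: Rmult_le_compat_r; first by apply: Rmult_le_pos; [lra | apply/Rlt_le/exp_pos].
      by apply: Rmult_le_compat_l; [lra | nra].
    by lra.
  apply: (@Rle_trans _ (600 * L * s / INR K * (harmonic J2 * (2 * C1 * (1 + (r / s + / INR J) * T) * (T * Rpower T (eps / 2)))))).
    apply: Rmult_le_compat_l.
      by apply: Rdiv_le_0_compat; [apply: Rmult_le_pos; lra | lra].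
    apply: (Rle_trans (rzsum_le (fun i _ => Bi i))).
    rewrite (@zsum_eq _ _ _ _ _ _ (fun i => (2 * C1 * (1 + (r / s + / INR J) * T) * (T * Rpower T (eps / 2))) * wz i)); last by move=> i _; ring.
    rewrite rzsum_scal Rmult_comm; apply: Rmult_le_compat_r.
      apply: Rmult_le_pos; last by apply: Rmult_le_pos; [lra | apply/Rlt_le/exp_pos].
      apply: Rmult_le_pos; first by lra.
      have : 0 <= (r / s + / INR J) * T; last by lra.
      by apply: Rmult_le_pos; [have : 0 < r / s by [apply: Rdiv_lt_0_compat]; lra | lra].
    by apply: rzsum_incl; [move=> z _; apply/Rlt_le/wz_pos | lia | rewrite /J; lia].
  have hh : harmonic J2 <= C2 * c2 * Rpower T (eps / 2).
    apply: (Rle_trans (H2 J2 _)); first by lia.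
    rewrite Rmult_assoc; apply: Rmult_le_compat_l; first by lra.
    have -> : c2 * Rpower T (eps / 2) = Rpower (2 * (T * T)) (eps / 4).
      rewrite -Rpower_mult_distr; [|lra|nra]; rewrite -Rpower_mult_distr; [|lra|lra].
      by rewrite -Rpower_plus; congr (_ * Rpower _ _); field.
    by apply: Rle_Rpower_l; [lra | split; [lra | rewrite (_ : T * T = T ^ 2); [lra | ring]]].
  have hs : s * (1 + (r / s + / INR J) * T) <= (r + 2) * T.
    have -> : s * (1 + (r / s + / INR J) * T) = s + r * T + s * (/ INR J * T) by field; lra.
    have : / INR J * T <= 1.
      by apply: (Rmult_le_reg_l (INR J)); [lra | rewrite -Rmult_assoc Rinv_r; lra].
    by move=> h; nra.
  have iK : / INR K <= 2 * / T.
    apply: (Rmult_le_reg_r (INR K * T)); first by nra.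
    rewrite (_ : / INR K * (INR K * T) = T); last by field; lra.
    by rewrite (_ : 2 * / T * (INR K * T) = 2 * INR K) //; field; lra.
  have E0 : 0 < Rpower T (eps / 2) := exp_pos _.
  have h0 := harmonic_ge0 J2.
  have ik0 : 0 < / INR K by apply: Rinv_0_lt_compat; lra.
  have it0 : 0 < / T by apply: Rinv_0_lt_compat; lra.
  have P1 : / INR K * harmonic J2 <= 2 * / T * (C2 * c2 * Rpower T (eps / 2)).
    by apply: Rmult_le_compat; lra.
  have sp0 : 0 <= s * (1 + (r / s + / INR J) * T).
    apply: Rmult_le_pos; first by lra.
    have : 0 <= (r / s + / INR J) * T; last by lra.
    by apply: Rmult_le_pos; [have : 0 < r / s by [apply: Rdiv_lt_0_compat]; lra | lra].
  have P2 : / INR K * harmonic J2 * (s * (1 + (r / s + / INR J) * T)) <=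
     2 * / T * (C2 * c2 * Rpower T (eps / 2)) * ((r + 2) * T).
    by apply: Rmult_le_compat => //; apply: Rmult_le_pos; lra.
  have -> : 600 * L * s / INR K * (harmonic J2 * (2 * C1 * (1 + (r / s + / INR J) * T) * (T * Rpower T (eps / 2)))) =
    (600 * L * 2 * C1 * (T * Rpower T (eps / 2))) * (/ INR K * harmonic J2 * (s * (1 + (r / s + / INR J) * T))).
    by rewrite /Rdiv; ring.
  apply: (@Rle_trans _ ((600 * L * 2 * C1 * (T * Rpower T (eps / 2))) * (2 * / T * (C2 * c2 * Rpower T (eps / 2)) * ((r + 2) * T)))).
    apply: Rmult_le_compat_l => //.
    by repeat apply: Rmult_le_pos; lra.
  by right; rewrite /D1 TE2; field; lra.
(* the frequencies [1 <= k < K] *)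
have e2 : Rabs (SS - c0 * S0) <= D2 * (T * sqrt T * sqrt (/ s) * Rpower T eps).
  apply: (Rle_trans (smoothed_main g T n w s J I K0)).
  have h := H4 T n K T1 K0 KT bn'.
  apply: (@Rle_trans _ (2 * ((C3 * sqrt (/ s)) * (C4 * (T * sqrt T * Rpower T eps))))); last first.
    by right; rewrite /D2; ring.
  apply: Rmult_le_compat_l; first by lra.
  have sq0 := sqrt_pos (/ s).
  apply: Rle_trans (Rmult_le_compat_l (C3 * sqrt (/ s)) ltac:(nra) h).
  rewrite -rsum_scal; apply: (@rsum_le K (fun i => Cmod (chat w s J I (INR i.+1)) * Cmod (Esum g T n (INR i.+1)))) => i iK.
  rewrite -Rmult_assoc; apply: Rmult_le_compat_r; first exact: Cmod_ge_0.
  by apply: H3 => //; try lia; lra.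
(* the main term is the product of two Riemann sums *)
have e3 : Rabs (c0 * S0 - T ^ 2 / s * (I1 * I2)) <= D3 + D4 * / s.
  have h6 := H6 T n T1 bn'; rewrite -/S0 -/I1 in h6.
  have h5 := H5 (s / INR J) I ltac:(apply: Rdiv_lt_0_compat; lra).
  have Jp : 0 < INR J by lra.
  have sJ : s / INR J <= 1.
    apply: (Rmult_le_reg_r (INR J)) => //.
    by rewrite (_ : s / INR J * INR J = s); [lra | field; lra].
  have rI : r <= s / INR J * INR I.
    have sJ0 : 0 <= s / INR J by apply: Rdiv_le_0_compat; lra.
    have := Rmult_le_compat_l (s / INR J) sJ0 hI1.
    by rewrite (_ : s / INR J * (r * INR J / s) = r) //; field; lra.
  have {}h5 := h5 sJ rI.
  have h7 : Rabs (c0 - I2 * / s) <= C5 * / INR J.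
    have -> : c0 - I2 * / s = / s * (s / INR J * rzsum (- Z.of_nat I) (2 * I + 1) (fun i => w (s / INR J * IZR i)) - I2).
      by rewrite /c0; field; lra.
    rewrite Rabs_mult (Rabs_pos_eq (/ s)); last by lra.
    apply: (Rle_trans (Rmult_le_compat_l (/ s) (Rlt_le _ _ is0) h5)).
    by right; field; lra.
  have h8 : Rabs S0 <= G * (b + 1) * T ^ 2.
    apply: (Rle_trans (@Rabs_rsum n (fun m => g (INR m / T ^ 2)))).
    apply: (Rle_trans (weight_count n Hs hG _)); first by lra.
    rewrite Rmult_assoc; apply: Rmult_le_compat_l; first by lra.
    by nra.
  have -> : c0 * S0 - T ^ 2 / s * (I1 * I2) = (c0 - I2 * / s) * S0 + (I2 * / s) * (S0 - T ^ 2 * I1).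
    by rewrite /Rdiv; ring.
  apply: (Rle_trans (Rabs_triang _ _)); rewrite !Rabs_mult (Rabs_pos_eq (/ s)); last by lra.
  apply: Rplus_le_compat.
    apply: (@Rle_trans _ (C5 * / INR J * (G * (b + 1) * T ^ 2))).
      by apply: Rmult_le_compat => //; apply: Rabs_pos.
    rewrite (_ : C5 * / INR J * (G * (b + 1) * T ^ 2) = D3 * (/ INR J * T ^ 2)); last by rewrite /D3; ring.
    rewrite -[X in _ <= X]Rmult_1_r; apply: Rmult_le_compat_l; first by lra.
    by apply: (Rmult_le_reg_l (INR J)); [lra | rewrite -Rmult_assoc Rinv_r; lra].
  rewrite /D4 (Rmult_assoc (Rabs I2) C6) (Rmult_comm C6) -Rmult_assoc.
  by apply: Rmult_le_compat_l => //; apply: Rmult_le_pos; [exact: Rabs_pos | lra].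
set S1 := rsum n _ in e1 *.
have X1 : 1 <= T * Rpower T eps by nra.
have X2 : 0 <= T * sqrt T * sqrt (/ s) * Rpower T eps.
  by repeat apply: Rmult_le_pos; try exact: sqrt_pos; lra.
have tri : Rabs (S1 - T ^ 2 / s * (I1 * I2)) <=
   D1 * (T * Rpower T eps) + D2 * (T * sqrt T * sqrt (/ s) * Rpower T eps) + (D3 + D4 * / s).
  have -> : S1 - T ^ 2 / s * (I1 * I2) =
    (S1 - SS) + ((SS - c0 * S0) + (c0 * S0 - T ^ 2 / s * (I1 * I2))) by ring.
  apply: (Rle_trans (Rabs_triang _ _)); rewrite Rplus_assoc.
  apply: Rplus_le_compat; first exact: e1.
  by apply: (Rle_trans (Rabs_triang _ _)); apply: Rplus_le_compat.
apply: (Rle_trans tri).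
move: X1 X2 is0.
move: (T * sqrt T * sqrt (/ s) * Rpower T eps) (T * Rpower T eps) => y x.
move: (/ s) => z hx hy hz.
have q1 : D3 <= D3 * x by nra.
have q2 : 0 <= (D2 + D4) * x + (D1 + D3 + D4) * y + (D1 + D2 + D3) * z.
  by repeat apply: Rplus_le_le_0_compat; apply: Rmult_le_pos; lra.
by nra.
Qed.

(** The bump is narrower than [1/T], so that [density] bounds the sum by
    [T^(1+eps)], and the main term is at most [T^2 / s <= T]. *)
Lemma count_narrow g b phi phi' a' b' G' w r L eps :
  lip_weight phi phi' G' -> supported phi a' b' -> (forall x, Rabs (g x) <= phi x) ->
  lip_bump w r L -> 0 < eps -> exists C, 0 < C /\
  forall T s n A nz, 1 <= T -> T <= s -> b' * T ^ 2 <= INR n ->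
  Rabs (\rsum_(m < n) (g (INR m / T ^ 2) * per_sum w s A nz (alpha m))
        - T ^ 2 / s * (RInt g (- b) b * RInt w (- r) r))
  <= C * (T * Rpower T eps).
Proof.
move=> Hp Hps gp Hw e0.
have phi0 x : 0 <= phi x by apply: Rle_trans (gp x); exact: Rabs_pos.
have [C1 [C10 H1]] := @density phi phi' a' b' G' eps Hp Hps phi0 e0.
have [r0 L0 hb _ hz] := Hw.
set II := _ * RInt w _ _.
exists (L * (C1 * (1 + r)) + Rabs II).
split; first by have := Rabs_pos II; have : 0 < L * (C1 * (1 + r)) by [repeat apply: Rmult_lt_0_compat; lra]; lra.
move=> T s n A nz T1 Ts bn.
have TE := @Rpower_ge1 T eps T1 (Rlt_le _ _ e0).
have is0 : 0 < / s by apply: Rinv_0_lt_compat; lra.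
have iT : T * / s <= 1.
  by apply: (Rmult_le_reg_r s); [lra | rewrite Rmult_assoc Rinv_l; lra].
have rs0 : 0 < r / s by apply: Rdiv_lt_0_compat; lra.
have h := H1 T n 0 (r / s) A nz T1 bn ltac:(lra).
have e1 : Rabs (\rsum_(m < n) (g (INR m / T ^ 2) * per_sum w s A nz (alpha m))) <=
    L * (C1 * (1 + r)) * (T * Rpower T eps).
  apply: (@Rle_trans _ (L * \rsum_(m < n) (phi (INR m / T ^ 2) *
     rzsum A nz (fun z => near (r / s) (IZR z - (alpha m + 0)))))).
    rewrite -rsum_scal; apply: (Rle_trans (@Rabs_rsum n (fun m => g (INR m / T ^ 2) * _))).
    apply: (@rsum_le n (fun m => Rabs (g (INR m / T ^ 2) * per_sum w s A nz (alpha m)))) => m _.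
    rewrite Rabs_mult.
    have hp : Rabs (per_sum w s A nz (alpha m)) <= L * rzsum A nz (fun z => near (r / s) (IZR z - (alpha m + 0))).
      rewrite -rzsum_scal; apply: Rabs_rzsum_le => z _; rewrite Rplus_0_r.
      case: (Rle_dec (Rabs (IZR z - alpha m)) (r / s)) => hn.
        by rewrite (near_in hn) Rmult_1_r; apply: hb.
      rewrite (near_out hn) Rmult_0_r hz ?Rabs_R0; first by lra.
      rewrite Rabs_mult (Rabs_pos_eq s); last by lra.
      apply: (@Rle_trans _ (s * (r / s))); first by right; field; lra.
      by apply: Rmult_le_compat_l; lra.
    apply: (@Rle_trans _ (phi (INR m / T ^ 2) * (L * rzsum A nz (fun z => near (r / s) (IZR z - (alpha m + 0)))))).
      by apply: Rmult_le_compat => //; exact: Rabs_pos.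
    by right; ring.
  rewrite Rmult_assoc; apply: Rmult_le_compat_l; first by lra.
  apply: (Rle_trans h); apply: Rmult_le_compat_r; first by nra.
  apply: Rmult_le_compat_l; first by lra.
  rewrite (_ : r / s * T = r * (T * / s)); last by rewrite /Rdiv; ring.
  by nra.
have e2 : Rabs (T ^ 2 / s * II) <= Rabs II * (T * Rpower T eps).
  rewrite Rabs_mult Rmult_comm; apply: Rmult_le_compat_l; first exact: Rabs_pos.
  rewrite (_ : T ^ 2 / s = T * (T * / s)); last by rewrite /Rdiv; ring.
  rewrite Rabs_pos_eq; last by apply: Rmult_le_pos; nra.
  by apply: Rmult_le_compat_l; lra.
by move: e1 e2; set x := rsum n _; move: (T ^ 2 / s * II) => y; split_Rabs; lra.
Qed.

(** * The counting function and its weights *)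

Lemma sum_n_rsum (f : nat -> R) n : sum_n f n = rsum n.+1 f.
Proof.
elim: n => [|n IH]; first by rewrite sum_O gsum_recr gsum_0 /= Rplus_0_l.
by rewrite sum_Sn IH [RHS]gsum_recr.
Qed.

Lemma Series_finite (f : nat -> R) B :
  (forall k, (B <= k)%coq_nat -> f k = 0) -> Series f = rsum B f.
Proof.
move=> H; apply: is_series_unique.
apply: (@filterlim_ext_loc _ _ _ _ _ (fun=> rsum B f)); last exact: filterlim_const.
exists B => n hn; rewrite sum_n_rsum (_ : n.+1 = (B + (n.+1 - B))%N); last by lia.
rewrite gsum_cat (_ : rsum (n.+1 - B) (fun i => f (B + i)%N) = 0); first by rewrite /= Rplus_0_r.
by apply: gsum_idx => i _; rewrite H //; lia.
Qed.

Lemma sum_Z_finite (f : Z -> R) A n :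
  (forall z, (z < A \/ A + Z.of_nat n <= z)%Z -> f z = 0) -> sum_Z f = rzsum A n f.
Proof.
move=> H; pose B := (Z.abs_nat A + n)%N.
rewrite /sum_Z (@Series_finite _ B); last by move=> k hk; apply: H; lia.
rewrite (@Series_finite (fun k => f (- Z.of_nat k.+1)%Z) B); last by move=> k hk; apply: H; lia.
rewrite (@zsum_window _ _ _ A n (- Z.of_nat B) (B + B)) //; last by move=> z hz; apply: H; lia.
rewrite rzsum_cat Rplus_comm; congr (_ + _).
  elim: B => [|B IH]; first by rewrite /zsum !gsum_0.
  rewrite gsum_recr IH (rzsum_cat _ 1 B) rzsum_1.
  rewrite (_ : (- Z.of_nat B.+1 + Z.of_nat 1 = - Z.of_nat B)%Z); last by lia.
  exact: Rplus_comm.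
by rewrite (_ : (- Z.of_nat B + Z.of_nat B = 0)%Z) ?zsum_nat //; lia.
Qed.

Lemma sum_Z_0 (f : Z -> R) : (forall z, f z = 0) -> sum_Z f = 0.
Proof. by move=> H; rewrite (@sum_Z_finite f 0%Z 0) // /zsum gsum_0. Qed.

Lemma fourier_at_0_RInt w r L : lip_bump w r L -> fourier_at_0 w = RInt w (- r) r.
Proof.
move=> hw; have ex a b := @lip_bump_ex_RInt w r L a b hw; have [r0 _ _ _ _] := hw.
rewrite /fourier_at_0.
apply: (@is_RInt_gen_unique R_CompleteNormedModule _ _
  (Proper_StrongProper _ (Rbar_locally_filter m_infty))
  (Proper_StrongProper _ (Rbar_locally_filter p_infty)) w).
move=> P hP.
apply: (@Filter_prod _ _ _ _ _ (fun x => x < - r) (fun x => r < x)).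
- by exists (- r).
- by exists r.
move=> x y hx hy /=; exists (RInt w (- r) r); split; last first.
  by case: hP => e he; apply: he; apply: ball_center.
rewrite -(@RInt_enlarge w r L x y hw); try lra.
exact: RInt_correct.
Qed.

Lemma bounded_of_compact_support (f : R -> R) R0 : (forall x, continuous f x) ->
  (forall x, R0 <= Rabs x -> f x = 0) -> exists M, 0 < M /\ forall x, Rabs (f x) <= M.
Proof.
move=> hc hz.
have [M HM] := @bounded_continuity R_AbsRing R_NormedModule f (- R0) R0 (fun x _ => hc x).
exists (Rabs M + 1); split; first by have := Rabs_pos M; lra.
move=> x; case: (Rle_dec R0 (Rabs x)) => h.
  by rewrite hz // Rabs_R0; have := Rabs_pos M; lra.
have := HM x ltac:(split_Rabs; lra); rewrite /norm /= /abs /= => h2.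
by have := Rle_abs M; lra.
Qed.

(** Three derivatives are used: the third makes the second continuous, hence
    bounded on the compact support, and this bounds the Lipschitz constant of
    the first. *)
Lemma smooth_weight w : smooth w -> compactly_supported w ->
  exists r G, 0 < r /\ (forall x, r <= Rabs x -> w x = 0) /\
  lip_weight w (Derive w) G.
Proof.
move=> hs /compact_P1[m [M hmM]].
pose r1 := Rabs m + Rabs M + 1.
have z0 x : r1 <= Rabs x -> w x = 0.
  move=> hx; apply: Classical_Prop.NNPP => hn.
  have := hmM x (adherence_P1 (fun x => w x <> 0) x hn).
  by rewrite /r1 in hx; split_Rabs; lra.
have D0 x : is_derive w x (Derive w x) by apply: Derive_correct; exact: (hs 1%N x).
have D1 x : is_derive (Derive w) x (Derive (Derive w) x).
  by apply: Derive_correct; exact: (hs 2%N x).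
have D2 x : ex_derive (Derive (Derive w)) x by exact: (hs 3%N x).
have zloc (f : R -> R) x t : (forall x, t <= Rabs x -> f x = 0) -> t + 1 <= Rabs x -> Derive f x = 0.
  move=> hz hx; rewrite (@Derive_ext_loc f (fun=> 0)); first exact: Derive_const.
  apply: (@locally_of_interval (x - 1) (x + 1)); first by lra.
  by move=> y hy; apply: hz; split_Rabs; lra.
have z1 x : r1 + 1 <= Rabs x -> Derive w x = 0 by apply: zloc.
have z2 x : r1 + 1 + 1 <= Rabs x -> Derive (Derive w) x = 0 by apply: zloc.
have [M0 [M00 B0]] := @bounded_of_compact_support w r1 (fun x => ex_derive_continuous _ _ (ex_intro _ _ (D0 x))) z0.
have [M1 [M10 B1]] := @bounded_of_compact_support (Derive w) (r1 + 1) (fun x => ex_derive_continuous _ _ (ex_intro _ _ (D1 x))) z1.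
have [M2 [M20 B2]] := @bounded_of_compact_support (Derive (Derive w)) (r1 + 1 + 1) (fun x => ex_derive_continuous _ _ (D2 x)) z2.
exists r1, (M0 + M1 + M2); split; first by rewrite /r1; split_Rabs; lra.
split=> //; split=> //; first by lra.
- by move=> x; have := B0 x; lra.
- by move=> x; have := B1 x; lra.
move=> x y.
have := @lipschitz_of_derive (Derive w) (Derive (Derive w)) (Rmin x y) (Rmax x y) M2 (fun z _ => D1 z) (fun z _ => B2 z) x y.
move=> /(_ (conj (Rmin_l _ _) (Rmax_l _ _)) (conj (Rmin_r _ _) (Rmax_r _ _))) h.
apply: (Rle_trans h); apply: Rmult_le_compat_r; [exact: Rabs_pos | lra].
Qed.

(** Otherwise 0 would be adherent to the points where [w] does not vanish, which
    are all positive. *)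
Lemma positive_support w : Rtopology.included (support w) (fun x => 0 < x) ->
  exists a, 0 < a /\ forall x, x <= a -> w x = 0.
Proof.
move=> hpos; apply: Classical_Prop.NNPP => hno.
suff : 0 < 0 by lra.
apply: (hpos 0) => V [d hd].
apply: Classical_Prop.NNPP => hV; apply: hno.
have dp := cond_pos d.
exists (d / 2); split; first by lra.
move=> x hx; apply: Classical_Prop.NNPP => hn; apply: hV.
have x0 : 0 < x by apply/hpos/adherence_P1.
exists x; split=> //; apply: hd; rewrite /disc Rminus_0_r Rabs_pos_eq; lra.
Qed.

Lemma lip_weight_scale g g' G c k t : 0 < c -> 0 < k -> lip_weight g g' G ->
  lip_weight (fun x => c * g (k * (x - t))) (fun x => c * k * g' (k * (x - t)))
    (c * G * (1 + k) ^ 2).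
Proof.
move=> c0 k0 [G0 hd hb hb' hl].
have e1 : 0 < c * G by apply: Rmult_lt_0_compat.
split.
- by apply: Rmult_lt_0_compat => //; nra.
- move=> x.
  have D := @is_derive_compR g (fun x => k * (x - t)) x (g' (k * (x - t))) k (hd _).
  have {}D := D ltac:(auto_derive => //; ring).
  have := is_derive_scal _ x c _ D; rewrite /scal /= /mult /=.
  by rewrite (_ : c * (g' (k * (x - t)) * k) = c * k * g' (k * (x - t))) //; ring.
- move=> x; rewrite Rabs_mult (Rabs_pos_eq c); last by lra.
  apply: (Rle_trans (Rmult_le_compat_l c (Rlt_le _ _ c0) (hb _))); nra.
- move=> x; rewrite Rabs_mult (Rabs_pos_eq (c * k)); last by nra.
  apply: (@Rle_trans _ (c * k * G)); first by apply: Rmult_le_compat_l => //; nra.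
  by rewrite (_ : c * k * G = c * G * k); [apply: Rmult_le_compat_l; nra | ring].
- move=> x y; rewrite -Rmult_minus_distr_l Rabs_mult (Rabs_pos_eq (c * k)); last by nra.
  apply: (@Rle_trans _ (c * k * (G * Rabs (k * (x - t) - k * (y - t))))).
    by apply: Rmult_le_compat_l => //; nra.
  have -> : k * (x - t) - k * (y - t) = k * (x - y) by ring.
  rewrite Rabs_mult (Rabs_pos_eq k); last by lra.
  rewrite (_ : c * k * (G * (k * Rabs (x - y))) = c * G * (k * k) * Rabs (x - y)); last by ring.
  apply: Rmult_le_compat_r; first exact: Rabs_pos.
  by apply: Rmult_le_compat_l; nra.
Qed.

Lemma lip_weight_om : lip_weight om om' 8.
Proof.
split; first by lra.
- exact: is_derive_om.
- by move=> x; have := om_range x; split_Rabs; lra.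
- by move=> x; have := om'_bound x; lra.
- exact: om'_lip.
Qed.

(** A dilated and translated copy of [om], centred at the middle of the support
    and large enough on it; its own support still avoids 0. *)
Lemma majorant g a b G : supported g a b -> 0 < G -> (forall x, Rabs (g x) <= G) ->
  exists phi phi' a' b' G', [/\ lip_weight phi phi' G', supported phi a' b',
    forall x, Rabs (g x) <= phi x & b <= b'].
Proof.
move=> [a0 [ab hz]] G0 hG.
pose t := (a + b) / 2; pose k := 2 / b; pose s := 1 - a / b.
have k0 : 0 < k by apply: Rdiv_lt_0_compat; lra.
have ib : 0 < / b by apply: Rinv_0_lt_compat; lra.
have bib : b * / b = 1 by apply: Rinv_r; lra.
have s0 : 0 < s < 1.
  rewrite /s /Rdiv; have : a * / b < b * / b by apply: Rmult_lt_compat_r; lra.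
  by have : 0 < a * / b by [apply: Rmult_lt_0_compat]; lra.
have [p1 p2] := PI_bounds.
have os : 0 < om s.
  rewrite /om clamp_id; last by lra.
  suff : -1 < cos (PI * s) by lra.
  by rewrite -cos_PI; apply: cos_decreasing_1; nra.
pose c := G / om s; have c0 : 0 < c by apply: Rdiv_lt_0_compat.
have om_mono u : Rabs u <= s -> om s <= om u.
  have : om u = om (Rabs u) by rewrite /Rabs; case: Rcase_abs => // _; rewrite om_even.
  move=> -> hu; have u0 := Rabs_pos u.
  rewrite /om !clamp_id; try lra.
  suff : cos (PI * s) <= cos (PI * Rabs u) by lra.
  by apply: cos_decr_1; nra.
exists (fun x => c * om (k * (x - t))), (fun x => c * k * om' (k * (x - t))), (a / 2), (a / 2 + b), (c * 8 * (1 + k) ^ 2).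
have kb : k * b = 2 by rewrite /k; field; lra.
split.
- by apply: lip_weight_scale => //; exact: lip_weight_om.
- split; first by lra.
  split; first by lra.
  move=> x hx; rewrite om_zero ?Rmult_0_r //.
  rewrite Rabs_mult (Rabs_pos_eq k); last by lra.
  have : b / 2 <= Rabs (x - t) by rewrite /t; split_Rabs; lra.
  by nra.
- move=> x; case: (Rle_dec x a) => h1.
    rewrite hz ?Rabs_R0; last by left.
    by apply: Rmult_le_pos; [lra | case: (om_range (k * (x - t)))].
  case: (Rle_dec b x) => h2.
    rewrite hz ?Rabs_R0; last by right.
    by apply: Rmult_le_pos; [lra | case: (om_range (k * (x - t)))].
  apply: (Rle_trans (hG x)).
  have -> : G = c * om s by rewrite /c; field; lra.
  apply: Rmult_le_compat_l; first by lra.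
  apply: om_mono; rewrite Rabs_mult (Rabs_pos_eq k); last by lra.
  have : Rabs (x - t) <= (b - a) / 2 by rewrite /t; split_Rabs; lra.
  have : k * ((b - a) / 2) = s by rewrite /k /s; field; lra.
  by nra.
- by lra.
Qed.

Lemma alpha_Rpower m : (0 < m)%coq_nat -> Rpower (INR m) (3 / 2) = alpha m.
Proof.
move=> m0; have p : 0 < INR m by apply: lt_0_INR.
rewrite /alpha -Rpower_sqrt // -Rpower_pow; last exact: exp_pos.
by rewrite Rpower_mult; congr Rpower; rewrite /=; field.
Qed.

Lemma alpha_le m n : (m <= n)%coq_nat -> 0 <= alpha m <= alpha n.
Proof.
move=> mn; split; first by apply: pow_le; exact: sqrt_pos.
by apply: pow_incr; split; [exact: sqrt_pos | apply: sqrt_le_1_alt; apply: le_INR].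
Qed.

(** The window [A .. A + nz] has to contain every [n] within [r / s] of some
    [alpha m]; outside it, and for [m] outside the support of [w1], all terms
    vanish. *)
Lemma T_S_finite w1 w2 a b r L N X n A nz : supported w1 a b -> lip_bump w2 r L ->
  0 < N -> 0 < X -> let T := Rpower N (1 / 3) in let s := N / X in
  b * T ^ 2 <= INR n ->
  (forall m, (m < n)%coq_nat -> IZR A <= alpha m - (r / s + 2) /\
     alpha m + (r / s + 3) <= IZR (A + Z.of_nat nz)) ->
  T_S w1 w2 N X = \rsum_(m < n) (w1 (INR m / T ^ 2) * per_sum w2 s A nz (alpha m)).
Proof.
move=> [a0 [ab hz]] [r0 _ _ _ hz2] N0 X0 T s bn hwin.
have T0 : 0 < T by apply: exp_pos.
have T2 : 0 < T ^ 2 by nra.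
have TE : Rpower N (2 / 3) = T ^ 2.
  rewrite -Rpower_pow // /T Rpower_mult; congr Rpower; rewrite /=; field.
have s0 : 0 < s by apply: Rdiv_lt_0_compat.
rewrite /T_S -/s TE (@sum_Z_finite _ 0%Z n).
  rewrite zsum_nat; apply: gsum_eq => m mn.
  rewrite -INR_IZR_INZ; case: (Nat.eq_dec m 0) => [E|m0].
    have w0 : w1 (INR m / T ^ 2) = 0.
      by apply: hz; left; rewrite E /= /Rdiv Rmult_0_l; lra.
    by rewrite w0 Rmult_0_l sum_Z_0 // => z; rewrite Rmult_0_l.
  rewrite alpha_Rpower; last by lia.
  have [h1 h2] := hwin m mn.
  rewrite (@sum_Z_finite _ A nz); first by rewrite rzsum_scal.
  move=> z hzz; rewrite hz2 ?Rmult_0_r //.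
  rewrite Rabs_mult (Rabs_pos_eq s); last by lra.
  apply: (@Rle_trans _ (s * (r / s))); first by right; field; lra.
  apply: Rmult_le_compat_l; first by lra.
  case: hzz => hzz.
    have : IZR z <= IZR A by apply: IZR_le; lia.
    by split_Rabs; lra.
  have : IZR (A + Z.of_nat nz) <= IZR z by apply: IZR_le.
  have : 0 < r / s by apply: Rdiv_lt_0_compat.
  by split_Rabs; lra.
move=> m hm; apply: sum_Z_0 => z; rewrite hz ?Rmult_0_l //.
have iT : 0 < / T ^ 2 by apply: Rinv_0_lt_compat.
case: hm => hm.
  left; have : IZR m <= 0 by apply: IZR_le; lia.
  by rewrite /Rdiv; nra.
right; apply: (Rmult_le_reg_r (T ^ 2)) => //.
rewrite /Rdiv Rmult_assoc Rinv_l ?Rmult_1_r; last by lra.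
apply: (Rle_trans bn); rewrite INR_IZR_INZ; apply: IZR_le; lia.
Qed.


Theorem theorem1p2 (w1 w2 : R -> R)
  (w1_smooth : smooth w1) (w2_smooth : smooth w2)
  (w1_compact : compactly_supported w1) (w2_compact : compactly_supported w2)
  (w1_pos : Rtopology.included (support w1) (fun x => 0 < x)) :
  forall eps c0 : R, 0 < eps -> 0 < c0 ->
  exists C : R, 0 < C /\
    forall N X : R, 1 <= N -> 0 < X -> c0 * Rpower X (1 / 2) <= N ->
      let M := Rpower N (2 / 3) in
      Rabs (T_S w1 w2 N X
            - X * M / N * fourier_at_0 w1 * fourier_at_0 w2)
      <= C * (Rpower N (1 / 3 + eps) + Rpower X (1 / 2) * Rpower N eps).
Proof.
move=> eps c0 e0 c00.
have [r1 [G1 [r10 [z1 W1]]]] := smooth_weight w1_smooth w1_compact.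
have [r [L [r0 [z2 W2]]]] := smooth_weight w2_smooth w2_compact.
have [a [a0 za]] := positive_support w1_pos.
pose b := r1 + a.
have Hs : supported w1 a b.
  split=> //; split; first by rewrite /b; lra.
  move=> x [hx|hx]; [exact: za | apply: z1].
  by rewrite /b in hx; split_Rabs; lra.
have [L0 _ hb2 _ _] := W2; have [G10 _ hb1 _ _] := W1.
have Hw : lip_bump w2 r L by split=> //; exact: lip_weight_lip W2.
have [phi [phi' [a' [b' [G' [Hp Hps gp bb']]]]]] := majorant Hs G10 hb1.
have [C1 [C10 H1]] := count_wide W1 Hs Hp Hps gp bb' Hw e0.
have [C2 [C20 H2]] := @count_narrow w1 b phi phi' a' b' G' w2 r L eps Hp Hps gp Hw e0.
rewrite (fourier_at_0_RInt (weight_lip_bump W1 Hs)) (fourier_at_0_RInt Hw).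
set I1 := RInt w1 _ _; set I2 := RInt w2 _ _.
have ic0 : 0 < / c0 by apply: Rinv_0_lt_compat.
exists ((C1 + C2) * (1 + / c0)); split; first by apply: Rmult_lt_0_compat; lra.
move=> N X N1 X0 NX M.
pose T := Rpower N (1 / 3); pose s := N / X.
have T1 : 1 <= T by apply: Rpower_ge1; lra.
have s0 : 0 < s by apply: Rdiv_lt_0_compat; lra.
have T3 : T ^ 3 = N.
  rewrite -Rpower_pow ?/T ?Rpower_mult; last exact: exp_pos.
  by rewrite (_ : 1 / 3 * INR 3 = 1) ?Rpower_1 /=; lra.
have ME : M = T ^ 2.
  rewrite -Rpower_pow; last exact: exp_pos.
  by rewrite /M /T Rpower_mult; congr Rpower; rewrite /=; field.
have T2 : 1 <= T ^ 2 by nra.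
have b'0 : 0 < b' by case: Hps => h1 [h2 _]; lra.
(* [n] exceeds every [m] in the support, and [- B .. B] contains every integer
   near some [alpha m] *)
have [u1 u2] := archimed (b' * T ^ 2).
have u0 : (0 < up (b' * T ^ 2))%Z by apply: lt_IZR; nra.
pose n := Z.to_nat (up (b' * T ^ 2)).
have nE : INR n = IZR (up (b' * T ^ 2)) by rewrite INR_IZR_INZ /n Z2Nat.id //; lia.
have bn : b' * T ^ 2 <= INR n by lra.
have bn' : b * T ^ 2 <= INR n by apply: Rle_trans bn; apply: Rmult_le_compat_r; lra.
pose B := up (alpha n + (r / s + 3)).
have [v1 _] := archimed (alpha n + (r / s + 3)); rewrite -/B in v1.
have rs : 0 < r / s by apply: Rdiv_lt_0_compat.
have an := proj1 (alpha_le (le_n n)).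
have B0 : (0 < B)%Z by apply: lt_IZR; lra.
pose nz := Z.to_nat (2 * B).
have hwin m : (m < n)%coq_nat -> IZR (- B) <= alpha m - (r / s + 2) /\
    alpha m + (r / s + 3) <= IZR (- B + Z.of_nat nz).
  move=> mn; have [h1 h2] := @alpha_le m n ltac:(lia).
  rewrite (_ : (- B + Z.of_nat nz = B)%Z); last by rewrite /nz; lia.
  by rewrite opp_IZR; lra.
rewrite (@T_S_finite w1 w2 a b r L N X n (- B) nz Hs Hw) //; last by lra.
have -> : X * M / N * I1 * I2 = T ^ 2 / s * (I1 * I2) by rewrite ME /s; field; lra.
rewrite -/T -/s.
have Te0 : 0 < Rpower T eps := exp_pos _.
have TeN : Rpower T eps <= Rpower N eps.
  rewrite /T Rpower_mult; apply: Rle_Rpower; first by lra.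
  by lra.
have F1 : T * Rpower T eps <= Rpower N (1 / 3 + eps).
  by rewrite Rpower_plus; apply: Rmult_le_compat_l; lra.
pose x2 := Rpower X (1 / 2); have x20 : 0 < x2 := exp_pos _.
have xx : x2 * x2 = X.
  by rewrite /x2 -Rpower_plus (_ : 1 / 2 + 1 / 2 = 1) ?Rpower_1 //; field.
(* [T^3 = N] and [s = N / X] *)
have F2 : T * sqrt T * sqrt (/ s) * Rpower T eps <= x2 * Rpower N eps.
  have -> : T * sqrt T * sqrt (/ s) = x2.
    have is0 : 0 < / s by apply: Rinv_0_lt_compat.
    have TT : 0 <= T * T by apply: Rmult_le_pos; lra.
    have -> : T * sqrt T = sqrt (T * T * T).
      by rewrite (sqrt_mult (T * T)) // ?sqrt_square; lra.
    rewrite -sqrt_mult; [| by apply: Rmult_le_pos; lra | lra].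
    rewrite -[RHS](sqrt_square x2); last by lra.
    rewrite xx (_ : T * T * T = N) -?T3; last by ring.
    by congr sqrt; rewrite T3 /s; field; lra.
  by apply: Rmult_le_compat_l; lra.
have Ne1 : 1 <= Rpower N eps by apply: Rpower_ge1; lra.
(* [X / N <= X^(1/2) / c0] is the hypothesis times [X^(1/2)] *)
have F3 : / s <= / c0 * (x2 * Rpower N eps).
  apply: (@Rle_trans _ (/ c0 * x2)).
    apply: (Rmult_le_reg_l (N * c0)); first by nra.
    rewrite (_ : N * c0 * / s = c0 * X); last by rewrite /s; field; lra.
    rewrite (_ : N * c0 * (/ c0 * x2) = N * x2); last by field; lra.
    have := Rmult_le_compat_r x2 (Rlt_le _ _ x20) NX; rewrite -/x2.
    by rewrite -xx; lra.
  by apply: Rmult_le_compat_l; [lra | rewrite -[X in X <= _]Rmult_1_r; apply: Rmult_le_compat_l; lra].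
set Y1 := Rpower N (1 / 3 + eps) in F1 *; have Y10 : 0 < Y1 := exp_pos _.
set Y2 := x2 * Rpower N eps in F2 F3 *.
have Y20 : 0 < Y2 by apply: Rmult_lt_0_compat; lra.
have fin : (C1 + C2) * (Y1 + Y2 + / c0 * Y2) <= (C1 + C2) * (1 + / c0) * (Y1 + Y2).
  rewrite Rmult_assoc; apply: Rmult_le_compat_l; first by lra.
  by have : 0 <= / c0 * Y1 by [apply: Rmult_le_pos; lra]; lra.
apply: Rle_trans fin.
have c2Y : 0 <= / c0 * Y2 by apply: Rmult_le_pos; lra.
case: (Rle_dec s T) => sT.
  apply: (Rle_trans (H1 T s n (- B)%Z nz T1 s0 sT bn hwin)).
  apply: (@Rle_trans _ (C1 * (Y1 + Y2 + / c0 * Y2))).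
    by apply: Rmult_le_compat_l; lra.
  by apply: Rmult_le_compat_r; lra.
apply: (Rle_trans (H2 T s n (- B)%Z nz T1 ltac:(lra) bn)).
apply: (@Rle_trans _ (C2 * (Y1 + Y2 + / c0 * Y2))).
  by apply: Rmult_le_compat_l; lra.
by apply: Rmult_le_compat_r; lra.
Qed.
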